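(* Let $V(x,y)=q_{\rm av}(x)+q(x,y)=q_{\rm av}(x)+\sum_{j\neq 0}q_j(x)e^{2\pi i\lambda_j y}$ satisfy Hypotheses (V) with parameters $\theta,\beta>0$, and let $K\subset\mathbb{C}$ satisfy Hypotheses (K) with parameter $0<\alpha<\beta/2$. Set $q_\epsilon(x)=q(x,x/\epsilon)$, $V_\epsilon(x)=V(x,x/\epsilon)=q_{\rm av}(x)+q_\epsilon(x)$, and define the effective potential well $$\sigma_{\rm eff}^\epsilon(x)=-\epsilon^2\Lambda_{\rm eff}(x),\qquad \Lambda_{\rm eff}(x)=\frac{1}{(2\pi)^2}\sum_{j\in\mathbb{Z}\setminus\{0\}}\frac{|q_j(x)|^2}{\lambda_j^2}.$$ Then there exist $\epsilon_0>0$ and a constant $C=C\big(N_\beta(V),\sup_{k\in K}|k|\big)$, independent of $\epsilon$, such that for all $0<\epsilon<\epsilon_0$ $$\sup_{k\in K}\left|\frac{k}{t^{q_{\rm av}+\sigma_{\rm eff}^\epsilon}(k)}-\frac{k}{t^{q_{\rm av}+q_\epsilon}(k)}\right|\le \epsilon^3\,M_K\,C,\qquad M_K=\max\Big(1,\sup_{k\in K}|t^{q_{\rm av}}(k)|\Big).$$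
   Context: Function spaces: for $\beta>0$, $L^\infty_\beta$ is the space of measurable $g:\mathbb{R}\to\mathbb{C}$ with $|g|_{L^\infty_\beta}=\operatorname{ess\,sup}_x e^{\beta|x|}|g(x)|<\infty$, and $|g|_{W^{n,\infty}_\beta}=\sum_{l=0}^n|\partial_x^l g|_{L^\infty_\beta}$. Hypotheses (V): $V(x,y)=q_{\rm av}(x)+\sum_{j\in\mathbb{Z}\setminus\{0\}}q_j(x)e^{2\pi i\lambda_jy}$ is real-valued with $q_{\rm av}$ real-valued, $\overline{q_j}=q_{-j}$, $\lambda_{-j}=-\lambda_j$; there are $\theta,\beta>0$ with $\inf_{j\ne k}|\lambda_j-\lambda_k|\ge\theta$ and $\inf_{j\neq 0}|\lambda_j|\ge\theta$ ($\lambda_j$ real); and $N_\beta(V):=|q_{\rm av}|_{W^{1,\infty}_\beta}+\sum_{j\ne0}|q_j|_{W^{3,\infty}_\beta}<\infty$. Jost solutions and transmission coefficient: for real-valued $U\in L^\infty_\beta$ and $k\in\mathbb{C}$ with $|\Im k|<\beta/2$, $f^U_\pm(x;k)$ are the unique solutions of $f^U_+(x;k)=e^{ikx}+\int_x^\infty\frac{\sin(k(y-x))}{k}U(y)f^U_+(y;k)\,dy$ and $f^U_-(x;k)=e^{-ikx}-\int_{-\infty}^x\frac{\sin(k(y-x))}{k}U(y)f^U_-(y;k)\,dy$ (with $\sin(kz)/k=z$ at $k=0$); they solve $(-\partial_x^2+U-k^2)u=0$. With $\mathcal{W}[h_1,h_2]=h_1h_2'-h_2h_1'$, the transmission coefficient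 $t^U$ is defined by $\mathcal{W}[f^U_+,f^U_-](k)=-2ik/t^U(k)$; it is meromorphic, values at removable singularities are taken by continuity, and $k/t^U(k)$ denotes $-\mathcal{W}[f_+^U,f_-^U](k)/(2i)$, defined for all such $k$. Hypotheses (K): $K$ is a compact subset of $\mathbb{C}$ with $K\subset\{|\Im k|<\alpha\}$, $0<\alpha<\beta/2$, and $K$ contains no pole of $t^{q_{\rm av}}$ (so $M_K<\infty$). Constants may also depend on the fixed parameters $\alpha,\beta,\theta$. *)

(* Defs.v *)
From HB Require Import structures.
From mathcomp Require Import all_boot all_order all_algebra.
From mathcomp Require Import all_classical all_reals all_analysis.
From mathcomp Require Import ess_sup_inf complex.

Set Implicit Arguments.
Unset Strict Implicit.
Unset Printing Implicit Defensive.

Import Order.TTheory GRing.Theory Num.Theory.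
Import numFieldNormedType.Exports.
Import ComplexField.Normc.

Local Open Scope classical_set_scope.
Local Open Scope ring_scope.
Local Open Scope complex_scope.

Section Complex_valued_functions.
Context {R : realType}.
Local Notation C := R[i].
Local Notation mu := (@lebesgue_measure R).

Definition cexp (z : C) : C :=
  (expR (complex.Re z))%:C
  * (cos (complex.Im z) +i* sin (complex.Im z)).

Definition csin (z : C) : C := (cexp ('i * z) - cexp (- ('i * z))) / ('i *+ 2).

Definition sink (k : C) (z : R) : C :=
  if k == 0 then z%:C else csin (k * z%:C) / k.

Definition cderive1 (f : R -> C) (x : R) : C :=
  derive1 (fun y => complex.Re (f y)) x +i* derive1 (fun y => complex.Im (f y)) x.

Definition cintegrable (D : set R) (f : R -> C) : Prop :=
  mu.-integrable D (fun x => (complex.Re (f x))%:E) /\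
  mu.-integrable D (fun x => (complex.Im (f x))%:E).

Definition cint (D : set R) (f : R -> C) : C :=
  (\int[mu]_(x in D) complex.Re (f x)) +i* (\int[mu]_(x in D) complex.Im (f x)).

Definition clocally_integrable (f : R -> C) : Prop :=
  locally_integrable setT (fun x => complex.Re (f x)) /\
  locally_integrable setT (fun x => complex.Im (f x)).

(* Compactly supported C^1 functions determine the same weak derivatives as
   compactly supported smooth ones. *)
Definition test_function (phi : R -> R) : Prop :=
  [/\ forall x, derivable phi x 1,
      continuous (derive1 phi) &
      exists M, forall x, M < `|x| -> phi x = 0].

Definition weak_derivative (g h : R -> C) : Prop :=
  [/\ clocally_integrable g, clocally_integrable h &
      forall phi, test_function phi ->
        cint setT (fun x => g x * (derive1 phi x)%:C)
        = - cint setT (fun x => h x * (phi x)%:C)].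

Definition Linfty_norm (beta : R) (g : R -> C) : \bar R :=
  ess_sup mu (fun x => (expR (beta * `|x|) * normc (g x))%:E).

(* The weak derivatives G l of g are unique up to null sets, so that the set
   below has at most one element; it is empty, and the norm is +oo, when g has
   no weak derivatives up to order n. *)
Definition sobolev_norm (n : nat) (beta : R) (g : R -> C) : \bar R :=
  ereal_inf [set s | exists G : nat -> R -> C,
    [/\ G 0%N = g,
        forall l, (l < n)%N -> weak_derivative (G l) (G l.+1) &
        s = (\sum_(l < n.+1) Linfty_norm beta (G l))%E]].

End Complex_valued_functions.

Section Potentials.
Context {R : realType}.
Local Notation C := R[i].

(* Sum over j in Z \ {0}, where j runs over the n + 1 and the
   Negz n = - (n + 1). It is only used for series that converge absolutely at
   almost every x, whose sums do not depend on the order of the terms. *)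
Definition sum_nonzero (a : int -> R) : R :=
  limn (series (fun n : nat => a (Posz n.+1) + a (Negz n))).

Definition csum_nonzero (a : int -> C) : C :=
  sum_nonzero (fun j => complex.Re (a j)) +i*
  sum_nonzero (fun j => complex.Im (a j)).

Definition q_osc (q : int -> R -> C) (lambda : int -> R) (x y : R) : C :=
  csum_nonzero (fun j => q j x * cexp ('i * (2 * pi * lambda j * y)%:C)).

Definition N_norm (beta : R) (qav : R -> R) (q : int -> R -> C) : \bar R :=
  (sobolev_norm 1 beta (fun x => (qav x)%:C)
   + \esum_(j in [set j : int | j != 0%R]) sobolev_norm 3 beta (q j))%E.

Record hypotheses_V (theta beta : R) (V : R -> R -> R)
    (qav : R -> R) (q : int -> R -> C) (lambda : int -> R) : Prop := {
  V_expansion : forall x y, (V x y)%:C = (qav x)%:C + q_osc q lambda x y;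
  q_conj : forall j x, j != 0 -> (q j x)^* = q (- j) x;
  lambda_opp : forall j, j != 0 -> lambda (- j) = - lambda j;
  lambda_sep : forall j k, j != 0 -> k != 0 -> j != k ->
    theta <= `|lambda j - lambda k|;
  lambda_ge : forall j, j != 0 -> theta <= `|lambda j|;
  N_norm_fin : (N_norm beta qav q < +oo)%E }.

Definition Lambda_eff (q : int -> R -> C) (lambda : int -> R) (x : R) : R :=
  ((2 * pi) ^+ 2)^-1
  * sum_nonzero (fun j => normc (q j x) ^+ 2 / lambda j ^+ 2).

Definition sigma_eff (q : int -> R -> C) (lambda : int -> R) (eps x : R) : R :=
  - eps ^+ 2 * Lambda_eff q lambda x.

End Potentials.

Section Scattering.
Context {R : realType}.
Local Notation C := R[i].

Definition is_jost_plus (U : R -> R) (k : C) (f : R -> C) : Prop :=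
  forall x, let F y := sink k (y - x) * (U y)%:C * f y in
    cintegrable `[x, +oo[ F /\
    f x = cexp ('i * k * x%:C) + cint `[x, +oo[ F.

Definition is_jost_minus (U : R -> R) (k : C) (f : R -> C) : Prop :=
  forall x, let F y := sink k (y - x) * (U y)%:C * f y in
    cintegrable `]-oo, x] F /\
    f x = cexp (- ('i * k * x%:C)) - cint `]-oo, x] F.

(* For U in L^oo_beta and |Im k| < beta / 2, each Volterra equation has exactly
   one solution whose integrals converge absolutely; xget selects it. *)
Definition jost_plus (U : R -> R) (k : C) : R -> C :=
  xget (fun=> 0) [set f | is_jost_plus U k f].

Definition jost_minus (U : R -> R) (k : C) : R -> C :=
  xget (fun=> 0) [set f | is_jost_minus U k f].

Definition wronskian (h1 h2 : R -> C) (x : R) : C :=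
  h1 x * cderive1 h2 x - h2 x * cderive1 h1 x.

(* The Wronskian of two solutions of the same Schroedinger equation does not
   depend on the point at which it is evaluated. *)
Definition jost_wronskian (U : R -> R) (k : C) : C :=
  wronskian (jost_plus U k) (jost_minus U k) 0.

Definition t_quotient (U : R -> R) (k : C) : C :=
  - ('i *+ 2) * k / jost_wronskian U k.

(* Where the Wronskian vanishes, the value is taken by continuity; this is
   meaningful at removable singularities only. The carrier R[i]^o has the
   topology of the modulus. *)
Definition transmission (U : R -> R) (k : C) : C :=
  if jost_wronskian U k == 0
  then lim ((t_quotient U z : C^o) @[z --> (k : C^o)^'])
  else t_quotient U k.

Definition transmission_pole (U : R -> R) (k : C) : Prop :=
  normc (transmission U z) @[z --> (k : C^o)^'] --> +oo.

Definition k_over_transmission (U : R -> R) (k : C) : C :=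
  - jost_wronskian U k / ('i *+ 2).

Record hypotheses_K (alpha : R) (qav : R -> R) (K : set C) : Prop := {
  K_compact : @compact C^o K;
  K_strip : forall k, K k -> `|complex.Im k| < alpha;
  K_no_pole : forall k, K k -> ~ transmission_pole qav k }.

Definition M_bound (qav : R -> R) (K : set C) : \bar R :=
  maxe 1%E (ereal_sup [set (normc (transmission qav k))%:E | k in K]).

End Scattering.

(* Main.v *)
(* Let [f] be the Jost solution f_+ for U1 = q_av + sigma_eff and [g] the Jost solution
   f_- for U2 = q_av + q_eps. The Wronskians of the two potentials differ by the integral
   of (U2 - U1) f g over the line. The Jost solutions are Volterra fixed points, and f g
   is twice differentiable and grows at most like exp (2 a |x|), which the decay of the
   potentials absorbs.

   Two integrations by parts in the mode q_j exp (2 pi i lambda_j x / eps) gain the factor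
   -(eps / (2 pi lambda_j)) ^ 2 and leave q_j'' f g + 2 q_j' (f g)' + q_j (f g)''. Since
   (f g)'' = (U1 + U2 - 2 k ^ 2) f g + 2 f' g', the last term contains q_j q_eps f g, whose
   only nonoscillating part is |q_j| ^ 2 f g. Summed over j, this part is exactly cancelled
   by - sigma_eff; all remaining terms still oscillate with frequency of order 1 / eps,
   hence one more integration by parts makes them O(eps ^ 3). The separation of the
   frequencies lambda_j enters through the modes lambda_j + lambda_l with l <> -j.

   The argument is carried out for finitely many modes, uniformly in their number, after
   replacing the coefficients by their continuous representatives. *)

Require Import Defs.
From mathcomp Require Import all_boot all_order all_algebra.
From mathcomp Require Import all_classical all_reals all_analysis.
From mathcomp Require Import ess_sup_inf complex.
From mathcomp Require Import measurable_realfun ring lra.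
Import Order.TTheory GRing.Theory Num.Theory.
Import numFieldNormedType.Exports ComplexField.Normc.
Local Open Scope classical_set_scope.
Local Open Scope ring_scope.
Local Open Scope complex_scope.

Set Implicit Arguments.
Unset Strict Implicit.
Unset Printing Implicit Defensive.

(** * Complex-valued functions *)

(** Pairing a Jost solution of one potential with one of the other makes the formula for the
    Wronskian difference exact, so no expansion in [U2 - U1] has to be controlled; the price is that
    both potentials enter [(f g)''] and that [f' g'] must be carried along. Two losses fix the
    exponents. The kernel sin(k x) / k grows linearly at k = 0, so a bound uniform in k needs a
    growth rate [a] strictly above the bound [al] on |Im k|; products of two solutions then grow
    like exp (2 a |x|), and [2 * a < be] leaves the integrable weight exp (- d |x|) with
    [d = be - 2 * a]. The Jost solutions are characterized by convergence of their Volterra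
    integrals, without a growth condition, so uniqueness has to be derived from that convergence
    before the selected solution can be identified. Singling out finitely many modes leaves
    remainders of size [tau] in both potentials. The estimate is a constant times [eps ^+ 3 + tau],
    where the constant sees the modes only through [N], [M] and [theta]; at fixed [eps] the number
    of modes can therefore go to infinity. *)

Section ComplexBasics.
Context {R : realType}.
Local Notation C := R[i].
Implicit Types (z w k : C) (f g : R -> C).

Lemma ReD z w : complex.Re (z + w) = complex.Re z + complex.Re w.
Proof. by case: z; case: w. Qed.
Lemma ImD z w : complex.Im (z + w) = complex.Im z + complex.Im w.
Proof. by case: z; case: w. Qed.
Lemma ReN z : complex.Re (- z) = - complex.Re z.
Proof. by case: z. Qed.
Lemma ImN z : complex.Im (- z) = - complex.Im z.
Proof. by case: z. Qed.
Lemma ReM z w : complex.Re (z * w)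
  = complex.Re z * complex.Re w - complex.Im z * complex.Im w.
Proof. by case: z; case: w. Qed.
Lemma ImM z w : complex.Im (z * w)
  = complex.Re z * complex.Im w + complex.Im z * complex.Re w.
Proof. by case: z => a b; case: w => c d. Qed.
Definition ReImE := (ReD, ImD, ReN, ImN, ReM, ImM).

Lemma complex_ext z w :
  complex.Re z = complex.Re w -> complex.Im z = complex.Im w -> z = w.
Proof. by case: z => a b; case: w => c d /= -> ->. Qed.

Lemma normc_ge0 z : 0 <= normc z.
Proof. by case: z => a b; exact: sqrtr_ge0. Qed.

Lemma normc_sqr z : normc z ^+ 2 = complex.Re z ^+ 2 + complex.Im z ^+ 2.
Proof. by case: z => a b /=; rewrite sqr_sqrtr// addr_ge0// sqr_ge0. Qed.

Lemma normcR (x : R) : normc x%:C = `|x|.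
Proof. by rewrite /= expr0n /= addr0 sqrtr_sqr. Qed.

Lemma normc_ge_Re z : `|complex.Re z| <= normc z.
Proof.
rewrite -(ler_pXn2r (n:=2)) ?nnegrE ?normc_ge0//.
by rewrite normc_sqr real_normK ?num_real// lerDl sqr_ge0.
Qed.

Lemma normc_ge_Im z : `|complex.Im z| <= normc z.
Proof.
rewrite -(ler_pXn2r (n:=2)) ?nnegrE ?normc_ge0//.
by rewrite normc_sqr real_normK ?num_real// lerDr sqr_ge0.
Qed.

Lemma normc_le_ReIm z : normc z <= `|complex.Re z| + `|complex.Im z|.
Proof.
rewrite -(ler_pXn2r (n:=2)) ?nnegrE ?normc_ge0 ?addr_ge0//.
rewrite normc_sqr -(real_normK (num_real (complex.Re z))).
rewrite -(real_normK (num_real (complex.Im z))) sqrrD.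
by rewrite -addrA lerD2l lerDr mulrn_wge0// mulr_ge0.
Qed.

Lemma normc_i : normc ('i : C) = 1.
Proof. by rewrite /= expr0n /= add0r expr1n sqrtr1. Qed.

Lemma ler_normcB z w : normc (z - w) <= normc z + normc w.
Proof. by rewrite (le_trans (le_normcD _ _))// normcN. Qed.

Lemma ler_normc_sub z w : `|normc z - normc w| <= normc (z - w).
Proof.
rewrite ler_norml; apply/andP; split.
  rewrite lerNl opprB lerBlDr -(normcN (z - w)) opprB addrC.
  by rewrite -{1}(subrK z w) addrC le_normcD// .
by rewrite lerBlDr -{1}(subrK w z) le_normcD.
Qed.

Lemma normcX z n : normc (z ^+ n) = normc z ^+ n.
Proof.
elim: n => [|n IH]; first by rewrite !expr0 normc1.
by rewrite !exprS normcM IH.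
Qed.

Lemma Re_cexp z : complex.Re (cexp z) = expR (complex.Re z) * cos (complex.Im z).
Proof. by rewrite /cexp ReM /= mul0r subr0. Qed.
Lemma Im_cexp z : complex.Im (cexp z) = expR (complex.Re z) * sin (complex.Im z).
Proof. by rewrite /cexp ImM /= mul0r addr0. Qed.

Lemma cexpD z w : cexp (z + w) = cexp z * cexp w.
Proof.
apply: complex_ext; rewrite !(Re_cexp, Im_cexp, ReImE) expRD.
  by rewrite cosD; ring.
by rewrite sinD; ring.
Qed.

Lemma cexp0 : cexp (0 : C) = 1.
Proof.
apply: complex_ext; rewrite (Re_cexp, Im_cexp) /= expR0 mul1r ?cos0 ?sin0//.
Qed.

Lemma normc_cexp z : normc (cexp z) = expR (complex.Re z).
Proof.
apply/eqP; rewrite -(eqrXn2 (n:=2)) ?normc_ge0 ?expR_ge0//.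
rewrite normc_sqr Re_cexp Im_cexp !exprMn -mulrDr cos2Dsin2 mulr1 eqxx//.
Qed.

(** With [sink k] this gives the free solutions normalized at 0: [ccos (k * x%:C)] is the derivative
    of [sink k] and has value 1 at 0. *)
Definition ccos z : C := (cexp ('i * z) + cexp (- ('i * z))) / 2.

Definition cmeas f := measurable_fun setT (fun x => complex.Re (f x)) /\
  measurable_fun setT (fun x => complex.Im (f x)).
Definition ccont f := continuous (fun x => complex.Re (f x)) /\
  continuous (fun x => complex.Im (f x)).
(** A relation between components rather than an operator: a derivative is exhibited and transported
    by rules, and it agrees with [cderive1], which is componentwise as well. *)
Definition cdiff f g := forall x : R,
  is_derive x 1 (fun y => complex.Re (f y)) (complex.Re (g x)) /\
  is_derive x 1 (fun y => complex.Im (f y)) (complex.Im (g x)).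

Lemma eq_cmeas f g : f =1 g -> cmeas f -> cmeas g.
Proof. by move=> /funext ->. Qed.
Lemma ccont_cmeas f : ccont f -> cmeas f.
Proof. by move=> [a b]; split; apply: continuous_measurable_fun. Qed.

Lemma cmeas_cst z : cmeas (fun=> z).
Proof. by split; exact: measurable_cst. Qed.
Lemma cmeas_real (u : R -> R) : measurable_fun setT u -> cmeas (fun x => (u x)%:C).
Proof. by move=> mu; split => //=; exact: measurable_cst. Qed.
Lemma cmeasD f g : cmeas f -> cmeas g -> cmeas (fun x => f x + g x).
Proof.
move=> [a b] [c d]; split.
  by under eq_fun do rewrite ReD; exact: measurable_funD.
by under eq_fun do rewrite ImD; exact: measurable_funD.
Qed.
Lemma cmeasM f g : cmeas f -> cmeas g -> cmeas (fun x => f x * g x).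
Proof.
move=> [a b] [c d]; split.
  by under eq_fun do rewrite ReM; apply: measurable_funB; exact: measurable_funM.
by under eq_fun do rewrite ImM; apply: measurable_funD; exact: measurable_funM.
Qed.
Lemma cmeasN f : cmeas f -> cmeas (fun x => - f x).
Proof.
move=> h; apply: eq_cmeas (cmeasM (cmeas_cst (-1)) h) => x.
by rewrite mulN1r.
Qed.
Lemma cmeasB f g : cmeas f -> cmeas g -> cmeas (fun x => f x - g x).
Proof. by move=> hf hg; exact: cmeasD hf (cmeasN hg). Qed.
Lemma eq_ccont f g : f =1 g -> ccont f -> ccont g.
Proof. by move=> /funext ->. Qed.
Lemma ccont_cst z : ccont (fun=> z).
Proof. by split => x; exact: cvg_cst. Qed.
Lemma ccont_real (u : R -> R) : continuous u -> ccont (fun x => (u x)%:C).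
Proof. by move=> mu; split => //= x; exact: cvg_cst. Qed.
Lemma ccontD f g : ccont f -> ccont g -> ccont (fun x => f x + g x).
Proof.
move=> [a b] [c d]; split => x.
  by under eq_fun do rewrite ReD; apply: cvgD; [exact: a|exact: c].
by under eq_fun do rewrite ImD; apply: cvgD; [exact: b|exact: d].
Qed.
Lemma ccontM f g : ccont f -> ccont g -> ccont (fun x => f x * g x).
Proof.
move=> [a b] [c d]; split => x.
  under eq_fun do rewrite ReM.
  by apply: cvgB; apply: cvgM; [exact: a|exact: c|exact: b|exact: d].
under eq_fun do rewrite ImM.
by apply: cvgD; apply: cvgM; [exact: a|exact: d|exact: b|exact: c].
Qed.
Lemma ccontN f : ccont f -> ccont (fun x => - f x).
Proof.
move=> h; apply: eq_ccont (ccontM (ccont_cst (-1)) h) => x.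
by rewrite mulN1r.
Qed.
Lemma ccontB f g : ccont f -> ccont g -> ccont (fun x => f x - g x).
Proof. by move=> hf hg; exact: ccontD hf (ccontN hg). Qed.
Lemma ccont_sum (I : Type) (s : seq I) (F : I -> R -> C) :
  (forall i, ccont (F i)) -> ccont (fun x => \sum_(i <- s) F i x).
Proof.
move=> h; elim: s => [|i s IH].
  by apply: eq_ccont (ccont_cst 0) => x; rewrite big_nil.
by apply: eq_ccont (ccontD (h i) IH) => x; rewrite big_cons.
Qed.

Lemma cdiff_ccont f g : cdiff f g -> ccont f.
Proof.
move=> h; split => x; have [h1 h2] := h x.
  by apply: differentiable_continuous; apply/derivable1_diffP; case: h1.
by apply: differentiable_continuous; apply/derivable1_diffP; case: h2.
Qed.
Lemma eq_cdiff f f' g g' : f =1 f' -> g =1 g' -> cdiff f g -> cdiff f' g'.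
Proof. by move=> /funext -> /funext ->. Qed.
Lemma cdiff_cst z : cdiff (fun=> z) (fun=> 0).
Proof. by move=> x; split; exact: is_derive_cst. Qed.
Lemma cdiff_real (u v : R -> R) : (forall x : R, is_derive x 1 u (v x)) ->
  cdiff (fun x => (u x)%:C) (fun x => (v x)%:C).
Proof. by move=> h x; split => //=; exact: is_derive_cst. Qed.
Lemma cdiffD f f' g g' : cdiff f f' -> cdiff g g' ->
  cdiff (fun x => f x + g x) (fun x => f' x + g' x).
Proof.
move=> hf hg x; have [a b] := hf x; have [c d] := hg x; split; rewrite ReImE.
  by under eq_fun do rewrite ReD; exact: is_deriveD.
by under eq_fun do rewrite ImD; exact: is_deriveD.
Qed.
Lemma cdiffM f f' g g' : cdiff f f' -> cdiff g g' ->
  cdiff (fun x => f x * g x) (fun x => f' x * g x + f x * g' x).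
Proof.
move=> hf hg x; have [a b] := hf x; have [c d] := hg x; split.
  under eq_fun do rewrite ReM.
  apply: (@is_derive_eq _ _ _ _ _ _ _ _ (is_deriveB (is_deriveM a c) (is_deriveM b d))).
  by rewrite !ReImE /GRing.scale /=; ring.
under eq_fun do rewrite ImM.
apply: (@is_derive_eq _ _ _ _ _ _ _ _ (is_deriveD (is_deriveM a d) (is_deriveM b c))).
by rewrite !ReImE /GRing.scale /=; ring.
Qed.
Lemma cdiffZ z f f' : cdiff f f' -> cdiff (fun x => z * f x) (fun x => z * f' x).
Proof.
move=> h; apply: eq_cdiff (cdiffM (cdiff_cst z) h) => // x.
by rewrite mul0r add0r.
Qed.
Lemma cdiffN f f' : cdiff f f' -> cdiff (fun x => - f x) (fun x => - f' x).
Proof.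
by move=> h; apply: eq_cdiff (cdiffZ (-1) h) => x; rewrite mulN1r.
Qed.
Lemma cdiffB f f' g g' : cdiff f f' -> cdiff g g' ->
  cdiff (fun x => f x - g x) (fun x => f' x - g' x).
Proof. by move=> hf hg; exact: cdiffD hf (cdiffN hg). Qed.

Lemma cdiff_cexp z : cdiff (fun x => cexp (z * x%:C)) (fun x => z * cexp (z * x%:C)).
Proof.
move=> x; case: z => a b.
have dl (c : R) : is_derive x 1 (fun y : R => c * y) c.
  by apply: (@is_derive_eq _ _ _ _ _ _ _ _ (is_deriveZ c (is_derive_id x 1))); rewrite /GRing.scale /= mulr1.
have re y : complex.Re ((a +i* b) * y%:C) = a * y by rewrite ReM /= mulr0 subr0.
have im y : complex.Im ((a +i* b) * y%:C) = b * y by rewrite ImM /= mulr0 add0r.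
have dc (g : R -> R) (g' l l' : R) : is_derive (l * x) 1 g g' ->
    is_derive x 1 (fun y => g (l * y)) (l * g').
  move=> h; apply: (@is_derive_eq _ _ _ _ _ _ _ _ (is_derive1_comp h (dl l))).
  by rewrite /GRing.scale /= mulrC.
have e := dc expR _ a 0 (is_derive_expR _).
have s := dc sin _ b 0 (is_derive_sin _).
have c := dc cos _ b 0 (is_derive_cos _).
split; under eq_fun do rewrite (Re_cexp, Im_cexp) re im.
  apply: (@is_derive_eq _ _ _ _ _ _ _ _ (is_deriveM e c)).
  by rewrite ReM Re_cexp Im_cexp re im /GRing.scale /=; ring.
apply: (@is_derive_eq _ _ _ _ _ _ _ _ (is_deriveM e s)).
by rewrite ImM Re_cexp Im_cexp re im /GRing.scale /=; ring.
Qed.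

Lemma cdiff_cderive1 f g (x : R) : cdiff f g -> cderive1 f x = g x.
Proof.
move=> h; have [[d1 e1] [d2 e2]] := h x.
by apply: complex_ext; rewrite /cderive1 /= derive1E.
Qed.

Lemma cdiff_opp f g : cdiff f g -> cdiff (fun x => f (- x)) (fun x => - g (- x)).
Proof.
move=> h x; have [a b] := h (- x).
have dN : is_derive x 1 (-%R : R -> R) (-1) by exact: is_deriveNid.
split; rewrite ReImE.
  apply: (@is_derive_eq _ _ _ _ _ _ _ _ (is_derive1_comp a dN)).
  by rewrite /GRing.scale /= mulrN1.
apply: (@is_derive_eq _ _ _ _ _ _ _ _ (is_derive1_comp b dN)).
by rewrite /GRing.scale /= mulrN1.
Qed.

End ComplexBasics.

(** * The kernel sin(k x) / k and the free solutions *)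

Section SineKernel.
Context {R : realType}.
Local Notation C := R[i].
Implicit Types (z w k : C).

Lemma normr_sin_le (a : R) : `|sin a| <= `|a|.
Proof.
wlog a0 : a / 0 <= a.
  move=> h; case: (lerP 0 a) => [/h//|/ltW a0].
  by rewrite -(normrN a) -(normrN (sin a)) -sinN h// oppr_ge0.
have [c _] := MVT_segment a0 (fun x _ => is_derive_sin x)
  (continuous_subspaceT (@continuous_sin R)).
rewrite sin0 !subr0 => ->; rewrite normrM ler_piMl//.
by rewrite ler_norml cos_geN1 cos_le1.
Qed.

(** This is the square of |2 sinh b| <= 2 |b| exp |b|, which follows from 1 - exp (-2 b) <= 2 b for
    b >= 0. The square makes it even in [b] and fits |sin (a + i b)|^2 = sin^2 a + sinh^2 b. *)
Lemma expR_sub_le (b : R) : (expR b - expR (- b)) ^+ 2 <= 4 * (b * expR `|b|) ^+ 2.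
Proof.
wlog b0 : b / 0 <= b.
  move=> h; case: (lerP 0 b) => [/h//|/ltW b0].
  have := h (- b); rewrite opprK normrN oppr_ge0 => /(_ b0).
  by rewrite -[expR b - _]opprB sqrrN mulNr sqrrN.
rewrite (ger0_norm b0).
have h1 : expR b - expR (- b) <= 2 * (b * expR b).
  have -> : expR b - expR (- b) = expR b * (1 - expR (- b) * expR (- b)).
    by rewrite mulrBr mulr1 mulrA -!expRD; congr (_ - expR _); ring.
  have -> : 2 * (b * expR b) = expR b * (2 * b) by ring.
  rewrite ler_pM2l ?expR_gt0// -expRD lerBlDr addrC -lerBlDr.
  by rewrite (le_trans _ (expR_ge1Dx _))//; lra.
have h0 : 0 <= expR b - expR (- b) by rewrite subr_ge0 ler_expR; lra.
have -> : 4 * (b * expR b) ^+ 2 = (2 * (b * expR b)) ^+ 2 by ring.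
by rewrite ler_pXn2r// nnegrE ?mulr_ge0// ?expR_ge0.
Qed.

Lemma normc_csin z : normc (csin z) <= normc z * expR `|complex.Im z|.
Proof.
rewrite -(ler_pXn2r (n:=2)) ?nnegrE ?mulr_ge0 ?normc_ge0 ?expR_ge0//.
have -> : normc (csin z) ^+ 2 = (normc (cexp ('i * z) - cexp (- ('i * z)))) ^+ 2 / 4.
  rewrite /csin normcM normcV normcMn normc_i exprMn exprVn.
  by congr (_ / _); ring.
rewrite exprMn !normc_sqr !(ReImE, Re_cexp, Im_cexp) /=.
case: z => a b /=.
have -> : 0 * a - 1 * b = - b by ring.
have -> : 0 * b + 1 * a = a by ring.
rewrite cosN sinN opprK.
have e1 : expR b * expR (- b) = 1 by rewrite -expRD subrr expR0.
have h1 : sin a ^+ 2 <= a ^+ 2.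
  rewrite -(real_normK (num_real (sin a))) -(real_normK (num_real a)).
  by rewrite ler_pXn2r ?nnegrE// normr_sin_le.
have h3 := cos2Dsin2 a; have h2 := expR_sub_le b; rewrite exprMn in h2.
move: e1 h1 h2 h3.
set p := expR b; set q := expR (- b); set u := cos a; set v := sin a.
move=> e1 h1 h2 h3.
have e2 : 1 <= expR `|b| ^+ 2 by rewrite exprn_ege1// -expR0 ler_expR.
set E := expR `|b| ^+ 2 in h2 e2 *.
have e3 : a ^+ 2 <= a ^+ 2 * E by rewrite ler_peMr// sqr_ge0.
(* With [p * q = 1] this is 4 |sin z|^2 = (2 sinh b)^2 + 4 sin^2 a. *)
have -> : (q * u - p * u) ^+ 2 + (q * v - p * - v) ^+ 2
  = (p - q) ^+ 2 * (u ^+ 2 + v ^+ 2) + 4 * (p * q) * v ^+ 2 by ring.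
rewrite h3 e1.
rewrite ler_pdivrMr//; lra.
Qed.

Lemma normc_sink k (x : R) : normc (sink k x) <= `|x| * expR (`|complex.Im k| * `|x|).
Proof.
rewrite /sink; case: eqP => [->|/eqP k0].
  by rewrite normcR /= normr0 mul0r expR0 mulr1.
have nk : 0 < normc k.
  rewrite lt_neqAle normc_ge0 andbT eq_sym; apply: contraNneq k0 => h.
  by apply/eqP/eq0_normc.
rewrite normcM normcV ler_pdivrMr//.
apply: le_trans (normc_csin _) _.
rewrite normcM normcR ImM /= mulr0 add0r normrM.
by rewrite [leLHS](_ : _ = `|x| * expR (`|complex.Im k| * `|x|) * normc k) //; ring.
Qed.

Lemma normc_ccos k (x : R) : normc (ccos (k * x%:C)) <= expR (`|complex.Im k| * `|x|).
Proof.
rewrite /ccos normcM normcV.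
have -> : normc (2 : C) = 2.
  by rewrite normcMn normc1.
rewrite ler_pdivrMr// (le_trans (le_normcD _ _))// !normc_cexp.
rewrite mulr_natr mulr2n lerD// ler_expR !ReImE /= -normrM.
  by apply: le_trans (ler_norm _) _; rewrite -normrN le_eqVlt; apply/orP; left; apply/eqP; congr `|_|; ring.
by apply: le_trans (ler_norm _) _; rewrite le_eqVlt; apply/orP; left; apply/eqP; congr `|_|; ring.
Qed.

Lemma expR_lin_le (a d x : R) : 0 < d -> 0 <= x ->
  x * expR (a * x) <= d^-1 * expR ((a + d) * x).
Proof.
move=> d0 x0; have h : x <= d^-1 * expR (d * x).
  by rewrite ler_pdivlMl// (le_trans _ (expR_ge1Dx _))//; lra.
have -> : d^-1 * expR ((a + d) * x) = d^-1 * expR (d * x) * expR (a * x).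
  by rewrite mulrDl expRD; ring.
by rewrite ler_pM2r ?expR_gt0.
Qed.

(** The linear growth of [sink k] at k = 0 is absorbed by a slightly larger exponent. The constant
    [(b - a)^-1] depends on [k] only through the bound on its imaginary part, which makes all later
    estimates uniform near k = 0. *)
Lemma normc_sink_exp k (a b x : R) : `|complex.Im k| <= a -> a < b ->
  normc (sink k x) <= (b - a)^-1 * expR (b * `|x|).
Proof.
move=> ka ab; apply: le_trans (normc_sink _ _) _.
have := @expR_lin_le a (b - a) `|x|; rewrite subr_gt0 => /(_ ab (normr_ge0 _)).
rewrite [a + _]addrC subrK; apply: le_trans.
by rewrite ler_wpM2l// ler_expR ler_wpM2r.
Qed.

Lemma normc_ccos_exp k (b x : R) : `|complex.Im k| <= b ->
  normc (ccos (k * x%:C)) <= expR (b * `|x|).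
Proof. by move=> kb; apply: le_trans (normc_ccos _ _) _; rewrite ler_expR ler_wpM2r. Qed.

Lemma real_complexB (x y : R) : (x - y)%:C = x%:C - y%:C.
Proof. by rewrite rmorphB. Qed.

Lemma two_i_neq0 : ('i *+ 2 : C) != 0.
Proof. by rewrite mulrn_eq0 /= eq_complex /= oner_eq0 andbF. Qed.
Lemma i_sqr : 'i * 'i = -1 :> C.
Proof. by rewrite -expr2 sqr_i. Qed.

(** The addition formulas separate the variables of the Volterra kernel: the integral over [[x,
    +oo[] becomes a combination of two tails whose integrands are free of [x], so continuity and
    derivatives in [x] reduce to those of tails. *)
Lemma sinkB k (x y : R) : sink k (y - x)
  = sink k y * ccos (k * x%:C) - ccos (k * y%:C) * sink k x.
Proof.
rewrite /sink; case: eqP => [->|/eqP k0].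
  by rewrite /ccos !mul0r mulr0 oppr0 cexp0 real_complexB; field.
rewrite /csin /ccos real_complexB.
have -> : 'i * (k * (y%:C - x%:C)) = 'i * (k * y%:C) - 'i * (k * x%:C) by ring.
rewrite opprD opprK !cexpD.
have := two_i_neq0; move: ('i *+ 2) => J J0.
by field; rewrite k0 J0.
Qed.

Lemma ccosB k (x y : R) : ccos (k * (y - x)%:C)
  = ccos (k * y%:C) * ccos (k * x%:C) + k ^+ 2 * (sink k y * sink k x).
Proof.
rewrite /sink; case: eqP => [->|/eqP k0].
  by rewrite /ccos !mul0r mulr0 oppr0 cexp0; field.
rewrite /csin /ccos real_complexB.
have -> : 'i * (k * (y%:C - x%:C)) = 'i * (k * y%:C) - 'i * (k * x%:C) by ring.
rewrite opprD opprK !cexpD.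
have : ('i *+ 2 : C) * ('i *+ 2) = -4.
  have e : 'i *+ 2 * ('i *+ 2) = 4 * ('i * 'i) :> C by ring.
  by rewrite e i_sqr mulrN1.
have := two_i_neq0; move: ('i *+ 2) => J J0 JJ.
have J4 : J^-1 * J^-1 = - 4^-1 by rewrite -invfM JJ invrN.
set r := cexp ('i * (k * y%:C)); set p := cexp (- ('i * (k * y%:C))).
set s := cexp ('i * (k * x%:C)); set q := cexp (- ('i * (k * x%:C))).
have -> : k ^+ 2 * ((r - p) / J / k * ((s - q) / J / k))
  = (r - p) * (s - q) * (J^-1 * J^-1) by field; rewrite k0 J0.
by rewrite J4; field.
Qed.

(** The Wronskian of the free solutions is 1; in the second derivative of a Jost solution this
    identity collects the boundary terms into [U f]. *)
Lemma ccos2Dsink2 k (x : R) :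
  ccos (k * x%:C) * ccos (k * x%:C) + k ^+ 2 * (sink k x * sink k x) = 1.
Proof.
by rewrite -ccosB subrr /ccos !mulr0 oppr0 cexp0; field.
Qed.

Lemma sinkN k (x : R) : sink k (- x) = - sink k x.
Proof.
rewrite /sink; case: eqP => _; first by rewrite rmorphN.
by rewrite /csin rmorphN mulrN mulrN opprK -[cexp (- _) - _]opprB !mulNr.
Qed.

Lemma sink0 k : sink k 0 = 0.
Proof. by rewrite /sink; case: eqP => // _; rewrite mulr0 /csin mulr0 oppr0 subrr !mul0r. Qed.

Lemma cdiff_ccos k : cdiff (fun x => ccos (k * x%:C)) (fun x => - k ^+ 2 * sink k x).
Proof.
have h := cdiffZ 2^-1 (cdiffD (cdiff_cexp ('i * k)) (cdiff_cexp (- ('i * k)))).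
apply: eq_cdiff h => x; first by rewrite /ccos mulrC mulNr mulrA.
rewrite /sink; case: eqP => [->|/eqP k0].
  by rewrite !(mulr0, oppr0, mul0r, expr0n, addr0).
rewrite /csin.
have -> : ('i *+ 2 : C)^-1 = - 'i / 2.
  apply: (mulfI two_i_neq0); rewrite divff ?two_i_neq0//.
  have -> : 'i *+ 2 * (- 'i / 2) = - ('i * 'i) * (2 / 2) :> C by ring.
  by rewrite i_sqr opprK mul1r divff ?pnatr_eq0.
have -> : 'i * (k * x%:C) = 'i * k * x%:C by ring.
rewrite [- ('i * k) * x%:C]mulNr.
set p := cexp ('i * k * x%:C); set q := cexp (- ('i * k * x%:C)).
by field.
Qed.

Lemma cdiff_sink k : cdiff (sink k) (fun x => ccos (k * x%:C)).
Proof.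
have [->|k0] := eqVneq k 0.
  apply: eq_cdiff (cdiff_real (fun x => is_derive_id x 1)) => x /=.
    by rewrite /sink eqxx.
  by rewrite /ccos mul0r mulr0 oppr0 cexp0; field.
have h := cdiffZ ('i *+ 2 * k)^-1 (cdiffB (cdiff_cexp ('i * k)) (cdiff_cexp (- ('i * k)))).
have e x : 'i * (k * x%:C) = 'i * k * x%:C by ring.
have i0 : ('i : C) != 0 by rewrite eq_complex /= oner_eq0 andbF.
apply: eq_cdiff h => x.
  rewrite /sink (negbTE k0) /csin e [- ('i * k) * x%:C]mulNr.
  set p := cexp ('i * k * x%:C); set q := cexp (- ('i * k * x%:C)).
  by rewrite invfM mulrC mulrA.
rewrite /ccos e [- ('i * k) * x%:C]mulNr.
set p := cexp ('i * k * x%:C); set q := cexp (- ('i * k * x%:C)).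
by field; rewrite k0 i0.
Qed.

End SineKernel.

(** * Integration on the real line *)

Section RealIntegrals.
Context {R : realType}.
Local Notation mu := (@lebesgue_measure R).
Implicit Types (D : set R) (f g b : R -> R).

Lemma ae_filter_lebesgue : Filter (nbhs (almost_everywhere mu)).
Proof. exact: ae_filter_ringOfSetsType. Qed.

Lemma ae_imp (P Q : R -> Prop) : {ae mu, forall x, P x} ->
  (forall x, P x -> Q x) -> {ae mu, forall x, Q x}.
Proof. by move=> h PQ; apply: (@filterS _ _ ae_filter_lebesgue _ _ _ h). Qed.

Lemma ae_all (P : R -> Prop) : (forall x, P x) -> {ae mu, forall x, P x}.
Proof. by move=> h; exists set0; split => // x []. Qed.

Lemma ae_imp2 (P Q S : R -> Prop) : {ae mu, forall x, P x} -> {ae mu, forall x, Q x} ->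
  (forall x, P x -> Q x -> S x) -> {ae mu, forall x, S x}.
Proof. by move=> h h' PQ; apply: (@filterS2 _ _ ae_filter_lebesgue _ _ _ _ h h'). Qed.

Lemma measurable_EFinf D f : measurable_fun D f ->
  measurable_fun D (fun x => (f x)%:E).
Proof. by move=> h; exact/measurable_EFinP. Qed.

Lemma ae_dominated_integrable D f b : measurable D ->
  measurable_fun D f -> mu.-integrable D (EFin \o b) ->
  {ae mu, forall x, D x -> `|f x| <= b x} -> mu.-integrable D (EFin \o f).
Proof.
move=> mD mf ib h; apply/integrableP; split; first exact/measurable_EFinP.
move/integrableP: (ib) => [mb ?]; apply: le_lt_trans (_ : (\int[mu]_(x in D) `|(b x)%:E| < +oo)%E) => //.
apply: ae_ge0_le_integral => //.
- by apply: measurableT_comp => //; exact/measurable_EFinP.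
- exact: measurableT_comp.
- apply: ae_imp h _ => x h Dx; rewrite lee_fin.
  by rewrite (le_trans (h Dx))// ler_norm.
Qed.

Lemma ae_norm_Rintegral_le D f b : measurable D ->
  mu.-integrable D (EFin \o f) -> mu.-integrable D (EFin \o b) ->
  {ae mu, forall x, D x -> `|f x| <= b x} ->
  `|\int[mu]_(x in D) f x| <= \int[mu]_(x in D) b x.
Proof.
move=> mD jf ib h.
apply: (@le_trans _ _ (\int[mu]_(x in D) `|f x|)).
  exact: (@le_normr_Rintegral _ _ _ mu D f mD jf).
move/integrableP: (jf) => [mf ff]; move/integrableP: (ib) => [mb fb].
have mnf : measurable_fun D (fun x => `|f x|).
  by apply: measurableT_comp => //; exact/measurable_EFinP.
have mnb : measurable_fun D (fun x => `|b x|).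
  by apply: measurableT_comp => //; exact/measurable_EFinP.
have e : \int[mu]_(x in D) b x = \int[mu]_(x in D) `|b x|.
  rewrite /Rintegral; congr fine; apply: ae_eq_integral => //.
    exact/measurable_EFinP.
  have h' : {ae mu, forall x, D x -> (b x)%:E = (`|b x|)%:E}.
    by apply: ae_imp h _ => x h Dx; rewrite ger0_norm// (le_trans _ (h Dx)).
  exact: h'.
rewrite e /Rintegral fine_le//.
- by apply: integrable_fin_num => //; exact: (integrable_norm jf).
- by apply: integrable_fin_num => //; exact: (integrable_norm ib).
apply: ae_ge0_le_integral => //; try exact/measurable_EFinP.
apply: ae_imp h _ => x h Dx; rewrite lee_fin (le_trans (h Dx))// ler_norm//.
Qed.

Lemma ae_eq_Rintegral D f g : measurable D -> measurable_fun D f ->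
  measurable_fun D g -> {ae mu, forall x, D x -> f x = g x} ->
  \int[mu]_(x in D) f x = \int[mu]_(x in D) g x.
Proof.
move=> mD mf mg h; rewrite /Rintegral; congr fine; apply: ae_eq_integral => //.
- exact/measurable_EFinP.
- exact/measurable_EFinP.
- have h' : {ae mu, forall x, D x -> (f x)%:E = (g x)%:E}.
    by apply: ae_imp h _ => x h Dx; rewrite h.
  exact: h'.
Qed.

Lemma dominated_Rintegral_cvg D (f_ : nat -> R -> R) f b : measurable D ->
  (forall n, measurable_fun D (f_ n)) -> measurable_fun D f ->
  {ae mu, forall x, D x -> f_ ^~ x @ \oo --> f x} ->
  mu.-integrable D (EFin \o b) ->
  {ae mu, forall x, D x -> forall n, `|f_ n x| <= b x} ->
  \int[mu]_(x in D) f_ n x @[n --> \oo] --> \int[mu]_(x in D) f x.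
Proof.
move=> mD mf_ mf cf ib h.
have h' : {ae mu, forall x n, D x -> (`|(f_ n x)%:E| <= (EFin \o b) x)%E}.
  by apply: ae_imp h _ => x h n Dx; rewrite lee_fin h.
have [|||jf _ cv] := @dominated_convergence _ _ _ mu D mD (fun n x => (f_ n x)%:E) (EFin \o f) (EFin \o b) _ _ _ ib h'.
- by move=> n; apply: measurable_EFinf.
- exact: measurable_EFinf.
- apply: ae_imp cf _ => x c Dx; apply/fine_cvgP; split; first by apply: nearW.
  exact: c.
have fn : (\int[mu]_(x in D) (f x)%:E \is a fin_num)%E by apply: integrable_fin_num.
apply: (@fine_cvg _ _ _ _ (fun n => \int[mu]_(x in D) (f_ n x)%:E)%E).
by rewrite fineK.
Qed.

Lemma integrable_subT D f : measurable D ->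
  mu.-integrable setT (EFin \o f) -> mu.-integrable D (EFin \o f).
Proof. by move=> mD; apply: integrableS. Qed.

Lemma Rintegral_cvg_itv f : mu.-integrable setT (EFin \o f) ->
  \int[mu]_(x in `[- (n%:R), n%:R]) f x @[n --> \oo] --> \int[mu]_x f x.
Proof.
move=> jf; under eq_fun do rewrite Rintegral_mkcond.
move/integrableP: (jf) => [/measurable_EFinP mf _].
apply: (@dominated_Rintegral_cvg _ _ _ (fun x => `|f x|)) => //.
- by move=> n; apply/(measurable_restrictT _ _).1 => //; exact: measurable_funTS.
- apply: nearW => x _; apply: cvg_near_cst; near=> n.
  rewrite patchE mem_set//= in_itv/= -ler_norml.
  by near: n; exact: nbhs_infty_ger.
- exact: integrable_norm.
- by apply: nearW => x _ n; rewrite patchE; case: ifPn => //; rewrite normr0.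
Unshelve. all: by end_near. Qed.

(** The fundamental theorem on [[-n, n]] followed by dominated convergence; with [f] integrable,
    limits of [F] along the integers are enough. *)
Lemma Rintegral_derivative (F f : R -> R) (l0 l1 : R) :
  (forall x : R, is_derive x 1 F (f x)) -> continuous f ->
  mu.-integrable setT (EFin \o f) ->
  F n%:R @[n --> \oo] --> l1 -> F (- n%:R) @[n --> \oo] --> l0 ->
  \int[mu]_x f x = l1 - l0.
Proof.
move=> dF cf jf c1 c0.
have cF : continuous F.
  move=> x; apply: differentiable_continuous; apply/derivable1_diffP.
  by case: (dF x).
apply: (@cvg_unique _ (@Rhausdorff R) _ _ _ _ (Rintegral_cvg_itv jf)).
apply: cvg_trans (cvgB c1 c0).
apply: near_eq_cvg; near=> n.
have n0 : 0 < n%:R :> R by rewrite ltr0n; near: n; exists 1%N.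
rewrite /Rintegral (@continuous_FTC2 _ f F)//.
- by rewrite gtrN.
- exact: continuous_subspaceT.
- split.
  + by move=> x _; case: (dF x).
  + exact/cvg_at_right_filter/cF.
  + exact/cvg_at_left_filter/cF.
- by move=> x _; rewrite derive1E; case: (dF x).
Unshelve. all: by end_near. Qed.

Lemma Rintegral_tailE f x : mu.-integrable setT (EFin \o f) ->
  \int[mu]_(y in `[x, +oo[) f y = \int[mu]_y f y - \int[mu]_(y in `]-oo, x]) f y.
Proof.
move=> jf; have jf' : mu.-integrable `]-oo, +oo[ (EFin \o f) by rewrite set_itvE.
have := @Rintegral_itvB R f -oo%O +oo%O x jf' isT isT.
rewrite [X in \int[mu]_(y in X) f y - _ = _](_ : _ = setT); last exact: set_itvNyy.
move=> ->; rewrite Rintegral_itv_obnd_cbnd//.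
exact: integrable_subT.
Qed.

Lemma is_derive_head f (x : R) : mu.-integrable setT (EFin \o f) ->
  {for x, continuous f} -> is_derive x 1 (fun x => \int[mu]_(y in `]-oo, x]) f y) (f x).
Proof.
move=> jf cf.
have x1 : x < x + 1 by rewrite ltrDl.
have jx : mu.-integrable `]-oo, x + 1] (EFin \o f) by apply: integrable_subT.
have [d e] := continuous_FTC1 x1 jx (ltNyr x) cf.
by apply: DeriveDef => //; rewrite -derive1E.
Qed.

Lemma is_derive_tail f (x : R) : mu.-integrable setT (EFin \o f) ->
  {for x, continuous f} -> is_derive x 1 (fun x => \int[mu]_(y in `[x, +oo[) f y) (- f x).
Proof.
move=> jf cf; under eq_fun do rewrite Rintegral_tailE//.
have h := is_derive_head jf cf.
apply: (@is_derive_eq _ _ _ _ _ _ _ _ (is_deriveB (is_derive_cst _ _ _) h)).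
by rewrite sub0r.
Qed.

Lemma continuous_tail f : mu.-integrable setT (EFin \o f) ->
  continuous (fun x => \int[mu]_(y in `[x, +oo[) f y).
Proof.
move=> jf x.
have jx : mu.-integrable `[x - 1, x + 1] (EFin \o f) by apply: integrable_subT.
have ab : x - 1 <= x + 1 by lra.
have := parameterized_integral_continuous ab jx.
move/continuous_within_itvP => /(_ _)[]; first by lra.
move=> + _ _ => /(_ x); rewrite in_itv /= => h.
have {}h : {for x, continuous (fun x0 => \int[mu]_(t in `[x - 1, x0]) f t)}.
  by apply: h; apply/andP; split; lra.
have e : \forall y \near x, \int[mu]_(t in `[x - 1, +oo[) f t - \int[mu]_(t in `[x - 1, y]) f t
   = \int[mu]_(t in `[y, +oo[) f t.
  near=> y.
  have -> // := @Rintegral_itvB R f (BLeft (x - 1)) +oo%O y (integrable_subT (measurable_itv _) jf).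
  - by rewrite Rintegral_itv_obnd_cbnd//; exact: integrable_subT.
  - rewrite bnd_simp; near: y; exists 1 => //= z /=; rewrite ltr_norml => /andP[_ ?]; lra.
apply: cvg_trans (near_eq_cvg e) _.
rewrite -(nbhs_singleton e).
by apply: cvgB; [exact: cvg_cst|exact: h].
Unshelve. all: by end_near. Qed.

End RealIntegrals.

Section ComplexIntegrals.
Context {R : realType}.
Local Notation C := R[i].
Local Notation mu := (@lebesgue_measure R).
Implicit Types (D : set R) (f g : R -> C) (b : R -> R).

Definition ccvg (u : nat -> C) (l : C) :=
  (complex.Re (u n) @[n --> \oo] --> complex.Re l) /\
  (complex.Im (u n) @[n --> \oo] --> complex.Im l).

Lemma ccvg_unique u l l' : ccvg u l -> ccvg u l' -> l = l'.
Proof.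
move=> [a b] [c d]; apply: complex_ext.
  exact: (cvg_unique (@Rhausdorff R) a c).
exact: (cvg_unique (@Rhausdorff R) b d).
Qed.

Lemma eq_ccvg u v l : u =1 v -> ccvg u l -> ccvg v l.
Proof. by move=> /funext ->. Qed.

Lemma ccvg_cst (l : C) : ccvg (fun=> l) l.
Proof. by split; exact: cvg_cst. Qed.

Lemma ccvgD u v l m : ccvg u l -> ccvg v m -> ccvg (fun n => u n + v n) (l + m).
Proof.
move=> [a b] [c d]; split.
  by under eq_fun do rewrite ReD; rewrite ReD; exact: cvgD.
by under eq_fun do rewrite ImD; rewrite ImD; exact: cvgD.
Qed.

Lemma ccvg0_squeeze u (e : nat -> R) : e n @[n --> \oo] --> 0 ->
  (forall n, normc (u n) <= e n) -> ccvg u 0.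
Proof.
move=> e0 h; have ne0 : - e n @[n --> \oo] --> 0 by rewrite -oppr0; exact: cvgN.
split; apply: (squeeze_cvgr _ ne0 e0); apply: nearW => n /=.
  by rewrite -ler_norml (le_trans (normc_ge_Re _)).
by rewrite -ler_norml (le_trans (normc_ge_Im _)).
Qed.


Lemma cintegrable_dom D f b : measurable D -> cmeas f ->
  mu.-integrable D (EFin \o b) ->
  {ae mu, forall x, D x -> normc (f x) <= b x} -> cintegrable D f.
Proof.
move=> mD [m1 m2] ib h; split; apply: (ae_dominated_integrable mD _ ib).
- exact: measurable_funTS.
- by apply: ae_imp h _ => x h Dx; rewrite (le_trans (normc_ge_Re _) (h Dx)).
- exact: measurable_funTS.
- by apply: ae_imp h _ => x h Dx; rewrite (le_trans (normc_ge_Im _) (h Dx)).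
Qed.

(** The factor 2 pays for estimating real and imaginary part separately; it is why [4 / d] appears
    later where the integral of [edecay d] gives [2 / d]. *)
Lemma normc_cint_le D f b : measurable D -> cintegrable D f ->
  mu.-integrable D (EFin \o b) ->
  {ae mu, forall x, D x -> normc (f x) <= b x} ->
  normc (cint D f) <= 2 * \int[mu]_(x in D) b x.
Proof.
move=> mD [i1 i2] ib h; rewrite (le_trans (normc_le_ReIm _))//= mulr_natl mulr2n.
apply: lerD; apply: ae_norm_Rintegral_le => //.
- by apply: ae_imp h _ => x h Dx; rewrite (le_trans (normc_ge_Re _) (h Dx)).
- by apply: ae_imp h _ => x h Dx; rewrite (le_trans (normc_ge_Im _) (h Dx)).
Qed.

Lemma eq_cint D f g : (forall x, D x -> f x = g x) -> cint D f = cint D g.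
Proof.
by move=> h; rewrite /cint; congr Complex; apply: eq_Rintegral => x;
  rewrite inE => Dx; rewrite h.
Qed.

Lemma eq_cintegrable D f g : measurable D -> (forall x, D x -> f x = g x) ->
  cintegrable D f -> cintegrable D g.
Proof.
move=> mD h [a b]; split.
  by apply: eq_integrable a => // x; rewrite inE => Dx; rewrite h.
by apply: eq_integrable b => // x; rewrite inE => Dx; rewrite h.
Qed.

Lemma ae_eq_cint D f g : measurable D -> cmeas f -> cmeas g ->
  {ae mu, forall x, D x -> f x = g x} -> cint D f = cint D g.
Proof.
move=> mD [a b] [c d] h; rewrite /cint; congr Complex;
  apply: ae_eq_Rintegral => //; try exact: measurable_funTS.
- by apply: ae_imp h _ => x h Dx; rewrite h.
- by apply: ae_imp h _ => x h Dx; rewrite h.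
Qed.

Lemma cintegrableS D E f : measurable D -> measurable E -> E `<=` D ->
  cintegrable D f -> cintegrable E f.
Proof.
move=> mD mE ED [a b]; split.
  exact: (@integrableS _ _ _ mu D E _ mD mE ED a).
exact: (@integrableS _ _ _ mu D E _ mD mE ED b).
Qed.

Lemma cintegrableD D f g : measurable D -> cintegrable D f -> cintegrable D g ->
  cintegrable D (fun x => f x + g x).
Proof.
move=> mD [a b] [c d]; split.
  have h := @integrableD _ _ _ mu D mD _ _ a c.
  by apply: eq_integrable h => // x _ /=; rewrite ReD.
have h := @integrableD _ _ _ mu D mD _ _ b d.
by apply: eq_integrable h => // x _ /=; rewrite ImD.
Qed.

Lemma cintegrableZ D f z : measurable D -> cintegrable D f ->
  cintegrable D (fun x => z * f x).
Proof.
move=> mD [a b]; split.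
  have h := @integrableB _ _ _ mu D mD _ _ (@integrableZl _ _ _ mu D mD (complex.Re z) _ a) (@integrableZl _ _ _ mu D mD (complex.Im z) _ b).
  by apply: eq_integrable h => // x _ /=; rewrite ReM.
have h := @integrableD _ _ _ mu D mD _ _ (@integrableZl _ _ _ mu D mD (complex.Re z) _ b) (@integrableZl _ _ _ mu D mD (complex.Im z) _ a).
by apply: eq_integrable h => // x _ /=; rewrite ImM.
Qed.

Lemma cintegrableB D f g : measurable D -> cintegrable D f -> cintegrable D g ->
  cintegrable D (fun x => f x - g x).
Proof.
move=> mD h1 h2; have := cintegrableD mD h1 (cintegrableZ (-1) mD h2).
by apply: eq_cintegrable => // x _; rewrite mulN1r.
Qed.

Lemma cintD D f g : measurable D -> cintegrable D f -> cintegrable D g ->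
  cint D (fun x => f x + g x) = cint D f + cint D g.
Proof.
move=> mD [a b] [c d]; apply: complex_ext; rewrite ReImE /=.
  by rewrite -RintegralD//; apply: eq_Rintegral => x _; rewrite ReD.
by rewrite -RintegralD//; apply: eq_Rintegral => x _; rewrite ImD.
Qed.

Lemma cintZ D f z : measurable D -> cintegrable D f ->
  cint D (fun x => z * f x) = z * cint D f.
Proof.
move=> mD [a b]; case: z => u v; apply: complex_ext; rewrite ReImE /=.
  rewrite -!RintegralZl// -RintegralB//; first by apply: eq_Rintegral => x _; rewrite ReM.
    exact: (@integrableZl _ _ _ mu D mD u _ a).
  exact: (@integrableZl _ _ _ mu D mD v _ b).
rewrite -!RintegralZl// -RintegralD//; first by apply: eq_Rintegral => x _; rewrite ImM.
  exact: (@integrableZl _ _ _ mu D mD u _ b).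
exact: (@integrableZl _ _ _ mu D mD v _ a).
Qed.

Lemma cintB D f g : measurable D -> cintegrable D f -> cintegrable D g ->
  cint D (fun x => f x - g x) = cint D f - cint D g.
Proof.
move=> mD h1 h2; rewrite -[- cint D g]mulN1r -cintZ// -cintD//.
  by apply: eq_cint => x _; rewrite mulN1r.
exact: cintegrableZ.
Qed.

Lemma cintegrable0 D : measurable D -> cintegrable D (fun=> 0).
Proof. by move=> mD; split; apply: eq_integrable (integrable0 _ _). Qed.

Lemma cint0 D : cint D (fun=> 0) = 0.
Proof.
by rewrite /cint /= /Rintegral integral0.
Qed.

Lemma cintegrable_sum (I : Type) (s : seq I) D (F : I -> R -> C) : measurable D ->
  (forall i, cintegrable D (F i)) -> cintegrable D (fun x => \sum_(i <- s) F i x).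
Proof.
move=> mD h; elim: s => [|i s IH].
  by apply: eq_cintegrable (cintegrable0 mD) => // x _; rewrite big_nil.
by apply: eq_cintegrable (cintegrableD mD (h i) IH) => // x _; rewrite big_cons.
Qed.

Lemma cint_sum (I : Type) (s : seq I) D (F : I -> R -> C) : measurable D ->
  (forall i, cintegrable D (F i)) ->
  cint D (fun x => \sum_(i <- s) F i x) = \sum_(i <- s) cint D (F i).
Proof.
move=> mD h; elim: s => [|i s IH].
  by rewrite big_nil -[RHS](cint0 D); apply: eq_cint => x _; rewrite big_nil.
rewrite big_cons -IH -cintD//; last exact: cintegrable_sum.
by apply: eq_cint => x _; rewrite big_cons.
Qed.

Lemma dominated_cint_cvg D (f_ : nat -> R -> C) f b : measurable D ->
  (forall n, cmeas (f_ n)) -> cmeas f ->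
  {ae mu, forall x, D x -> ccvg (f_ ^~ x) (f x)} ->
  mu.-integrable D (EFin \o b) ->
  {ae mu, forall x, D x -> forall n, normc (f_ n x) <= b x} ->
  ccvg (fun n => cint D (f_ n)) (cint D f).
Proof.
move=> mD mf_ [m1 m2] cf ib h; split => /=; apply: (dominated_Rintegral_cvg mD _ _ _ ib).
- by move=> n; have [? _] := mf_ n; apply: measurable_funTS.
- exact: measurable_funTS.
- by apply: ae_imp cf _ => x c Dx; have [] := c Dx.
- by apply: ae_imp h _ => x h Dx n; rewrite (le_trans (normc_ge_Re _) (h Dx n)).
- by move=> n; have [_ ?] := mf_ n; apply: measurable_funTS.
- exact: measurable_funTS.
- by apply: ae_imp cf _ => x c Dx; have [] := c Dx.
- by apply: ae_imp h _ => x h Dx n; rewrite (le_trans (normc_ge_Im _) (h Dx n)).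
Qed.

Lemma cint_derivative (F f : R -> C) (l0 l1 : C) : cdiff F f -> ccont f ->
  cintegrable setT f -> ccvg (fun n => F n%:R) l1 -> ccvg (fun n => F (- n%:R)) l0 ->
  cint setT f = l1 - l0.
Proof.
move=> dF [c1 c2] [i1 i2] [a1 b1] [a0 b0]; apply: complex_ext; rewrite !ReImE /=.
  exact: (@Rintegral_derivative _ (fun x => complex.Re (F x)) (fun x => complex.Re (f x)) _ _ (fun x => (dF x).1) c1 i1 a1 a0).
exact: (@Rintegral_derivative _ (fun x => complex.Im (F x)) (fun x => complex.Im (f x)) _ _ (fun x => (dF x).2) c2 i2 b1 b0).
Qed.

Lemma cdiff_tail f : ccont f -> cintegrable setT f ->
  cdiff (fun x => cint `[x, +oo[ f) (fun x => - f x).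
Proof.
move=> [c1 c2] [i1 i2] x; split; rewrite ReImE /=.
  exact: is_derive_tail i1 (c1 x).
exact: is_derive_tail i2 (c2 x).
Qed.

Lemma ccont_tail f : cintegrable setT f -> ccont (fun x => cint `[x, +oo[ f).
Proof. by move=> [i1 i2]; split; apply: continuous_tail. Qed.

(** Lebesgue measure is its own pushforward under negation, so this is the change of variables for
    that pushforward, after the domain has been moved into the integrand by restriction. *)
Lemma Rintegral_reflect D (h : R -> R) : measurable D ->
  mu.-integrable D (EFin \o h) ->
  mu.-integrable (-%R @^-1` D) (EFin \o (fun x => h (- x))) /\
  \int[mu]_(x in -%R @^-1` D) h (- x) = \int[mu]_(x in D) h x.
Proof.
move=> mD /(@integrable_mkcond _ _ _ mu D _ mD).1 ih.
pose phi : measurableTypeR R -> measurableTypeR R := -%R.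
have mphi : measurable_fun [set: measurableTypeR R] phi.
  by apply: continuous_measurable_fun => x; exact: opp_continuous.
have mN : measurable (-%R @^-1` D).
  by rewrite -[X in measurable X]setTI; exact: mphi.
have e : (fun x => (EFin \o (fun x => h (- x))) \_ (-%R @^-1` D) x) =
   ((EFin \o h) \_ D) \o phi.
  apply/funext => x; rewrite /= !patchE.
  by rewrite (_ : (x \in -%R @^-1` D) = (phi x \in D))// !inE.
move/integrableP: (ih) => [mh fh].
have mm (k : R -> \bar R) : (\int[pushforward mu phi]_x k x = \int[mu]_x k x)%E.
  by apply: eq_measure_integral => A mA _; exact: lebesgue_measureN.
have ip : mu.-integrable setT (((EFin \o h) \_ D) \o phi).
  apply/integrableP; split; first exact: measurableT_comp.
  rewrite -(@ge0_integral_pushforward _ _ _ _ _ _ mphi mu setT (fun y => `|((EFin \o h) \_ D) y|%E))//.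
    by rewrite mm.
  exact: measurableT_comp.
have h2 := @integral_pushforward _ _ _ _ _ _ mphi mu setT _ mh ip measurableT.
have e' : (EFin \o (fun x => h (- x))) \_ (-%R @^-1` D) = ((EFin \o h) \_ D) \o phi.
  by apply/funext => x; rewrite -e.
split; first by apply/(@integrable_mkcond _ _ _ mu _ _ mN).2; rewrite e'.
rewrite /Rintegral integral_mkcond e' [in RHS]integral_mkcond -[in RHS]mm.
by rewrite h2.
Qed.

Lemma cint_reflect D f : measurable D -> cintegrable D f ->
  cintegrable (-%R @^-1` D) (fun x => f (- x)) /\
  cint (-%R @^-1` D) (fun x => f (- x)) = cint D f.
Proof.
move=> mD [a b]; have [a1 a2] := Rintegral_reflect mD a.
by have [b1 b2] := Rintegral_reflect mD b; split=> //; rewrite /cint a2 b2.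
Qed.

End ComplexIntegrals.

(** * Jost solutions *)

Section Weights.
Context {R : realType}.
Local Notation mu := (@lebesgue_measure R).
Implicit Types (d x y : R).

Definition edecay d x := expR (- (d * `|x|)).

Definition egrow d x := expR (d * `|x|).

Lemma edecay_le1 d x : 0 <= d -> edecay d x <= 1.
Proof. by move=> d0; rewrite -[leRHS]expR0 ler_expR lerNl oppr0 mulr_ge0. Qed.

Lemma continuous_edecay d : continuous (edecay d).
Proof.
move=> x; apply: continuous_comp; last exact: continuous_expR.
apply: cvgN; apply: cvgM; [exact: cvg_cst|exact: norm_continuous].
Qed.

Lemma measurable_edecay d : measurable_fun setT (edecay d).
Proof. by apply: continuous_measurable_fun; exact: continuous_edecay. Qed.

Lemma is_derive_expRM c x : is_derive x 1 (fun y => expR (c * y)) (c * expR (c * x)).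
Proof.
have dl : is_derive x 1 (fun y : R => c * y) c.
  by apply: (@is_derive_eq _ _ _ _ _ _ _ _ (is_deriveZ c (is_derive_id x 1)));
    rewrite /GRing.scale /= mulr1.
apply: (@is_derive_eq _ _ _ _ _ _ _ _ (is_derive1_comp (is_derive_expR _) dl)).
by rewrite mulrC.
Qed.

Lemma is_derive_continuous (f : R -> R) (x l : R) : is_derive x 1 f l ->
  {for x, continuous f}.
Proof. by move=> [d _]; apply: differentiable_continuous; exact/derivable1_diffP. Qed.

Lemma cvg_expR_Ny (c : R) : 0 < c -> expR (- (c * x)) @[x --> +oo] --> 0.
Proof.
move=> c0; apply/cvgrPdist_lt => e e0; near=> x.
rewrite sub0r normrN ger0_norm ?expR_ge0//.
have x0 : 0 < x by near: x; exact: nbhs_pinfty_gt.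
rewrite expRN invf_plt ?posrE ?expR_gt0//.
apply: (@lt_le_trans _ _ (1 + c * x)); last exact: expR_ge1Dx.
rewrite -ltrBlDl -ltr_pdivrMl//.
by near: x; apply: nbhs_pinfty_gt; exact: num_real.
Unshelve. all: by end_near. Qed.

Lemma cvg_edecay_nat d : 0 < d -> edecay d n%:R @[n --> \oo] --> 0.
Proof.
move=> d0; apply: cvg_trans (cvg_comp _ _ (@cvgr_idn R) (cvg_expR_Ny d0)).
by apply: near_eq_cvg; apply: nearW => n; rewrite /edecay /= normr_nat.
Qed.

Lemma integral_edecay d : 0 < d ->
  (\int[mu]_x (edecay d x)%:E = (2 / d)%:E)%E.
Proof.
move=> d0; rewrite ge0_symfun_integralT.
- have e : (\int[mu]_(x in [set x | (0 <= x)%R]) (edecay d x)%:E = (d^-1)%:E)%E.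
    rewrite -set_itvcy.
    transitivity (\int[mu]_(x in `[0%R, +oo[) (expR ((- d) * x))%:E)%E.
      apply: eq_integral => x; rewrite inE /= in_itv /= andbT => x0.
      by rewrite /edecay ger0_norm// mulNr.
    rewrite (@ge0_continuous_FTC2y R _ (fun x => - d^-1 * expR (- d * x)) 0 0).
    + by rewrite mulr0 expR0 mulr1 -EFinB sub0r opprK.
    + by move=> x _; exact: expR_ge0.
    + by apply: continuous_subspaceT => x; exact: is_derive_continuous (is_derive_expRM (- d) x).
    + rewrite -[X in _ --> X](mulr0 (- d^-1)); apply: cvgM; first exact: cvg_cst.
      by under eq_fun do rewrite mulNr; exact: cvg_expR_Ny.
    + by move=> x _; case: (is_deriveZ (- d^-1) (is_derive_expRM (- d) x)).
    + apply: cvg_at_right_filter.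
      exact: is_derive_continuous (is_deriveZ (- d^-1) (is_derive_expRM (- d) 0)).
    + move=> x _; rewrite derive1E.
      case: (is_deriveZ (- d^-1) (is_derive_expRM (- d) x)) => _ ->.
      by rewrite /GRing.scale /=; field; rewrite gt_eqF.
  by rewrite e -EFinM.
- by move=> x; exact: expR_ge0.
- exact: continuous_edecay.
- by move=> x /=; rewrite /edecay normrN.
Qed.

Lemma integrable_edecay d : 0 < d -> mu.-integrable setT (EFin \o edecay d).
Proof.
move=> d0; apply/integrableP; split.
  by apply/measurable_EFinP; exact: measurable_edecay.
rewrite (_ : (\int[mu]_x _)%E = (\int[mu]_x (edecay d x)%:E)%E).
  by rewrite integral_edecay ?ltry.
by apply: eq_integral => x _; rewrite /= ger0_norm// expR_ge0.
Qed.

Lemma integrable_edecayS d (D : set R) : measurable D -> 0 < d ->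
  mu.-integrable D (EFin \o edecay d).
Proof. by move=> mD d0; apply: integrable_subT => //; exact: integrable_edecay. Qed.

Lemma Rintegral_edecay_le d (D : set R) : measurable D -> 0 < d ->
  \int[mu]_(x in D) edecay d x <= 2 / d.
Proof.
move=> mD d0; have -> : 2 / d = \int[mu]_x edecay d x.
  by rewrite /Rintegral integral_edecay.
rewrite Rintegral_mkcond; apply: le_Rintegral => //.
- rewrite -restrict_EFin.
  exact: (@integrable_mkcond _ _ _ mu D _ mD).1 (integrable_edecayS mD d0).
- exact: integrable_edecay.
- move=> x _; rewrite patchE; case: ifPn => // _; exact: expR_ge0.
Qed.

Lemma integrableZ (D : set R) (f : R -> R) c : measurable D ->
  mu.-integrable D (EFin \o f) -> mu.-integrable D (EFin \o (fun x => c * f x)).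
Proof. by move=> mD h; exact: (@integrableZl _ _ _ mu D mD c _ h). Qed.

(* [picard_weight c x] solves [w' = - c (edecay d) w], so that integrating
   [edecay d * w] over [x, +oo[ gains a factor [1 / c]. *)
Definition picard_weight c d x :=
  expR (- (c * \int[mu]_(y in `]-oo, x]) edecay d y)).

Lemma is_derive_picard_weight c d x : 0 < d ->
  is_derive x 1 (picard_weight c d) (- (c * edecay d x * picard_weight c d x)).
Proof.
move=> d0; have h := is_derive_head (integrable_edecay d0) (@continuous_edecay d x).
have h2 := is_deriveN (is_deriveZ c h).
apply: (@is_derive_eq _ _ _ _ _ _ _ _ (is_derive1_comp (is_derive_expR _) h2)).
by rewrite /GRing.scale /= mulrN; congr (- _); rewrite mulrC.
Qed.

Lemma picard_weight_le1 c d x : 0 <= c -> 0 < d -> picard_weight c d x <= 1.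
Proof.
move=> c0 d0; rewrite -[leRHS]expR0 ler_expR lerNl oppr0 mulr_ge0//.
by apply: Rintegral_ge0 => y _; exact: expR_ge0.
Qed.

Lemma picard_weight_ge c d x : 0 <= c -> 0 < d ->
  expR (- (c * (2 / d))) <= picard_weight c d x.
Proof.
by move=> c0 d0; rewrite ler_expR lerN2 ler_wpM2l// Rintegral_edecay_le.
Qed.

Lemma continuous_picard_weight c d : 0 < d -> continuous (picard_weight c d).
Proof.
by move=> d0 x; exact: is_derive_continuous (is_derive_picard_weight c x d0).
Qed.

Lemma integrable_edecay_weight c d (D : set R) : measurable D -> 0 <= c -> 0 < d ->
  mu.-integrable D (EFin \o (fun y => edecay d y * picard_weight c d y)).
Proof.
move=> mD c0 d0; apply: (ae_dominated_integrable mD _ (integrable_edecayS mD d0)).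
  apply: measurable_funM; apply: measurable_funTS.
    exact: measurable_edecay.
  by apply: continuous_measurable_fun; exact: continuous_picard_weight.
apply: aeW => x _; rewrite ger0_norm ?mulr_ge0 ?expR_ge0//.
by rewrite ler_piMr ?expR_ge0// picard_weight_le1.
Qed.

Lemma Rintegral_weight_le c d x : 0 < c -> 0 < d ->
  \int[mu]_(y in `[x, +oo[) (edecay d y * picard_weight c d y)
    <= c^-1 * picard_weight c d x.
Proof.
move=> c0 d0.
set p := fun y => edecay d y * picard_weight c d y; set S := fun x => \int[mu]_(y in `[x, +oo[) p y.
have ip : mu.-integrable setT (EFin \o p) by apply: integrable_edecay_weight => //; exact: ltW.
have cp : continuous p.
  by move=> y; apply: cvgM; [exact: continuous_edecay|exact: continuous_picard_weight].
(* By the differential equation of the weight [G] has derivative 0, hence [G x = G n] for every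
   natural [n]. Without its nonpositive weight term, [G n] is at most the tail from [n], which tends
   to 0. *)
pose G y := S y - c^-1 * picard_weight c d y.
have dG (y : R) : is_derive y 1 G 0.
  have h := is_deriveB (is_derive_tail ip (cp y)) (is_deriveZ c^-1 (is_derive_picard_weight c y d0)).
  apply: (@is_derive_eq _ _ _ _ _ _ _ _ h).
  by rewrite /GRing.scale /= /p; field; rewrite gt_eqF.
have Gc (n : nat) : G x = G n%:R by exact: (@is_derive_0_is_cst R G x n%:R dG).
rewrite -subr_le0 -/(S x) -/(G x).
have le n : G x <= edecay (d / 2) n%:R * (2 / (d / 2)).
  have d2 : 0 < d / 2 by rewrite divr_gt0.
  rewrite (Gc n) lerBlDr; apply: ler_wpDr.
    by rewrite mulr_ge0 ?invr_ge0 ?expR_ge0// ltW.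
  apply: (@le_trans _ _ (\int[mu]_(y in `[n%:R, +oo[) (edecay (d / 2) n%:R * edecay (d / 2) y))).
    apply: le_Rintegral => //.
    - exact: integrable_subT.
    - by apply: integrableZ => //; exact: integrable_edecayS.
    - move=> y; rewrite /= in_itv /= andbT => ny.
      have y0 : 0 <= y by rewrite (le_trans _ ny).
      rewrite /p (@le_trans _ _ (edecay d y))//.
        by rewrite ler_piMr ?expR_ge0// picard_weight_le1// ltW.
      rewrite /edecay -expRD ler_expR normr_nat ger0_norm// -opprD lerN2 -mulrDr.
      rewrite -mulrA ler_wpM2l//; first exact: ltW.
      by lra.
  rewrite RintegralZl//; last exact: integrable_edecayS.
  by rewrite ler_wpM2l ?expR_ge0// Rintegral_edecay_le.
have cv : edecay (d / 2) n%:R * (2 / (d / 2)) @[n --> \oo] --> 0.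
  rewrite -(mul0r (2 / (d / 2))); apply: cvgM; last exact: cvg_cst.
  by apply: cvg_edecay_nat; rewrite divr_gt0.
by apply: (cvgr_to_ge cv); apply: nearW => n; exact: le.
Qed.

End Weights.

(** * The Volterra equation: contraction, uniqueness, iteration *)

Section Volterra.
Context {R : realType}.
Local Notation C := R[i].
Local Notation mu := (@lebesgue_measure R).
Context (al a be M : R) (k : C).
Context (hk : `|complex.Im k| <= al).
Context (ala : al < a).
Context (abe : a < be / 2).
Context (M0 : 0 < M).

Let d := be - 2 * a.
Let c0 := (a - al)^-1.
Let d0 : 0 < d. Proof. by rewrite /d subr_gt0 mulrC -ltr_pdivlMr. Qed.
Let al0 : 0 <= al. Proof. exact: le_trans hk. Qed.
Let a0 : 0 <= a. Proof. by rewrite ltW// (le_lt_trans al0). Qed.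
Let c00 : 0 < c0. Proof. by rewrite /c0 invr_gt0 subr_gt0. Qed.

Local Notation egrow := (egrow a).
Implicit Types x y : R.

Lemma egrow_gt0 x : 0 < egrow x. Proof. exact: expR_gt0. Qed.

Lemma egrowD x y : egrow (y - x) <= egrow x * egrow y.
Proof.
by rewrite /egrow -expRD ler_expR -mulrDr ler_wpM2l// (le_trans (ler_normB _ _))// addrC.
Qed.

Lemma egrow_decay y : egrow y * edecay be y = edecay d y * expR (- (a * `|y|)).
Proof. by rewrite /egrow /edecay -!expRD; congr expR; rewrite /d; ring. Qed.

(** The decay rate [be] of the potential is split three ways: [a] compensates the growth of the
    kernel in [y], another [a] normalizes the solution, and [d = be - 2 * a] remains as an
    integrable weight. The growth in [x] comes out as [egrow x]. *)
Lemma kernel_bound (q z : C) (u c x y : R) : 0 <= c ->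
  normc q <= c * egrow (y - x) -> `|u| <= M * edecay be y ->
  normc (q * u%:C * z) <=
    c * M * egrow x * (edecay d y * (expR (- (a * `|y|)) * normc z)).
Proof.
move=> c0' hq hu; rewrite !normcM normcR.
have -> : c * M * egrow x * (edecay d y * (expR (- (a * `|y|)) * normc z))
  = c * (egrow x * egrow y) * (M * edecay be y) * normc z.
  have -> : c * (egrow x * egrow y) * (M * edecay be y) * normc z =
    c * M * egrow x * (egrow y * edecay be y) * normc z by ring.
  by rewrite egrow_decay; ring.
rewrite ler_wpM2r ?normc_ge0// ler_pM ?normc_ge0//.
by rewrite (le_trans hq)// ler_wpM2l// egrowD.
Qed.

Lemma sink_bound x y : normc (sink k (y - x)) <= c0 * egrow (y - x).
Proof. exact: normc_sink_exp. Qed.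

Lemma ccos_bound x y : normc (ccos (k * (y - x)%:C)) <= 1 * egrow (y - x).
Proof. by rewrite mul1r; apply: normc_ccos_exp; rewrite (le_trans hk)// ltW. Qed.

Lemma ccont_sink : ccont (sink k). Proof. exact: cdiff_ccont (cdiff_sink k). Qed.
Lemma ccont_ccos : ccont (fun x => ccos (k * x%:C)).
Proof. exact: cdiff_ccont (cdiff_ccos k). Qed.

Lemma ccont_sinkB x : ccont (fun y => sink k (y - x)).
Proof.
apply: (@eq_ccont _ (fun y => sink k y * ccos (k * x%:C) - ccos (k * y%:C) * sink k x)).
  by move=> y; rewrite -sinkB.
apply: ccontB; apply: ccontM; by [exact: ccont_sink|exact: ccont_ccos|exact: ccont_cst].
Qed.

Lemma ccont_ccosB x : ccont (fun y => ccos (k * (y - x)%:C)).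
Proof.
apply: (@eq_ccont _ (fun y => ccos (k * y%:C) * ccos (k * x%:C) + k ^+ 2 * (sink k y * sink k x))).
  by move=> y; rewrite -ccosB.
apply: ccontD; first by apply: ccontM; [exact: ccont_ccos|exact: ccont_cst].
apply: ccontM; first exact: ccont_cst.
by apply: ccontM; [exact: ccont_sink|exact: ccont_cst].
Qed.

Context (U : R -> R).
Context (mU : measurable_fun setT U).
Context (hU : {ae mu, forall x, `|U x| <= M * edecay be x}).

Section Operator.
Context (h q : R -> C) (x c B : R) (D : set R).
Context (mD : measurable D).
Context (c_ge0 : 0 <= c).
Context (hq : forall y, normc (q y) <= c * egrow (y - x)).
Context (hh : forall y, D y -> normc (h y) <= B * egrow y).

Lemma kernel_ae_bound : {ae mu, forall y, D y ->
  normc (q y * (U y)%:C * h y) <= c * M * egrow x * B * edecay d y}.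
Proof.
apply: ae_imp hU _ => y hy Dy; rewrite (le_trans (kernel_bound _ c_ge0 (hq y) hy))//.
rewrite mulrA -[leRHS]mulrA [B * _]mulrC [leRHS]mulrA.
apply: ler_wpM2l; first by rewrite !mulr_ge0 ?expR_ge0// ltW.
by rewrite expRN ler_pdivrMl ?expR_gt0// mulrC; exact: hh.
Qed.


Lemma kernel_integrable : cmeas q -> cmeas h ->
  cintegrable D (fun y => q y * (U y)%:C * h y).
Proof.
move=> mq mh; apply: (cintegrable_dom mD _ _ kernel_ae_bound).
  by apply: cmeasM => //; apply: cmeasM => //; exact: cmeas_real.
by apply: integrableZ => //; exact: integrable_edecayS.
Qed.

Lemma kernel_cint_le : 0 <= B -> cintegrable D (fun y => q y * (U y)%:C * h y) ->
  normc (cint D (fun y => q y * (U y)%:C * h y)) <= 4 / d * (c * M * B) * egrow x.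
Proof.
move=> B0 ic; have ie := integrable_edecayS mD d0.
apply: le_trans (normc_cint_le mD ic _ kernel_ae_bound) _.
  exact: integrableZ.
rewrite RintegralZl//.
apply: (@le_trans _ _ (2 * (c * M * egrow x * B * (2 / d)))).
  rewrite ler_wpM2l// ler_wpM2l// ?Rintegral_edecay_le//.
  by rewrite !mulr_ge0// ltW// egrow_gt0.
by rewrite le_eqVlt; apply/orP; left; apply/eqP; field; rewrite gt_eqF.
Qed.

End Operator.

Definition volterra (h : R -> C) x :=
  cint `[x, +oo[ (fun y => sink k (y - x) * (U y)%:C * h y).

(** Chosen so that [volterra] halves the weighted norm: [normc_cint_le] contributes 2, the kernel
    [c0 * M], and the integration of the weight [1 / cW], together 1/2. *)
Let cW := 4 * c0 * M.
Let cW0 : 0 < cW. Proof. by rewrite /cW !mulr_gt0. Qed.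
Definition vweight x := egrow x * picard_weight cW d x.

Lemma vweight_ge0 x : 0 <= vweight x.
Proof. by rewrite mulr_ge0 ?expR_ge0. Qed.

Lemma vweight_le x : vweight x <= egrow x.
Proof. by rewrite ler_piMr ?expR_ge0// picard_weight_le1// ltW. Qed.

Lemma vweight_ge x : egrow x <= expR (cW * (2 / d)) * vweight x.
Proof.
rewrite /vweight mulrCA ler_peMr ?expR_ge0//.
have := @picard_weight_ge R cW d x (ltW cW0) d0.
by rewrite expRN -ler_pdivrMl ?expR_gt0// mulr1.
Qed.

(** Thanks to the weight, the contraction holds for potentials of any size [M]. Only values of [h]
    to the right of [x] enter, so the bound also serves on half-lines in the uniqueness proof. *)
Lemma volterra_weight_le (h : R -> C) x B : 0 <= B ->
  (forall y, x <= y -> normc (h y) <= B * vweight y) ->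
  cintegrable `[x, +oo[ (fun y => sink k (y - x) * (U y)%:C * h y) ->
  normc (volterra h x) <= B / 2 * vweight x.
Proof.
move=> B0 hh ih.
have mD : measurable `[x, +oo[ by exact: measurable_itv.
have iw := integrable_edecay_weight mD (ltW cW0) d0.
have ae : {ae mu, forall y, `[x, +oo[%classic y ->
  normc (sink k (y - x) * (U y)%:C * h y) <=
    c0 * M * egrow x * B * (edecay d y * picard_weight cW d y)}.
  apply: ae_imp hU _ => y hy; rewrite /= in_itv /= andbT => xy.
  rewrite (le_trans (kernel_bound _ (ltW c00) (sink_bound x y) hy))//.
  rewrite mulrA -[leRHS]mulrA [B * _]mulrCA [leRHS]mulrA.
  apply: ler_wpM2l; first by rewrite !mulr_ge0 ?expR_ge0// ltW.
  by rewrite expRN ler_pdivrMl ?expR_gt0// mulrCA; exact: hh.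
apply: le_trans (normc_cint_le mD ih _ ae) _; first exact: integrableZ.
rewrite RintegralZl//.
have h2 := @Rintegral_weight_le R cW d x cW0 d0.
have p0 : 0 <= c0 * M * egrow x * B.
  by rewrite !mulr_ge0// ltW// egrow_gt0.
apply: le_trans (ler_wpM2l _ (ler_wpM2l p0 h2)) _ => //.
rewrite /vweight /cW le_eqVlt; apply/orP; left; apply/eqP; field.
by rewrite !gt_eqF.
Qed.

Lemma volterra_split h x :
  cintegrable `[x, +oo[ (fun y => sink k y * (U y)%:C * h y) ->
  cintegrable `[x, +oo[ (fun y => ccos (k * y%:C) * (U y)%:C * h y) ->
  volterra h x =
    ccos (k * x%:C) * cint `[x, +oo[ (fun y => sink k y * (U y)%:C * h y)
    - sink k x * cint `[x, +oo[ (fun y => ccos (k * y%:C) * (U y)%:C * h y).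
Proof.
move=> i1 i2; rewrite -!cintZ// -cintB//; try exact: cintegrableZ.
by apply: eq_cint => y _; rewrite sinkB; ring.
Qed.

Section Bounded.
Context (h : R -> C) (B : R).
Context (mh : cmeas h).
Context (hh : forall y, normc (h y) <= B * egrow y).

Lemma integrable_sinkU D : measurable D ->
  cintegrable D (fun y => sink k y * (U y)%:C * h y).
Proof.
move=> mD; apply: (@kernel_integrable h (sink k) 0 c0 B D) => //.
- exact: ltW.
- by move=> y; have := sink_bound 0 y; rewrite subr0.
- exact/ccont_cmeas/ccont_sink.
Qed.

Lemma integrable_ccosU D : measurable D ->
  cintegrable D (fun y => ccos (k * y%:C) * (U y)%:C * h y).
Proof.
move=> mD; apply: (@kernel_integrable h (fun y => ccos (k * y%:C)) 0 1 B D) => //.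
- by move=> y; have := ccos_bound 0 y; rewrite subr0.
- exact/ccont_cmeas/ccont_ccos.
Qed.

Lemma integrable_sinkBU D x : measurable D ->
  cintegrable D (fun y => sink k (y - x) * (U y)%:C * h y).
Proof.
move=> mD; apply: (@kernel_integrable h (fun y => sink k (y - x)) x c0 B D) => //.
- exact: ltW.
- by move=> y; exact: sink_bound.
- exact/ccont_cmeas/ccont_sinkB.
Qed.

Lemma integrable_ccosBU D x : measurable D ->
  cintegrable D (fun y => ccos (k * (y - x)%:C) * (U y)%:C * h y).
Proof.
move=> mD; apply: (@kernel_integrable h (fun y => ccos (k * (y - x)%:C)) x 1 B D) => //.
- by move=> y; exact: ccos_bound.
- exact/ccont_cmeas/ccont_ccosB.
Qed.

Lemma volterra_tails x : volterra h x =
    ccos (k * x%:C) * cint `[x, +oo[ (fun y => sink k y * (U y)%:C * h y)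
    - sink k x * cint `[x, +oo[ (fun y => ccos (k * y%:C) * (U y)%:C * h y).
Proof. by apply: volterra_split; [exact: integrable_sinkU|exact: integrable_ccosU]. Qed.

Lemma ccont_volterra : ccont (volterra h).
Proof.
apply: eq_ccont (fun x => esym (volterra_tails x)) _.
apply: ccontB; apply: ccontM.
- exact: ccont_ccos.
- by apply: ccont_tail; exact: integrable_sinkU.
- exact: ccont_sink.
- by apply: ccont_tail; exact: integrable_ccosU.
Qed.

End Bounded.

(** [sink k] has derivative 1 at 0, so it cannot vanish identically; the value [sink k r] is the
    determinant in the uniqueness argument. *)
Lemma sink_neq0 : exists2 r : R, 0 < r & sink k r != 0.
Proof.
apply: contrapT => H.
have s0 (r : R) : sink k r = 0.
  have h (t : R) : 0 < t -> sink k t = 0.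
    by move=> t0; apply/eqP; apply: contrapT => /negP h; apply: H; exists t.
  case: (ltrgt0P r) => [/h//|r0|->]; last exact: sink0.
  by rewrite -[r]opprK sinkN h ?oppr0// oppr_gt0.
have [[_ e1] _] := cdiff_sink k 0.
have [[_ e2] _] := cdiff_cst (0 : C) (0 : R).
have e : (fun y => complex.Re (sink k y)) = (fun y : R => complex.Re (0 : C)).
  by apply/funext => y; rewrite s0.
move: e1; rewrite e e2 /ccos mulr0 mulr0 oppr0 cexp0 -mulr2n -[_ *+ 2]mulr_natr.
by rewrite mul1r divff ?pnatr_eq0//= => /esym/eqP; rewrite oner_eq0.
Qed.

Lemma cint_tail_bounded (p : R -> C) x0 : cintegrable `[x0, +oo[ p ->
  exists2 B : R, 0 <= B & forall x, x0 <= x -> normc (cint `[x, +oo[ p) <= B.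
Proof.
move=> ip; have [i1 i2] := ip.
pose b y := `|complex.Re (p y)| + `|complex.Im (p y)|.
have ib : mu.-integrable `[x0, +oo[ (EFin \o b).
  have m0 : measurable `[x0, +oo[ by exact: measurable_itv.
  have h := @integrableD _ _ _ mu _ m0 _ _ (integrable_norm i1) (integrable_norm i2).
  exact: eq_integrable h.
have b0 y : 0 <= b y by rewrite addr_ge0.
exists (2 * \int[mu]_(y in `[x0, +oo[) b y).
  by rewrite mulr_ge0// Rintegral_ge0.
move=> x xx0; have sub : `[x, +oo[ `<=` `[x0, +oo[.
  by move=> y /=; rewrite !in_itv /= !andbT; exact: le_trans.
have mD (z : R) : measurable `[z, +oo[ by exact: measurable_itv.
have ib' : mu.-integrable `[x, +oo[ (EFin \o b) by exact: (@integrableS _ _ _ mu _ _ _ (mD x0) (mD x) sub ib).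
have ip' := cintegrableS (mD x0) (mD x) sub ip.
have aeb : {ae mu, forall y, `[x, +oo[%classic y -> normc (p y) <= b y}.
  by apply: aeW => y _; exact: normc_le_ReIm.
apply: le_trans (normc_cint_le (mD x) ip' ib' aeb) _.
apply: ler_wpM2l => //; rewrite [leLHS]Rintegral_mkcond [leRHS]Rintegral_mkcond.
apply: le_Rintegral => //.
- by rewrite -restrict_EFin; apply: (@integrable_mkcond _ _ _ mu _ _ (mD x)).1.
- by rewrite -restrict_EFin; apply: (@integrable_mkcond _ _ _ mu _ _ (mD x0)).1.
move=> y _; rewrite !patchE; case: ifPn => [/set_mem yx|_].
  by rewrite mem_set//; exact: sub.
by case: ifPn.
Qed.

(** No growth of [g] is assumed, only convergence of its Volterra integrals. Convergence at the two
    base points [x0] and [x0 - r] is a 2 by 2 linear system for the integrands with [sink k y] and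
    with [ccos (k * y%:C)], of determinant [sink k r]. Hence both are integrable, [g] grows at most
    like [egrow] on the half-line, and iterating the contraction forces [g x0 = 0]. *)
Lemma volterra_unique (g : R -> C) :
  (forall x, cintegrable `[x, +oo[ (fun y => sink k (y - x) * (U y)%:C * g y) /\
    g x = volterra g x) -> forall x, g x = 0.
Proof.
move=> hg x0; have [r r0 rn0] := sink_neq0.
have mD x : measurable `[x, +oo[ by exact: measurable_itv.
pose x1 := x0 - r; have i0 := (hg x0).1.
have i1 : cintegrable `[x0, +oo[ (fun y => sink k (y - x1) * (U y)%:C * g y).
  apply: cintegrableS (hg x1).1 => // y /=; rewrite !in_itv /= !andbT.
  by apply: le_trans; rewrite /x1 gerBl ltW.
have det : sink k x0 * ccos (k * x1%:C) - ccos (k * x0%:C) * sink k x1 = sink k r.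
  by rewrite -sinkB; congr sink; rewrite /x1; ring.
have iS : cintegrable `[x0, +oo[ (fun y => sink k y * (U y)%:C * g y).
  have h := cintegrableZ (sink k r)^-1 (mD x0) (cintegrableB (mD x0)
    (cintegrableZ (sink k x0) (mD x0) i1) (cintegrableZ (sink k x1) (mD x0) i0)).
  apply: eq_cintegrable h => // y _; rewrite (sinkB k x1 y) (sinkB k x0 y).
  apply: (mulfI rn0); rewrite mulVKf// -det; ring.
have iC : cintegrable `[x0, +oo[ (fun y => ccos (k * y%:C) * (U y)%:C * g y).
  have h := cintegrableZ (sink k r)^-1 (mD x0) (cintegrableB (mD x0)
    (cintegrableZ (ccos (k * x0%:C)) (mD x0) i1) (cintegrableZ (ccos (k * x1%:C)) (mD x0) i0)).
  apply: eq_cintegrable h => // y _; rewrite (sinkB k x1 y) (sinkB k x0 y).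
  apply: (mulfI rn0); rewrite mulVKf// -det; ring.
have [B1 B10 hB1] := cint_tail_bounded iS.
have [B2 B20 hB2] := cint_tail_bounded iC.
have sub x : x0 <= x -> `[x, +oo[ `<=` `[x0, +oo[.
  by move=> xx0 y /=; rewrite !in_itv /= !andbT; exact: le_trans.
pose B := (B1 + c0 * B2) * expR (cW * (2 / d)).
have B0 : 0 <= B by rewrite /B mulr_ge0 ?expR_ge0// addr_ge0// mulr_ge0// ltW.
(* The base case uses the bounds [B1] and [B2] of the two tails, and the exponential in [B] converts
   [egrow] into [vweight]. Each further step applies the equation and gains 1/2. *)
have bd n x : x0 <= x -> normc (g x) <= B / 2 ^+ n * vweight x.
  elim: n x => [|n IH] x xx0.
    rewrite expr0 divr1 (hg x).2 volterra_split.
    - rewrite (le_trans (ler_normcB _ _))// (normcM (ccos _)) (normcM (sink k x)).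
      rewrite (@le_trans _ _ ((B1 + c0 * B2) * egrow x))//.
        rewrite mulrDl lerD//.
          rewrite mulrC ler_pM ?normc_ge0// ?hB1//.
          by have := ccos_bound 0 x; rewrite subr0 mul1r.
        rewrite [leRHS]mulrAC ler_pM ?normc_ge0// ?hB2//.
        by have := sink_bound 0 x; rewrite subr0.
      rewrite /B -mulrA ler_wpM2l// ?vweight_ge//.
      by rewrite addr_ge0// mulr_ge0// ltW.
    - exact: cintegrableS (mD _) (mD _) (sub _ xx0) iS.
    - exact: cintegrableS (mD _) (mD _) (sub _ xx0) iC.
  have -> : B / 2 ^+ n.+1 = B / 2 ^+ n / 2 by rewrite exprS invfM mulrA mulrAC.
  rewrite (hg x).2.
  apply: volterra_weight_le; first by rewrite mulr_ge0// invr_ge0 exprn_ge0.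
  - by move=> y xy; apply: IH; exact: le_trans xy.
  - exact: (hg x).1.
apply: eq0_normc; apply/eqP; rewrite eq_le normc_ge0 andbT.
have cv : B / 2 ^+ n * vweight x0 @[n --> \oo] --> 0.
  rewrite -(mul0r (vweight x0)); apply: cvgM; last exact: cvg_cst.
  rewrite -(mulr0 B); apply: cvgM; first exact: cvg_cst.
  under eq_fun do rewrite -exprVn.
  by apply: cvg_expr; rewrite ger0_norm ?invr_ge0// invf_lt1 ?ltr1n.
by apply: (cvgr_to_ge cv); apply: nearW => n; exact: bd.
Qed.

Let ek x := cexp ('i * k * x%:C).

Lemma normc_expik x : normc (cexp ('i * k * x%:C)) <= egrow x.
Proof.
rewrite normc_cexp ler_expR !ReImE /=.
rewrite [X in X <= _](_ : _ = - complex.Im k * x); last by ring.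
rewrite (le_trans (ler_norm _))// normrM normrN ler_wpM2r//.
by rewrite (le_trans hk)// ltW.
Qed.

Lemma ccont_expik : ccont ek.
Proof. exact: cdiff_ccont (cdiff_cexp ('i * k)). Qed.

Lemma volterraB (h1 h2 : R -> C) B1 B2 x : cmeas h1 -> cmeas h2 ->
  (forall y, normc (h1 y) <= B1 * egrow y) ->
  (forall y, normc (h2 y) <= B2 * egrow y) ->
  volterra (fun y => h1 y - h2 y) x = volterra h1 x - volterra h2 x.
Proof.
move=> m1 m2 b1 b2; rewrite /volterra -cintB//.
- by apply: eq_cint => y _; ring.
- exact: integrable_sinkBU b1 _ _ _.
- exact: integrable_sinkBU b2 _ _ _.
Qed.

(** Starting from 0 makes the free exponential the first increment, so that iterates are bounded by
    a geometric sum without a separate initial term. *)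
Fixpoint picard (n : nat) : R -> C :=
  if n is n'.+1 then fun x => ek x + volterra (picard n') x else fun=> 0.

Let E0 := expR (cW * (2 / d)).

Lemma picard_bounds n : [/\ ccont (picard n),
  forall x, normc (picard n x) <= (2 - 2 / 2 ^+ n) * E0 * vweight x &
  forall x, normc (picard n.+1 x - picard n x) <= E0 / 2 ^+ n * vweight x].
Proof.
have E00 : 0 <= E0 by exact: expR_ge0.
have grow (B : R) x : 0 <= B -> B * vweight x <= B * egrow x.
  by move=> B0; rewrite ler_wpM2l// vweight_le.
have p2 m : 0 <= 2 - 2 / 2 ^+ m :> R.
  rewrite subr_ge0 ler_pdivrMr ?exprn_gt0// ler_peMr//.
  by rewrite exprn_ege1// ler1n.
have pow m x : (2 - 2 / 2 ^+ m) * E0 * vweight x + E0 / 2 ^+ m * vweight x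
  = (2 - 2 / 2 ^+ m.+1) * E0 * vweight x.
  by rewrite exprS; field; rewrite expf_neq0.
elim: n => [|n [c1 b1 b2]].
  have v0 x : volterra (fun=> 0) x = 0.
    by rewrite -[RHS](cint0 `[x, +oo[%classic); apply: eq_cint => y _; rewrite mulr0.
  split; first exact: ccont_cst.
    by move=> x; rewrite expr0 divr1 subrr !mul0r normc0.
  move=> x; have -> : picard 1 x - picard 0 x = ek x.
    by rewrite -[RHS]addr0 -(v0 x) -[RHS]subr0.
  rewrite expr0 divr1.
  exact: le_trans (normc_expik x) (vweight_ge x).
have b3 x : normc (picard n.+1 x) <= (2 - 2 / 2 ^+ n.+1) * E0 * vweight x.
  rewrite -(subrK (picard n x) (picard n.+1 x)) addrC.
  rewrite (le_trans (le_normcD _ _))// -pow lerD//.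
have g1 x : normc (picard n x) <= (2 - 2 / 2 ^+ n) * E0 * egrow x.
  by rewrite (le_trans (b1 x))// grow// mulr_ge0.
have g3 x : normc (picard n.+1 x) <= (2 - 2 / 2 ^+ n.+1) * E0 * egrow x.
  by rewrite (le_trans (b3 x))// grow// mulr_ge0.
have c3 : ccont (picard n.+1).
  apply: ccontD; first exact: ccont_expik.
  exact: ccont_volterra (ccont_cmeas c1) g1.
split => // x.
have -> : picard n.+2 x - picard n.+1 x =
   volterra (fun y => picard n.+1 y - picard n y) x.
  rewrite (volterraB _ (ccont_cmeas c3) (ccont_cmeas c1) g3 g1) /=; ring.
have -> : E0 / 2 ^+ n.+1 = E0 / 2 ^+ n / 2 by rewrite exprS invfM mulrA mulrAC.
have q0 : 0 <= E0 / 2 ^+ n by rewrite divr_ge0// exprn_ge0.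
apply: volterra_weight_le => //.
have m2 : cmeas (fun y => picard n.+1 y - picard n y).
  by apply: cmeasB; exact: ccont_cmeas.
apply: (integrable_sinkBU m2 (B := E0 / 2 ^+ n)) => // y.
by rewrite (le_trans (b2 y))// grow.
Qed.

Lemma cvg_geometric_increments (u : nat -> R) (K : R) :
  (forall n, `|u n.+1 - u n| <= K / 2 ^+ n) -> cvgn u.
Proof.
move=> h; have K0 : 0 <= K by have := h 0%N; rewrite expr0 divr1; exact: le_trans.
rewrite (_ : u = fun n => u 0%N + series (telescope u) n); last first.
  by apply/funext => n; rewrite -eq_sum_telescope.
apply: is_cvgD; first exact: is_cvg_cst.
apply: normed_cvg; apply: (@series_le_cvg _ _ (geometric K 2^-1)) => //.
- by move=> n; exact: normr_ge0.
- by move=> n; apply: mulr_ge0 => //; rewrite exprn_ge0// invr_ge0.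
- by move=> n; rewrite /geometric /= exprVn; exact: h.
- by apply: is_cvg_geometric_series; rewrite ger0_norm ?invr_ge0// invf_lt1 ?ltr1n.
Qed.

(** The geometric sum of the increments gives [2 * E0]; passing to the limit in real and imaginary
    part separately doubles it. *)
Definition jost_growth := 4 * E0.

Lemma jost_exists : exists f, [/\ ccont f,
  forall x, normc (f x) <= jost_growth * egrow x & is_jost_plus U k f].
Proof.
have E00 : 0 <= E0 by exact: expR_ge0.
pose f x := lim (complex.Re (picard n x) @[n --> \oo]) +i*
            lim (complex.Im (picard n x) @[n --> \oo]).
have cf x : ccvg (picard ^~ x) (f x).
  split.
    apply: (@cvg_geometric_increments _ (E0 * vweight x)) => n.
    have [_ _ /(_ x)] := picard_bounds n.
    by rewrite -ReN -ReD mulrAC; apply: le_trans; exact: normc_ge_Re.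
  apply: (@cvg_geometric_increments _ (E0 * vweight x)) => n.
  have [_ _ /(_ x)] := picard_bounds n.
  by rewrite -ImN -ImD mulrAC; apply: le_trans; exact: normc_ge_Im.
have bp n x : normc (picard n x) <= 2 * E0 * egrow x.
  have [_ h _] := picard_bounds n; rewrite (le_trans (h x))//.
  rewrite ler_pM ?vweight_ge0 ?vweight_le//.
    rewrite mulr_ge0// subr_ge0 ler_pdivrMr ?exprn_gt0// ler_peMr//.
    by rewrite exprn_ege1// ler1n.
  by rewrite ler_wpM2r// gerBl divr_ge0// exprn_ge0.
have bf x : normc (f x) <= jost_growth * egrow x.
  have [c1 c2] := cf x; rewrite (le_trans (normc_le_ReIm _))//.
  have -> : jost_growth * egrow x = 2 * E0 * egrow x + 2 * E0 * egrow x.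
    by rewrite /jost_growth; ring.
  rewrite lerD//.
    apply: (cvgr_to_le (cvg_norm c1)); apply: nearW => n.
    exact: le_trans (normc_ge_Re _) (bp n x).
  apply: (cvgr_to_le (cvg_norm c2)); apply: nearW => n.
  exact: le_trans (normc_ge_Im _) (bp n x).
have mp n : cmeas (picard n) by have [/ccont_cmeas] := picard_bounds n.
have mf : cmeas f.
  split.
    apply: (measurable_fun_cvg (h := fun n x => complex.Re (picard n x))).
      by move=> n; have [] := mp n.
    by move=> x _; have [] := cf x.
  apply: (measurable_fun_cvg (h := fun n x => complex.Im (picard n x))).
    by move=> n; have [] := mp n.
  by move=> x _; have [] := cf x.
have mD x : measurable `[x, +oo[ by exact: measurable_itv.
have fE x : f x = ek x + volterra f x.
  have c1 : ccvg (fun n => picard n.+1 x) (f x).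
    by have [a1 a2] := cf x; split; [move: a1|move: a2]; rewrite -(cvg_shiftS (fun n => _ (picard n x))).
  apply: ccvg_unique c1 _; apply: ccvgD; first exact: ccvg_cst.
  apply: (dominated_cint_cvg (mD x) _ _ _ (b := fun y => c0 * M * egrow x * (2 * E0) * edecay d y)).
  - by move=> n; apply: cmeasM => //; apply: cmeasM;
      [exact/ccont_cmeas/ccont_sinkB|exact: cmeas_real].
  - by apply: cmeasM => //; apply: cmeasM;
      [exact/ccont_cmeas/ccont_sinkB|exact: cmeas_real].
  - apply: aeW => y _; have [a1 a2] := cf y; split.
      under eq_fun do rewrite ReM; rewrite ReM.
      by apply: cvgB; apply: cvgM => //; exact: cvg_cst.
    under eq_fun do rewrite ImM; rewrite ImM.
    by apply: cvgD; apply: cvgM => //; exact: cvg_cst.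
  - by apply: integrableZ => //; exact: integrable_edecayS.
  - apply: ae_imp hU _ => y hy xy n.
    rewrite (le_trans (kernel_bound _ (ltW c00) (sink_bound x y) hy))//.
    rewrite mulrA -[leRHS]mulrA [2 * E0 * _]mulrC [leRHS]mulrA.
    apply: ler_wpM2l; first by rewrite !mulr_ge0 ?expR_ge0// ltW.
    by rewrite expRN ler_pdivrMl ?expR_gt0// mulrC; exact: bp.
exists f; split => //.
  apply: eq_ccont (fun x => esym (fE x)) _.
  by apply: ccontD; [exact: ccont_expik|exact: ccont_volterra mf bf].
by move=> x /=; split; [exact: integrable_sinkBU mf bf _ _ _|exact: fE].
Qed.

Lemma jost_plus_eq f : is_jost_plus U k f -> jost_plus U k = f.
Proof.
move=> hf; rewrite /jost_plus.
have : is_jost_plus U k (xget (fun=> 0) [set f | is_jost_plus U k f]).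
  exact: (@xgetPex _ (fun=> 0) [set f | is_jost_plus U k f] (ex_intro _ f hf)).
move: (xget _ _) => g hg; apply/funext => x; apply/eqP; rewrite -subr_eq0; apply/eqP.
apply: (@volterra_unique (fun x => g x - f x)) => {}x.
have [i1 e1] := hg x; have [i2 e2] := hf x.
have i3 := cintegrableB (measurable_itv _) i1 i2.
have e3 y : sink k (y - x) * (U y)%:C * g y - sink k (y - x) * (U y)%:C * f y
  = sink k (y - x) * (U y)%:C * (g y - f y) by ring.
split; first by apply: eq_cintegrable i3.
rewrite {1}e1 {1}e2 opprD addrACA subrr add0r -cintB//.
exact: eq_cint.
Qed.

Section Regular.
Context (kappa : R).
Context (hkappa : normc k <= kappa).
Context (cU : continuous U).

Let sU f y := sink k y * (U y)%:C * f y.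
Let cU' f y := ccos (k * y%:C) * (U y)%:C * f y.

Definition jost_slope_growth := kappa + 4 / d * (M * jost_growth).
(** Half of the rate [d] is taken out of the integral as decay in [x] and the other half is
    integrated: [8 / d] is [2 * (2 / (d / 2))]. The factor [1 + c0] covers both kernels, [sink] with
    [c0] and [ccos] with 1. *)
Definition jost_tail := 8 / d * ((1 + c0) * M * jost_growth).

Let growth0 : 0 <= jost_growth. Proof. by rewrite mulr_ge0// expR_ge0. Qed.

(** For [0 <= x <= y] the exponents are signed and add up to [a * (y - x) + a * y - be * y = - a * x
    - d * y]. The factor [expR (- (a * x))] later beats the growth of the other solution in a
    Wronskian. *)
Lemma kernel_cint_decay (f q : R -> C) c x : 0 <= c -> c <= 1 + c0 -> 0 <= x ->
  (forall y, normc (q y) <= c * egrow (y - x)) ->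
  (forall y, normc (f y) <= jost_growth * egrow y) ->
  cintegrable `[x, +oo[ (fun y => q y * (U y)%:C * f y) ->
  normc (cint `[x, +oo[ (fun y => q y * (U y)%:C * f y)) <=
    jost_tail * (expR (- (a * x)) * edecay (d / 2) x).
Proof.
move=> c_ge0 cc0 x0 hq hf ic; have mD : measurable `[x, +oo[ by exact: measurable_itv.
have d2 : 0 < d / 2 by rewrite divr_gt0.
pose Z := c * M * jost_growth * (expR (- (a * x)) * edecay (d / 2) x).
have ae : {ae mu, forall y, `[x, +oo[%classic y ->
    normc (q y * (U y)%:C * f y) <= Z * edecay (d / 2) y}.
  apply: ae_imp hU _ => y hy; rewrite /= in_itv /= andbT => xy.
  have y0 : 0 <= y := le_trans x0 xy.
  rewrite !normcM normcR.
  apply: (@le_trans _ _ (c * egrow (y - x) * (M * edecay be y) * (jost_growth * egrow y))).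
    rewrite ler_pM ?mulr_ge0 ?normc_ge0//.
    by rewrite ler_pM ?normc_ge0.
  rewrite [leLHS](_ : _ = c * M * jost_growth * (egrow (y - x) * edecay be y * egrow y)); last by ring.
  rewrite /Z -[leRHS]mulrA ler_wpM2l//; first by rewrite !mulr_ge0 ?expR_ge0// ltW.
  rewrite /egrow /edecay !ger0_norm ?subr_ge0// -!expRD ler_expR.
  have : d / 2 * x <= d / 2 * y by rewrite ler_wpM2l// ltW.
  by rewrite /d; lra.
apply: le_trans (normc_cint_le mD ic _ ae) _.
  by apply: integrableZ => //; exact: integrable_edecayS.
rewrite RintegralZl//; last exact: integrable_edecayS.
have Z0 : 0 <= Z by rewrite /Z !mulr_ge0 ?expR_ge0// ltW.
apply: (@le_trans _ _ (2 * (Z * (2 / (d / 2))))).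
  by rewrite ler_wpM2l// ler_wpM2l// Rintegral_edecay_le.
have -> : 2 * (Z * (2 / (d / 2))) = 8 / d * Z by field; rewrite gt_eqF.
rewrite /Z /jost_tail [leRHS](_ : _ = 8 / d * ((1 + c0) * M * jost_growth *
  (expR (- (a * x)) * edecay (d / 2) x))); last by ring.
rewrite ler_wpM2l//; first by rewrite divr_ge0// ltW.
rewrite ler_wpM2r ?mulr_ge0 ?expR_ge0//.
by rewrite ler_wpM2r// ler_wpM2r// ltW.
Qed.

Lemma jost_plus_regular : exists2 f', is_jost_plus U k (jost_plus U k) &
  [/\ cdiff (jost_plus U k) f' /\
      cdiff f' (fun x => ((U x)%:C - k ^+ 2) * jost_plus U k x),
      forall x, normc (jost_plus U k x) <= jost_growth * egrow x,
      forall x, normc (f' x) <= jost_slope_growth * egrow x,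
      forall x, 0 <= x -> normc (jost_plus U k x - cexp ('i * k * x%:C)) <=
        jost_tail * (expR (- (a * x)) * edecay (d / 2) x) &
      forall x, 0 <= x -> normc (f' x - 'i * k * cexp ('i * k * x%:C)) <=
        jost_tail * (expR (- (a * x)) * edecay (d / 2) x)].
Proof.
have [f [cf bf hf]] := jost_exists; rewrite (jost_plus_eq hf).
have mf := ccont_cmeas cf.
have mD x : measurable `[x, +oo[ by exact: measurable_itv.
pose S x := cint `[x, +oo[ (sU f); pose Q x := cint `[x, +oo[ (cU' f).
have csU : ccont (sU f).
  apply: ccontM => //; apply: ccontM; [exact: ccont_sink|exact: ccont_real].
have ccU : ccont (cU' f).
  apply: ccontM => //; apply: ccontM; [exact: ccont_ccos|exact: ccont_real].
have dS : cdiff S (fun x => - sU f x).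
  by apply: cdiff_tail => //; exact: (integrable_sinkU mf bf measurableT).
have dQ : cdiff Q (fun x => - cU' f x).
  by apply: cdiff_tail => //; exact: (integrable_ccosU mf bf measurableT).
have fE x : f x = ek x + (ccos (k * x%:C) * S x - sink k x * Q x).
  by rewrite (hf x).2 -(volterra_tails mf bf).
have c2s2 := ccos2Dsink2 k.
(* Differentiating the separated form, the boundary terms of [S] and [Q] cancel because the kernel
   vanishes at [y = x]. In the next derivative they add up to [U f] times the free Wronskian, which
   is 1. *)
pose f' x := 'i * k * ek x - (k ^+ 2 * (sink k x * S x) + ccos (k * x%:C) * Q x).
have f'E x : f' x = 'i * k * ek x -
    cint `[x, +oo[ (fun y => ccos (k * (y - x)%:C) * (U y)%:C * f y).
  have iS := integrable_sinkU mf bf (mD x); have iQ := integrable_ccosU mf bf (mD x).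
  rewrite /f' mulrA /S /Q -(cintZ _ (mD x) iS) -(cintZ _ (mD x) iQ).
  rewrite -(cintD (mD x) (cintegrableZ _ (mD x) iS) (cintegrableZ _ (mD x) iQ)).
  by congr (_ - _); apply: eq_cint => y _; rewrite /sU /cU' ccosB; ring.
have dsS := cdiffM (cdiff_sink k) dS.
have dcQ := cdiffM (cdiff_ccos k) dQ.
have dcS := cdiffM (cdiff_ccos k) dS.
have dsQ := cdiffM (cdiff_sink k) dQ.
have de := cdiff_cexp ('i * k).
have bc y x : normc (ccos (k * (y - x)%:C)) <= 1 * egrow (y - x) by exact: ccos_bound.
exists f' => //; split => //.
- split.
    apply: eq_cdiff (cdiffD de (cdiffB dcS dsQ)) => x; first by rewrite fE.
    rewrite /f' /sU /cU' /ek; move: (ccos (k * x%:C)) (cexp ('i * k * x%:C)) (sink k x) => c e s.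
    by move: (S x) (Q x) (f x) ((U x)%:C) => Sx Qx fx u; ring.
  have h := cdiffB (cdiffZ ('i * k) de) (cdiffD (cdiffZ (k ^+ 2) dsS) dcQ).
  apply: eq_cdiff h => x; first by [].
  have -> : ((U x)%:C - k ^+ 2) * f x = (U x)%:C * f x * (ccos (k * x%:C) * ccos (k * x%:C) +
    k ^+ 2 * (sink k x * sink k x)) - k ^+ 2 * f x by rewrite c2s2; ring.
  rewrite {2}fE /sU /cU'.
  have -> : 'i * k * ('i * k * cexp ('i * k * x%:C)) = - (k ^+ 2 * ek x).
    have -> : 'i * k * ('i * k * cexp ('i * k * x%:C)) = ('i * 'i) * (k ^+ 2 * ek x) by rewrite /ek; ring.
    by rewrite i_sqr mulN1r.
  move: (ccos (k * x%:C)) (ek x) (sink k x) => c e s.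
  by move: (S x) (Q x) (f x) ((U x)%:C) => Sx Qx fx u; ring.
- move=> x; rewrite f'E (le_trans (ler_normcB _ _))// /jost_slope_growth mulrDl lerD//.
    rewrite normcM ler_pM ?normc_ge0//; last exact: normc_expik.
    by rewrite normcM normc_i mul1r.
  have h := @kernel_cint_le f (fun y => ccos (k * (y - x)%:C)) x 1 jost_growth _ (mD x) ler01 (bc^~ x) (fun y _ => bf y) growth0.
  by rewrite (le_trans (h _)) ?mul1r//; exact: (integrable_ccosBU mf bf _ (mD x)).
- move=> x x0; rewrite (hf x).2 addrC addKr.
  apply: (@kernel_cint_decay f (fun y => sink k (y - x)) c0) => //.
  - exact: ltW.
  - by rewrite lerDr.
  - by move=> y; exact: sink_bound.
  - exact: (integrable_sinkBU mf bf _ (mD x)).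
- move=> x x0; rewrite f'E addrC addKr normcN.
  apply: (@kernel_cint_decay f (fun y => ccos (k * (y - x)%:C)) 1) => //.
  - by rewrite lerDl ltW.
  - exact: (integrable_ccosBU mf bf _ (mD x)).
Qed.

End Regular.

End Volterra.

(** * Reflection, which exchanges the two Jost solutions *)

Section Reflection.
Context {R : realType}.
Local Notation C := R[i].
Local Notation mu := (@lebesgue_measure R).
Implicit Types (U : R -> R) (f g : R -> C) (k : C).

Lemma ae_reflect (P : R -> Prop) : {ae mu, forall x, P x} -> {ae mu, forall x, P (- x)}.
Proof.
move=> [A [mA A0 PA]].
have mphi : measurable_fun [set: measurableTypeR R] (-%R : measurableTypeR R -> measurableTypeR R).
  by apply: continuous_measurable_fun => x; exact: opp_continuous.
exists (-%R @^-1` A); split.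
- by rewrite -[X in measurable X]setTI; exact: mphi.
- by have := lebesgue_measureN mA; rewrite A0.
- by move=> x /= Px; apply: PA.
Qed.

Lemma preimage_opp_itv (x : R) : (-%R @^-1` `[- x, +oo[ : set R) = `]-oo, x]%classic.
Proof. by apply/seteqP; split => y /=; rewrite !in_itv /= andbT lerN2. Qed.

Lemma preimage_opp_itv' (x : R) : (-%R @^-1` `]-oo, - x] : set R) = `[x, +oo[%classic.
Proof. by apply/seteqP; split => y /=; rewrite !in_itv /= andbT lerN2. Qed.

(** Reflection preserves Lebesgue measure; the minus sign in front of the integral in the equation
    for [f_-] comes from [sink k] being odd. *)
Lemma is_jost_plus_reflect U k g : is_jost_plus (fun x => U (- x)) k g ->
  is_jost_minus U k (fun x => g (- x)).
Proof.
move=> h x /=; have [i1 e1] := h (- x).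
have [i2 e2] := cint_reflect (measurable_itv `[- x, +oo[) i1.
rewrite preimage_opp_itv in i2 e2.
have mD : measurable `]-oo, x] by exact: measurable_itv.
have e y : -1 * (sink k (- y - - x) * (U (- - y))%:C * g (- y))
    = sink k (y - x) * (U y)%:C * g (- y).
  by rewrite -opprD sinkN opprK; ring.
have i3 := cintegrableZ (-1) mD i2.
split; first by apply: eq_cintegrable i3 => // y _; rewrite e.
have eF : cint `]-oo, x] (fun y => sink k (y - x) * (U y)%:C * g (- y)) =
    - cint `[- x, +oo[ (fun y => sink k (y - - x) * (U (- y))%:C * g y).
  rewrite -e2 -[RHS]mulN1r -(cintZ (-1) mD i2).
  by apply: eq_cint => y _; rewrite e.
by rewrite eF opprK {1}e1 rmorphN mulrN.
Qed.

Lemma is_jost_minus_reflect U k f : is_jost_minus U k f ->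
  is_jost_plus (fun x => U (- x)) k (fun x => f (- x)).
Proof.
move=> h x /=; have [i1 e1] := h (- x).
have [i2 e2] := cint_reflect (measurable_itv `]-oo, - x]) i1.
rewrite preimage_opp_itv' in i2 e2.
have mD : measurable `[x, +oo[ by exact: measurable_itv.
have e y : -1 * (sink k (- y - - x) * (U (- y))%:C * f (- y))
    = sink k (y - x) * (U (- y))%:C * f (- y).
  by rewrite -opprD sinkN; ring.
have i3 := cintegrableZ (-1) mD i2.
split; first by apply: eq_cintegrable i3 => // y _; rewrite e.
have eF : cint `[x, +oo[ (fun y => sink k (y - x) * (U (- y))%:C * f (- y)) =
    - cint `]-oo, - x] (fun y => sink k (y - - x) * (U y)%:C * f y).
  rewrite -e2 -[RHS]mulN1r -(cintZ (-1) mD i2).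
  by apply: eq_cint => y _; rewrite e.
by rewrite eF {1}e1 rmorphN mulrN opprK.
Qed.

End Reflection.

(** * Wronskians of Jost solutions for two potentials *)

Section JostPair.
Context {R : realType}.
Local Notation C := R[i].
Local Notation mu := (@lebesgue_measure R).
Context (al a be M kappa : R) (k : C).
Context (hk : `|complex.Im k| <= al).
Context (ala : al < a).
Context (abe : a < be / 2).
Context (M0 : 0 < M).
Context (hkappa : normc k <= kappa).
Let d := be - 2 * a.

(** The Volterra integral sees the potential only up to null sets. This is what permits continuous
    representatives of the coefficients. *)
Lemma jost_plus_ae (U V : R -> R) : measurable_fun setT U -> measurable_fun setT V ->
  {ae mu, forall x, `|U x| <= M * edecay be x} ->
  {ae mu, forall x, U x = V x} -> jost_plus U k = jost_plus V k.
Proof.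
move=> mU mV hU UV.
have [f [cf bf hf]] := jost_exists hk ala abe M0 mU hU.
rewrite (jost_plus_eq hk ala abe M0 hU hf).
have hV : {ae mu, forall x, `|V x| <= M * edecay be x}.
  by apply: ae_imp2 hU UV _ => x h <-.
symmetry; apply: (jost_plus_eq hk ala abe M0 hV) => x /=.
have mD : measurable `[x, +oo[ by exact: measurable_itv.
have h2 := integrable_sinkBU hk ala abe M0 mV hV (ccont_cmeas cf) bf x mD.
split => //; rewrite (hf x).2; congr (_ + _).
have mS := ccont_cmeas (ccont_sinkB k x).
apply: ae_eq_cint => //.
- by apply: cmeasM; [apply: cmeasM => //; exact: cmeas_real|exact: ccont_cmeas].
- by apply: cmeasM; [apply: cmeasM => //; exact: cmeas_real|exact: ccont_cmeas].
- by apply: ae_imp UV _ => y ->.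
Qed.

Lemma measurable_reflect (U : R -> R) : measurable_fun setT U ->
  measurable_fun setT (fun x : R => U (- x)).
Proof.
by move=> mU; apply: measurableT_comp => //; apply: continuous_measurable_fun => x;
  exact: opp_continuous.
Qed.

Lemma ae_bound_reflect (U : R -> R) : {ae mu, forall x, `|U x| <= M * edecay be x} ->
  {ae mu, forall x, `|U (- x)| <= M * edecay be x}.
Proof. by move=> /ae_reflect h; apply: ae_imp h _ => x; rewrite /edecay normrN. Qed.

(** Reflection is used in both directions: a reflected [f_+] gives existence, so that [xget] selects
    a true solution, and reflecting that solution back lets the uniqueness of [f_+] identify it. *)
Lemma jost_minusE (U : R -> R) : measurable_fun setT U ->
  {ae mu, forall x, `|U x| <= M * edecay be x} ->
  jost_minus U k = fun x => jost_plus (fun y => U (- y)) k (- x).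
Proof.
move=> mU hU; have mU' := measurable_reflect mU; have hU' := ae_bound_reflect hU.
have [f [_ _ hf]] := jost_exists hk ala abe M0 mU' hU'.
have : is_jost_minus U k (jost_minus U k).
  exact: (@xgetPex _ (fun=> 0) [set f | is_jost_minus U k f] (ex_intro _ _ (is_jost_plus_reflect hf))).
move=> /is_jost_minus_reflect /(jost_plus_eq hk ala abe M0 hU') ->.
by apply/funext => x; rewrite opprK.
Qed.

Lemma jost_minus_ae (U V : R -> R) : measurable_fun setT U -> measurable_fun setT V ->
  {ae mu, forall x, `|U x| <= M * edecay be x} ->
  {ae mu, forall x, U x = V x} -> jost_minus U k = jost_minus V k.
Proof.
move=> mU mV hU UV.
have hV : {ae mu, forall x, `|V x| <= M * edecay be x}.
  by apply: ae_imp2 hU UV _ => x h <-.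
rewrite !jost_minusE//; apply/funext => x; congr (_ (- x)).
apply: jost_plus_ae.
- exact: measurable_reflect.
- exact: measurable_reflect.
- exact: ae_bound_reflect.
- exact: (ae_reflect UV).
Qed.

Definition jost_bound := jost_growth al a be M + jost_slope_growth al a be M kappa.
Definition jost_remainder x := jost_tail al a be M * (expR (- (a * x)) * edecay (d / 2) x).

Let kappa0 : 0 <= kappa. Proof. exact: le_trans (normc_ge0 k) hkappa. Qed.

Lemma jost_growth_ge0 : 0 <= jost_growth al a be M.
Proof. by rewrite mulr_ge0// expR_ge0. Qed.

Lemma jost_slope_growth_ge0 : 0 <= jost_slope_growth al a be M kappa.
Proof.
rewrite addr_ge0//; rewrite !mulr_ge0 ?expR_ge0// ?ltW// invr_gt0.
by rewrite subr_gt0 mulrC -ltr_pdivlMr.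
Qed.

Lemma jost_growth_le : jost_growth al a be M <= jost_bound.
Proof. by rewrite lerDl jost_slope_growth_ge0. Qed.

Lemma jost_slope_growth_le : jost_slope_growth al a be M kappa <= jost_bound.
Proof. by rewrite lerDr jost_growth_ge0. Qed.

Lemma jost_plus_props (U : R -> R) : continuous U ->
  (forall x, `|U x| <= M * edecay be x) ->
  exists f', [/\ cdiff (jost_plus U k) f' /\
      cdiff f' (fun x => ((U x)%:C - k ^+ 2) * jost_plus U k x),
      forall x, normc (jost_plus U k x) <= jost_bound * egrow a x,
      forall x, normc (f' x) <= jost_bound * egrow a x,
      forall x, 0 <= x -> normc (jost_plus U k x - cexp ('i * k * x%:C)) <= jost_remainder x &
      forall x, 0 <= x -> normc (f' x - 'i * k * cexp ('i * k * x%:C)) <= jost_remainder x].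
Proof.
move=> cU hU.
have [f' _ [h1 h2 h3 h4 h5]] := jost_plus_regular hk ala abe M0
  (continuous_measurable_fun cU) (ae_all hU) hkappa cU.
exists f'; split => //.
  by move=> x; rewrite (le_trans (h2 x))// ler_wpM2r ?expR_ge0// jost_growth_le.
by move=> x; rewrite (le_trans (h3 x))// ler_wpM2r ?expR_ge0// jost_slope_growth_le.
Qed.

Lemma jost_minus_props (U : R -> R) : continuous U ->
  (forall x, `|U x| <= M * edecay be x) ->
  exists f', [/\ cdiff (jost_minus U k) f' /\
      cdiff f' (fun x => ((U x)%:C - k ^+ 2) * jost_minus U k x),
      forall x, normc (jost_minus U k x) <= jost_bound * egrow a x,
      forall x, normc (f' x) <= jost_bound * egrow a x,
      forall x, 0 <= x -> normc (jost_minus U k (- x) - cexp ('i * k * x%:C)) <= jost_remainder x &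
      forall x, 0 <= x -> normc (f' (- x) + 'i * k * cexp ('i * k * x%:C)) <= jost_remainder x].
Proof.
move=> cU hU; rewrite (jost_minusE (continuous_measurable_fun cU) (ae_all hU)).
have cU' : continuous (fun x => U (- x)).
  by move=> x; apply: continuous_comp; [exact: opp_continuous|exact: cU].
have hU' x : `|U (- x)| <= M * edecay be x.
  by rewrite (le_trans (hU _))// /edecay normrN.
have [f' [[h1 h1'] h2 h3 h4 h5]] := jost_plus_props cU' hU'.
exists (fun x => - f' (- x)); split.
- split; first exact: cdiff_opp.
  apply: eq_cdiff (cdiffN (cdiff_opp h1')) => // x.
  by rewrite !opprK.
- by move=> x; rewrite (le_trans (h2 _))// /egrow normrN.
- by move=> x; rewrite normcN (le_trans (h3 _))// /egrow normrN.
- by move=> x x0; rewrite opprK; exact: h4.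
- by move=> x x0; rewrite opprK addrC -normcN opprB; exact: h5.
Qed.

(** The exponential in the remainder cancels the growth exactly, and the decay with rate [d / 2] is
    left over. *)
Lemma cvg_jost_remainder : jost_remainder n%:R * egrow a n%:R @[n --> \oo] --> 0.
Proof.
have d2 : 0 < d / 2 by rewrite divr_gt0// /d subr_gt0 mulrC -ltr_pdivlMr.
have e (n : nat) : jost_tail al a be M * edecay (d / 2) n%:R =
    jost_remainder n%:R * egrow a n%:R.
  have E : expR (- (a * n%:R)) * expR (a * n%:R) = 1 by rewrite -expRD addNr expR0.
  rewrite /jost_remainder /egrow normr_nat.
  transitivity (jost_tail al a be M * edecay (d / 2) n%:R *
    (expR (- (a * n%:R)) * expR (a * n%:R))); first by rewrite E mulr1.
  by ring.
have h : jost_tail al a be M * edecay (d / 2) n%:R @[n --> \oo] --> jost_tail al a be M * 0.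
  by apply: cvgM; [exact: cvg_cst|exact: cvg_edecay_nat].
rewrite mulr0 in h; apply: cvg_trans h; apply: near_eq_cvg.
by apply: nearW => n; rewrite -e.
Qed.

Lemma wronskianE (f f' g g' : R -> C) x : cdiff f f' -> cdiff g g' ->
  wronskian f g x = f x * g' x - g x * f' x.
Proof. by move=> df dg; rewrite /wronskian (cdiff_cderive1 x df) (cdiff_cderive1 x dg). Qed.

Lemma cdiff0_cst (f : R -> C) x y : cdiff f (fun=> 0) -> f x = f y.
Proof.
move=> h; apply: complex_ext.
  exact: (@is_derive_0_is_cst R (fun x => complex.Re (f x)) x y (fun z => (h z).1)).
exact: (@is_derive_0_is_cst R (fun x => complex.Im (f x)) x y (fun z => (h z).2)).
Qed.

Lemma cdiff_wronskian (f f' g g' : R -> C) (U1 U2 : R -> R) :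
  cdiff f f' -> cdiff f' (fun x => ((U1 x)%:C - k ^+ 2) * f x) ->
  cdiff g g' -> cdiff g' (fun x => ((U2 x)%:C - k ^+ 2) * g x) ->
  cdiff (fun x => f x * g' x - g x * f' x) (fun x => (U2 x - U1 x)%:C * (f x * g x)).
Proof.
move=> h1 h2 h3 h4; apply: eq_cdiff (cdiffB (cdiffM h1 h4) (cdiffM h3 h2)) => // x.
by rewrite real_complexB; ring.
Qed.

(** The Wronskian is bilinear, and the difference of two Jost solutions with the same asymptotics
    decays faster than the third solution grows. Stated for sequences, it serves at both ends of the
    line. *)
Lemma cvg_wronskian_diff (f f' g g' h h' : nat -> C) :
  (forall n, normc (h n) <= jost_bound * egrow a n%:R) ->
  (forall n, normc (h' n) <= jost_bound * egrow a n%:R) ->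
  (forall n, normc (f n - g n) <= jost_remainder n%:R *+ 2) ->
  (forall n, normc (f' n - g' n) <= jost_remainder n%:R *+ 2) ->
  ccvg (fun n => (f n * h' n - h n * f' n) - (g n * h' n - h n * g' n)) 0.
Proof.
move=> b b' r r'.
have cv : jost_bound * 4 * (jost_remainder n%:R * egrow a n%:R) @[n --> \oo] --> 0.
  have cv0 : jost_bound * 4 * (jost_remainder n%:R * egrow a n%:R) @[n --> \oo] --> jost_bound * 4 * 0.
    by apply: cvgM; [exact: cvg_cst|exact: cvg_jost_remainder].
  by rewrite mulr0 in cv0.
apply: ccvg0_squeeze cv _ => n.
have -> : f n * h' n - h n * f' n - (g n * h' n - h n * g' n) =
  (f n - g n) * h' n - h n * (f' n - g' n) by ring.
rewrite (le_trans (ler_normcB _ _))// !normcM.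
apply: (@le_trans _ _ (jost_remainder n%:R *+ 2 * (jost_bound * egrow a n%:R) +
   jost_bound * egrow a n%:R * (jost_remainder n%:R *+ 2))).
  by rewrite lerD// ler_pM ?normc_ge0.
rewrite le_eqVlt; apply/orP; left; apply/eqP.
by ring.
Qed.

(** The Wronskian of [f1] and [g2] has derivative [(U2 - U1) f1 g2]. At +oo [f1] is asymptotic to
    [f2], so it tends to the Wronskian of [U2]; at -oo [g2] is asymptotic to [g1], so it tends to
    that of [U1]. The identity is then the fundamental theorem of calculus. *)
Lemma jost_wronskian_diff (U1 U2 : R -> R) : continuous U1 -> continuous U2 ->
  (forall x, `|U1 x| <= M * edecay be x) -> (forall x, `|U2 x| <= M * edecay be x) ->
  jost_wronskian U2 k - jost_wronskian U1 k =
  cint setT (fun x => (U2 x - U1 x)%:C * (jost_plus U1 k x * jost_minus U2 k x)).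
Proof.
move=> c1 c2 b1 b2.
have [f1' [[f1d f1d'] f1b f1b' f1a f1a']] := jost_plus_props c1 b1.
have [f2' [[f2d f2d'] f2b f2b' f2a f2a']] := jost_plus_props c2 b2.
have [g1' [[g1d g1d'] g1b g1b' g1a g1a']] := jost_minus_props c1 b1.
have [g2' [[g2d g2d'] g2b g2b' g2a g2a']] := jost_minus_props c2 b2.
set f1 := jost_plus U1 k in f1d f1d' f1b f1a *.
set f2 := jost_plus U2 k in f2d f2d' f2b f2a.
set g1 := jost_minus U1 k in g1d g1d' g1b g1a.
set g2 := jost_minus U2 k in g2d g2d' g2b g2a *.
(* For equal potentials the derivative vanishes, so the Wronskian, which [jost_wronskian] evaluates
   at 0, may be read off at any [x]. *)
have wc (f f' g g' : R -> C) (U : R -> R) x :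
    cdiff f f' -> cdiff f' (fun x => ((U x)%:C - k ^+ 2) * f x) ->
    cdiff g g' -> cdiff g' (fun x => ((U x)%:C - k ^+ 2) * g x) ->
    wronskian f g 0 = f x * g' x - g x * f' x.
  move=> h1 h2 h3 h4; rewrite (wronskianE _ h1 h3).
  apply: (@cdiff0_cst (fun x => f x * g' x - g x * f' x)).
  by apply: eq_cdiff (cdiff_wronskian h1 h2 h3 h4) => // y; rewrite subrr mul0r.
have w2 x : jost_wronskian U2 k = f2 x * g2' x - g2 x * f2' x.
  exact: (wc f2 f2' g2 g2' U2 x).
have w1 x : jost_wronskian U1 k = f1 x * g1' x - g1 x * f1' x.
  exact: (wc f1 f1' g1 g1' U1 x).
have dist (u v w : C) (r : R) : normc (u - w) <= r -> normc (v - w) <= r ->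
    normc (u - v) <= r *+ 2.
  move=> h1 h2; have -> : u - v = (u - w) - (v - w) by ring.
  by rewrite (le_trans (ler_normcB _ _))// mulr2n lerD.
have en (n : nat) : egrow a (- n%:R) = egrow a n%:R by rewrite /egrow normrN.
symmetry; apply: cint_derivative (cdiff_wronskian f1d f1d' g2d g2d') _ _ _ _.
- apply: ccontM; last by apply: ccontM; [exact: cdiff_ccont f1d|exact: cdiff_ccont g2d].
  by apply: ccont_real => x; apply: cvgB; [exact: c2|exact: c1].
- have d0 : 0 < d by rewrite /d subr_gt0 mulrC -ltr_pdivlMr.
  apply: (@cintegrable_dom _ _ _ (fun x => (M + M) * jost_bound * jost_bound * edecay d x)) => //.
  + apply: cmeasM; last by apply: ccont_cmeas; apply: ccontM; [exact: cdiff_ccont f1d|exact: cdiff_ccont g2d].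
    by apply: cmeas_real; apply: measurable_funB; exact: continuous_measurable_fun.
  + by apply: integrableZ => //; exact: integrable_edecay.
  + apply: aeW => x _; rewrite normcM normcR normcM.
    have -> : (M + M) * jost_bound * jost_bound * edecay d x =
       (M * edecay be x + M * edecay be x) * ((jost_bound * egrow a x) * (jost_bound * egrow a x)).
      have -> : edecay d x = edecay be x * egrow a x * egrow a x.
        by rewrite /edecay /egrow -!expRD /d; congr expR; ring.
      by ring.
    rewrite ler_pM ?mulr_ge0 ?normc_ge0//.
      by rewrite (le_trans (ler_normB _ _))// lerD.
    by rewrite ler_pM ?normc_ge0.
- have h : ccvg (fun n => (f1 n%:R * g2' n%:R - g2 n%:R * f1' n%:R) -
      (f2 n%:R * g2' n%:R - g2 n%:R * f2' n%:R)) 0.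
    apply: (@cvg_wronskian_diff (fun n => f1 n%:R) (fun n => f1' n%:R)
      (fun n => f2 n%:R) (fun n => f2' n%:R) (fun n => g2 n%:R) (fun n => g2' n%:R)) => // n.
      by apply: dist; [exact: f1a|exact: f2a].
    by apply: dist; [exact: f1a'|exact: f2a'].
  have := ccvgD h (ccvg_cst (jost_wronskian U2 k)); rewrite add0r.
  by apply: eq_ccvg => n; rewrite (w2 n%:R) subrK.
(* At -oo the minus solutions are the ones compared, which exchanges the arguments of the Wronskian;
   the factor -1 in [h'] restores the order. *)
- have h : ccvg (fun n => (g2 (- n%:R) * f1' (- n%:R) - f1 (- n%:R) * g2' (- n%:R)) -
      (g1 (- n%:R) * f1' (- n%:R) - f1 (- n%:R) * g1' (- n%:R))) 0.
    apply: (@cvg_wronskian_diff (fun n => g2 (- n%:R)) (fun n => g2' (- n%:R))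
      (fun n => g1 (- n%:R)) (fun n => g1' (- n%:R)) (fun n => f1 (- n%:R)) (fun n => f1' (- n%:R))) => n.
    + by rewrite -en.
    + by rewrite -en.
    + by apply: dist; [exact: g2a|exact: g1a].
    + by apply: (@dist _ _ (- ('i * k * cexp ('i * k * (n%:R)%:C)))); rewrite opprK; [exact: g2a'|exact: g1a'].
  have mone := ccvgD (u := fun=> 0) (ccvg_cst 0) (ccvg_cst (jost_wronskian U1 k)).
  have h' : ccvg (fun n => - 1 * ((g2 (- n%:R) * f1' (- n%:R) - f1 (- n%:R) * g2' (- n%:R)) -
      (g1 (- n%:R) * f1' (- n%:R) - f1 (- n%:R) * g1' (- n%:R)))) 0.
    case: h => r1 r2; split.
      by under eq_fun do rewrite mulN1r ReN; rewrite -oppr0; exact: cvgN.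
    by under eq_fun do rewrite mulN1r ImN; rewrite -oppr0; exact: cvgN.
  have := ccvgD h' (ccvg_cst (jost_wronskian U1 k)); rewrite add0r.
  by apply: eq_ccvg => n; rewrite (w1 (- n%:R)); ring.
Qed.

End JostPair.

(** * Integration by parts against oscillating factors *)

Section SmoothStep.
Context {R : realType}.
Implicit Types t x y : R.

(** With a quadratic remainder as criterion, the square of [pospart] is differentiated by a case
    analysis on signs instead of one-sided limits at 0. *)
Lemma is_derive_quadratic (f : R -> R) x (l K : R) :
  (forall h, `|f (h + x) - f x - l * h| <= K * h ^+ 2) -> is_derive x 1 f l.
Proof.
move=> H; suff h : (fun h : R => h^-1 *: ((f \o shift x) (h *: 1) - f x)) @ 0^' --> (l : R).
  by apply: DeriveDef; [apply: (cvgP l)|apply/cvg_lim].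
have K0 : 0 <= K by have /(le_trans (normr_ge0 _)) := H 1; rewrite expr1n mulr1.
apply/cvgrPdist_le => e e0; near=> h.
have h0 : h != 0 by near: h; exact: nbhs_dnbhs_neq.
rewrite /= /GRing.scale /= mulr1.
have -> : l - h^-1 * (f (h + x) - f x) = - (h^-1 * (f (h + x) - f x - l * h)) by field.
rewrite normrN normrM normfV ler_pdivrMl ?normr_gt0//.
apply: le_trans (H h) _; rewrite -(real_normK (num_real h)) expr2 mulrCA ler_wpM2l// mulrC.
have he : `|h| <= e / (K + 1).
  near: h; apply: dnbhs0_le; rewrite divr_gt0// ltr_wpDl//.
apply: le_trans (ler_wpM2r K0 he) _.
by rewrite mulrAC ler_pdivrMr ?ltr_wpDl// ler_wpM2l ?lerDl// ltW.
Unshelve. all: by end_near. Qed.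

Definition pospart t := Num.max 0 t.

Lemma is_derive_sqr_pospart t :
  is_derive t 1 (fun s => pospart s ^+ 2) (2 * pospart t).
Proof.
apply: (@is_derive_quadratic _ _ _ 1) => h; rewrite mul1r /pospart.
have [h1|h1] := lerP 0 (h + t); have [h2|h2] := lerP 0 t.
- by rewrite ler_norml; apply/andP; split; nra.
- by rewrite ler_norml; apply/andP; split; nra.
- by rewrite ler_norml; apply/andP; split; nra.
- by rewrite ler_norml; apply/andP; split; nra.
Qed.

Lemma continuous_pospart : continuous pospart.
Proof. by move=> t; apply: continuous_max; [exact: cvg_cst|exact: cvg_id]. Qed.

(* The second difference of [pospart t ^+ 2] rises from 0 at -1 to 1 at 1. *)
Definition step t := (pospart (t + 1) ^+ 2 - 2 * pospart t ^+ 2 + pospart (t - 1) ^+ 2) / 2.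
Definition tent t := pospart (t + 1) - 2 * pospart t + pospart (t - 1).

Lemma is_derive_shiftE (f : R -> R) t c l : is_derive (t + c) 1 f l ->
  is_derive t 1 (fun s => f (s + c)) l.
Proof.
move=> h; have ds : is_derive t 1 (fun s : R => s + c) 1.
  apply: (@is_derive_eq _ _ _ _ _ _ _ _ (is_deriveD (is_derive_id t 1) (is_derive_cst c t 1))).
  by rewrite addr0.
have h2 := @is_derive1_comp R f (fun s => s + c) t l 1 h ds.
by rewrite mulr1 in h2.
Qed.

Lemma is_derive_step t : is_derive t 1 step (tent t).
Proof.
have h1 := is_derive_shiftE (is_derive_sqr_pospart (t + 1)).
have h2 := is_derive_sqr_pospart t.
have h3 := is_derive_shiftE (is_derive_sqr_pospart (t - 1)).
have h := is_deriveZ 2^-1 (is_deriveD (is_deriveB h1 (is_deriveZ 2 h2)) h3).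
rewrite (_ : step = (fun s => 2^-1 *: (pospart (s + 1) ^+ 2 - 2 *: pospart s ^+ 2 + pospart (s - 1) ^+ 2))).
  apply: (@is_derive_eq _ _ _ _ _ _ _ _ h).
  by rewrite /GRing.scale /= /tent; field.
by apply/funext => s; rewrite /step /GRing.scale /= mulrC.
Qed.

Lemma continuous_tent : continuous tent.
Proof.
have sh (c : R) : continuous (fun t => pospart (t + c)).
  move=> t; apply: (@continuous_comp _ _ _ (fun t => t + c) pospart); last exact: continuous_pospart.
  by apply: cvgD; [exact: cvg_id|exact: cvg_cst].
move=> t; apply: cvgD; last exact: sh.
apply: cvgB; first exact: sh.
by apply: cvgM; [exact: cvg_cst|exact: continuous_pospart].
Qed.

Lemma step_le t : t <= -1 -> step t = 0.
Proof.
move=> h; rewrite /step /pospart !max_l; try lra.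
Qed.

Lemma step_ge t : 1 <= t -> step t = 1.
Proof.
move=> h; rewrite /step /pospart !max_r; try lra.
Qed.

Lemma tent_out t : 1 <= `|t| -> tent t = 0.
Proof.
rewrite ler_normr => /orP[h|h]; rewrite /tent /pospart.
  by rewrite !max_r; lra.
by rewrite !max_l; lra.
Qed.

Lemma tent_bound t : 0 <= tent t <= 1.
Proof.
rewrite /tent /pospart; apply/andP.
have [h1|h1] := lerP 0 (t + 1); have [h2|h2] := lerP 0 t;
  have [h3|h3] := lerP 0 (t - 1); split; lra.
Qed.

Lemma step_bound t : 0 <= step t <= 1.
Proof.
have [h|h] := lerP t (-1); first by rewrite step_le// lexx ler01.
have [h'|h'] := lerP 1 t; first by rewrite step_ge// lexx ler01.
rewrite /step /pospart; apply/andP.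
have [h1|h1] := lerP 0 (t + 1); have [h2|h2] := lerP 0 t;
  have [h3|h3] := lerP 0 (t - 1); split; nra.
Qed.

(** For [n >= 1] this is 1 where [|x| <= n - 1] and 0 beyond [n + 1]. The transition layers have
    fixed width, which keeps the derivative bounded by 1 uniformly in [n]. *)
Definition cutoff (n : nat) x := step (x + n%:R) - step (x - n%:R).
Definition cutoff' (n : nat) x := tent (x + n%:R) - tent (x - n%:R).

Lemma is_derive_cutoff n x : is_derive x 1 (cutoff n) (cutoff' n x).
Proof.
exact: is_deriveB (is_derive_shiftE (is_derive_step _)) (is_derive_shiftE (is_derive_step _)).
Qed.

Lemma continuous_cutoff' n : continuous (cutoff' n).
Proof.
have sh (c : R) : continuous (fun t => tent (t + c)).
  move=> t; apply: (@continuous_comp _ _ _ (fun t => t + c) tent); last exact: continuous_tent.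
  by apply: cvgD; [exact: cvg_id|exact: cvg_cst].
by move=> x; apply: cvgB; exact: sh.
Qed.

Lemma cutoff_bound n x : `|cutoff n x| <= 1.
Proof.
have /andP[h1 h2] := step_bound (x + n%:R); have /andP[h3 h4] := step_bound (x - n%:R).
by rewrite /cutoff ler_norml; apply/andP; split; lra.
Qed.

Lemma cutoff'_bound n x : `|cutoff' n x| <= 1.
Proof.
have /andP[h1 h2] := tent_bound (x + n%:R); have /andP[h3 h4] := tent_bound (x - n%:R).
by rewrite /cutoff' ler_norml; apply/andP; split; lra.
Qed.

Lemma cutoff_out n x : n%:R + 1 < `|x| -> cutoff n x = 0.
Proof.
have n0 : 0 <= n%:R :> R by exact: ler0n.
rewrite ltr_normr => /orP[h|h]; rewrite /cutoff.
  by rewrite !step_ge ?subrr//; lra.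
by rewrite !step_le ?subrr//; lra.
Qed.

Lemma cutoff_in n x : `|x| <= n%:R - 1 -> cutoff n x = 1 /\ cutoff' n x = 0.
Proof.
rewrite ler_norml => /andP[h1 h2]; rewrite /cutoff /cutoff'; split.
  by rewrite step_ge ?step_le ?subr0//; lra.
rewrite !tent_out ?subrr// ler_normr; apply/orP; last by left; lra.
by right; lra.
Qed.

Lemma near_cutoff x : \forall n \near \oo, cutoff n x = 1 /\ cutoff' n x = 0.
Proof.
near=> n; apply: cutoff_in; rewrite lerBrDr; near: n.
exact: nbhs_infty_ger.
Unshelve. all: by end_near. Qed.

End SmoothStep.

(** * Weak integration by parts with growing test functions *)

Section WeakIBP.
Context {R : realType}.
Local Notation C := R[i].
Local Notation mu := (@lebesgue_measure R).
Context (a be : R).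
Context (abe : a < be / 2).
Let d := be - 2 * a.
Let d0 : 0 < d. Proof. by rewrite /d subr_gt0 mulrC -ltr_pdivlMr. Qed.

(** Almost everywhere, because the highest weak derivatives have no preferred values. The companion
    [grows] is pointwise: it is applied to continuous expressions containing two Jost solutions,
    whence the rate [2 * a]. *)
Definition decays (N : R) (g : R -> C) := cmeas g /\
  {ae mu, forall x, normc (g x) <= N * edecay be x}.
Definition grows (B : R) (phi : R -> C) := forall x, normc (phi x) <= B * egrow (2 * a) x.

Lemma edecay_egrow x : edecay be x * egrow (2 * a) x = edecay d x.
Proof. by rewrite /edecay /egrow -expRD; congr expR; rewrite /d; ring. Qed.

(** The line is not a null set, so the bound holds at some point. *)
Lemma decays_ge0 N g : decays N g -> 0 <= N.
Proof.
move=> [_ h]; rewrite leNgt; apply/negP => N0.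
have [x hx] : exists x, normc (g x) <= N * edecay be x.
  apply: contrapT => H.
  have : {ae mu, forall x : R, False}.
    by apply: ae_imp h _ => x hx; apply: H; exists x.
  move=> [A [mA A0 AT]]; have : mu setT = 0.
    rewrite -A0; congr (mu _); apply/seteqP; split => // x _.
    exact: AT.
  have -> : mu setT = +oo%E by rewrite -set_itvNyy lebesgue_measure_itv.
  by [].
have := le_trans (normc_ge0 _) hx.
by rewrite leNgt nmulr_rlt0 ?expR_gt0.
Qed.

Lemma decays_grows_bound N B g phi : decays N g -> grows B phi ->
  {ae mu, forall x, normc (g x * phi x) <= N * B * edecay d x}.
Proof.
move=> [_ h] hp; apply: ae_imp h _ => x h; rewrite normcM -edecay_egrow.
have -> : N * B * (edecay be x * egrow (2 * a) x) =
  (N * edecay be x) * (B * egrow (2 * a) x) by ring.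
by rewrite ler_pM ?normc_ge0.
Qed.

Lemma decays_grows_integrable N B g phi : decays N g -> grows B phi -> cmeas phi ->
  cintegrable setT (fun x => g x * phi x).
Proof.
move=> hg hp mp; have := decays_grows_bound hg hp => ae.
apply: (@cintegrable_dom _ _ _ (fun x => N * B * edecay d x)) => //.
- by apply: cmeasM => //; case: hg.
- by apply: integrableZ => //; exact: integrable_edecay.
- by apply: ae_imp ae _.
Qed.

Lemma decays_grows_cint_le N B g phi : decays N g -> grows B phi -> 0 <= B -> cmeas phi ->
  normc (cint setT (fun x => g x * phi x)) <= 4 / d * (N * B).
Proof.
move=> hg hp B0 mp; have ae := decays_grows_bound hg hp.
have ig := decays_grows_integrable hg hp mp.
have ae' : {ae mu, forall x, setT x -> normc (g x * phi x) <= N * B * edecay d x}.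
  by apply: ae_imp ae _.
have ib := integrableZ (N * B) measurableT (integrable_edecay d0).
apply: le_trans (normc_cint_le measurableT ig ib ae') _.
rewrite RintegralZl//; last exact: integrable_edecay.
have N0 := decays_ge0 hg.
apply: (@le_trans _ _ (2 * (N * B * (2 / d)))).
  by rewrite !ler_wpM2l ?mulr_ge0// Rintegral_edecay_le.
by rewrite le_eqVlt; apply/orP; left; apply/eqP; field; rewrite gt_eqF.
Qed.

(** Test functions have compact support, whereas [u] may grow. The formula is applied to [u] times a
    cutoff and [n] goes to infinity; decay of rate [be] against growth of rate [2 * a] is dominated
    by a multiple of [edecay d], uniformly in [n]. *)
Lemma weak_ibp_real N B g h (u u' : R -> R) : weak_derivative g h ->
  decays N g -> decays N h -> (forall x : R, is_derive x 1 u (u' x)) -> continuous u' ->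
  grows B (fun x => (u x)%:C) -> grows B (fun x => (u' x)%:C) ->
  cint setT (fun x => g x * (u' x)%:C) = - cint setT (fun x => h x * (u x)%:C).
Proof.
move=> [_ _ whg] dg dh du cu' bu bu'.
have cu : continuous u by move=> x; exact: is_derive_continuous (du x).
pose psi n x := u x * cutoff n x.
pose psi' n x := u' x * cutoff n x + u x * cutoff' n x.
have dpsi n (x : R) : is_derive x 1 (psi n) (psi' n x).
  apply: (@is_derive_eq _ _ _ _ _ _ _ _ (is_deriveM (du x) (is_derive_cutoff n x))).
  by rewrite /psi' /GRing.scale /=; ring.
have cc n : continuous (cutoff n) by move=> x; exact: is_derive_continuous (is_derive_cutoff n x).
have cpsi' n : continuous (psi' n).
  move=> x; apply: cvgD; apply: cvgM; by [exact: cu'|exact: cc|exact: cu|exact: continuous_cutoff'].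
have tpsi n : test_function (psi n).
  have e : derive1 (psi n) = psi' n.
    by apply/funext => x; rewrite derive1E; case: (dpsi n x).
  split.
  - by move=> x; case: (dpsi n x).
  - by rewrite e.
  - by exists (n%:R + 1) => x hx; rewrite /psi cutoff_out// mulr0.
have wn n : cint setT (fun x => g x * (psi' n x)%:C) = - cint setT (fun x => h x * (psi n x)%:C).
  rewrite -whg//; apply: eq_cint => x _; congr (_ * _%:C).
  by rewrite derive1E; case: (dpsi n x).
have mC (w : R -> R) : continuous w -> cmeas (fun x => (w x)%:C).
  by move=> cw; apply: cmeas_real; exact: continuous_measurable_fun.
have bpsi n : grows B (fun x => (psi n x)%:C).
  move=> x; rewrite normcR normrM; have := bu x; rewrite normcR; apply: le_trans.
  by rewrite ler_piMr// cutoff_bound.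
have bpsi' n : grows (B + B) (fun x => (psi' n x)%:C).
  move=> x; rewrite normcR (le_trans (ler_normD _ _))// !normrM mulrDl.
  have := bu x; have := bu' x; rewrite !normcR => h1 h2.
  apply: lerD; [apply: le_trans h1|apply: le_trans h2]; rewrite ler_piMr//.
    exact: cutoff_bound.
  exact: cutoff'_bound.
have lim (w : R -> C) (v : nat -> R -> R) (v0 : R -> R) (D : R) : decays N w ->
    (forall n, continuous (v n)) -> continuous v0 ->
    (forall x, \forall n \near \oo, v n x = v0 x) ->
    (forall n, grows D (fun x => (v n x)%:C)) ->
    ccvg (fun n => cint setT (fun x => w x * (v n x)%:C)) (cint setT (fun x => w x * (v0 x)%:C)).
  move=> dw cv cv0 nv gv.
  apply: (dominated_cint_cvg measurableT _ _ _ (b := fun x => N * D * edecay d x)).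
  - by move=> n; apply: cmeasM; [case: dw|exact: mC].
  - by apply: cmeasM; [case: dw|exact: mC].
  - apply: ae_all => x _; split; apply: cvg_near_cst.
      by apply: filterS (nv x) => n ->.
    by apply: filterS (nv x) => n ->.
  - by apply: integrableZ => //; exact: integrable_edecay.
  - have [mw aw] := dw; apply: ae_imp aw _ => x hx _ n.
    rewrite normcM -edecay_egrow.
    have -> : N * D * (edecay be x * egrow (2 * a) x) =
      (N * edecay be x) * (D * egrow (2 * a) x) by ring.
    by rewrite ler_pM ?normc_ge0//; exact: gv.
have l1 := lim g psi' u' (B + B) dg cpsi' cu' _ bpsi'.
have l2 := lim h psi u B dh _ cu _ bpsi.
apply: ccvg_unique.
  apply: l1 => x; apply: filterS (near_cutoff x) => n [e1 e2].
  by rewrite /psi' e1 e2 mulr1 mulr0 addr0.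
apply: (@eq_ccvg _ (fun n => - cint setT (fun x => h x * (psi n x)%:C))) => [n|].
  by rewrite wn.
have {}l2 : ccvg (fun n => cint setT (fun x => h x * (psi n x)%:C)) (cint setT (fun x => h x * (u x)%:C)).
  apply: l2; first by move=> n x; exact: is_derive_continuous (dpsi n x).
  by move=> x; apply: filterS (near_cutoff x) => n [e1 _]; rewrite /psi e1 mulr1.
case: l2 => r1 r2; split.
  by under eq_fun do rewrite ReN; rewrite ReN; exact: cvgN.
by under eq_fun do rewrite ImN; rewrite ImN; exact: cvgN.
Qed.

(** Weak derivatives are tested on real functions, so [phi] is split into real and imaginary
    part. *)
Lemma weak_ibp N B g h (phi phi' : R -> C) : weak_derivative g h ->
  decays N g -> decays N h -> cdiff phi phi' -> ccont phi' ->
  grows B phi -> grows B phi' ->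
  cint setT (fun x => g x * phi' x) = - cint setT (fun x => h x * phi x).
Proof.
move=> w dg dh dphi [c1 c2] gp gp'.
have gR (p : R -> C) : grows B p -> grows B (fun x => (complex.Re (p x))%:C).
  by move=> hp x; rewrite normcR (le_trans (normc_ge_Re _) (hp x)).
have gI (p : R -> C) : grows B p -> grows B (fun x => (complex.Im (p x))%:C).
  by move=> hp x; rewrite normcR (le_trans (normc_ge_Im _) (hp x)).
have eR := weak_ibp_real w dg dh (fun x => (dphi x).1) c1 (gR _ gp) (gR _ gp').
have eI := weak_ibp_real w dg dh (fun x => (dphi x).2) c2 (gI _ gp) (gI _ gp').
have [cp1 cp2] := cdiff_ccont dphi.
have mC (v : R -> R) : continuous v -> cmeas (fun x => (v x)%:C).
  by move=> cw; apply: cmeas_real; exact: continuous_measurable_fun.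
have split_cint (f p : R -> C) : decays N f -> grows B p -> ccont p ->
    cint setT (fun x => f x * p x) = cint setT (fun x => f x * (complex.Re (p x))%:C)
     + 'i * cint setT (fun x => f x * (complex.Im (p x))%:C).
  move=> df hp [cp cp'].
  have i1 := decays_grows_integrable df (gR _ hp) (mC _ cp).
  have i2 := decays_grows_integrable df (gI _ hp) (mC _ cp').
  rewrite -(cintZ 'i measurableT i2) -(cintD measurableT i1 (cintegrableZ 'i measurableT i2)).
  by apply: eq_cint => x _; rewrite {1}(complexE (p x)) mulrDr [X in _ + X]mulrCA.
rewrite (split_cint g phi') // (split_cint h phi)//.
by rewrite eR eI; ring.
Qed.

Definition osc (om x : R) := cexp ('i * (om * x)%:C).

Lemma normc_osc om x : normc (osc om x) = 1.
Proof. by rewrite normc_cexp ReM /= mul0r mul1r subrr expR0. Qed.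

Lemma oscE om x : osc om x = cexp ('i * om%:C * x%:C).
Proof. by rewrite /osc rmorphM mulrA. Qed.

Lemma cdiff_osc om : cdiff (osc om) (fun x => 'i * om%:C * osc om x).
Proof.
by apply: eq_cdiff (cdiff_cexp ('i * om%:C)) => x; rewrite oscE.
Qed.

Lemma ccont_osc om : ccont (osc om). Proof. exact: cdiff_ccont (cdiff_osc om). Qed.

Lemma grows_osc B om phi : grows B phi -> grows B (fun x => phi x * osc om x).
Proof. by move=> h x; rewrite normcM normc_osc mulr1. Qed.

(** Weak integration by parts is applied to [phi * osc om] and solved for the term in which the
    derivative falls on [osc om]. It is an identity and not a bound, because the resonant part must
    survive exactly in order to cancel later. *)
Lemma osc_ibp N B g h (phi phi' : R -> C) (om : R) : om != 0 -> 0 <= B ->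
  weak_derivative g h -> decays N g -> decays N h -> cdiff phi phi' -> ccont phi' ->
  grows B phi -> grows B phi' ->
  cint setT (fun x => g x * (phi x * osc om x)) =
   'i / om%:C * (cint setT (fun x => h x * (phi x * osc om x))
     + cint setT (fun x => g x * (phi' x * osc om x))).
Proof.
move=> om0 B0 w dg dh dphi cphi' gp gp'.
have cphi := cdiff_ccont dphi.
have omC : om%:C != 0 :> C by rewrite eq_complex /= negb_and om0.
have i0 : ('i : C) != 0 by rewrite eq_complex /= oner_eq0 andbF.
pose Om := 'i * om%:C; have Om0 : Om != 0 by rewrite mulf_neq0.
have nOm : normc Om = `|om| by rewrite normcM normc_i mul1r normcR.
pose P x := phi x * osc om x; pose P' x := phi' x * osc om x.
have dP : cdiff P (fun x => P' x + Om * P x).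
  by apply: eq_cdiff (cdiffM dphi (cdiff_osc om)) => // x; rewrite /P' /P /Om; ring.
have cP : ccont P by apply: ccontM => //; exact: ccont_osc.
have cP' : ccont P' by apply: ccontM => //; exact: ccont_osc.
have gP : grows B P by exact: grows_osc.
have gP' : grows B P' by exact: grows_osc.
have cD : ccont (fun x => P' x + Om * P x).
  by apply: ccontD => //; apply: ccontM => //; exact: ccont_cst.
(* [B'] depends on [om], but it only certifies integrability; the resulting identity is free of
   it. *)
pose B' := B + `|om| * B + B.
have B'1 : B <= B' by rewrite /B' lerDr addr_ge0// mulr_ge0.
have gP2 : grows B' P.
  by move=> x; rewrite (le_trans (gP x))// ler_wpM2r// expR_ge0.
have gD : grows B' (fun x => P' x + Om * P x).
  move=> x; rewrite (le_trans (le_normcD _ _))// (normcM Om) nOm.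
  apply: (@le_trans _ _ ((B + `|om| * B) * egrow (2 * a) x)).
    rewrite mulrDl; apply: lerD; first exact: gP'.
    by rewrite -mulrA; apply: ler_wpM2l => //; exact: gP.
  by rewrite ler_wpM2r ?expR_ge0// lerDl.
have E := weak_ibp w dg dh dP cD gP2 gD.
have i1 := decays_grows_integrable dg gP' (ccont_cmeas cP').
have i2 := decays_grows_integrable dg gP (ccont_cmeas cP).
have E2 : cint setT (fun x => g x * (P' x + Om * P x)) =
  cint setT (fun x => g x * P' x) + Om * cint setT (fun x => g x * P x).
  rewrite -(cintZ Om measurableT i2) -(cintD measurableT i1 (cintegrableZ Om measurableT i2)).
  by apply: eq_cint => x _; ring.
rewrite E2 in E; apply: (mulfI Om0); rewrite mulrA.
have -> : Om * ('i / om%:C) = -1.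
  have -> : Om * ('i / om%:C) = 'i * 'i by rewrite /Om; field.
  exact: i_sqr.
by rewrite mulN1r opprD -E; ring.
Qed.

Lemma osc_bound N B g h (phi phi' : R -> C) (om : R) : om != 0 -> 0 <= B ->
  weak_derivative g h -> decays N g -> decays N h -> cdiff phi phi' -> ccont phi' ->
  grows B phi -> grows B phi' ->
  normc (cint setT (fun x => g x * (phi x * osc om x))) <= `|om|^-1 * (8 / d * (N * B)).
Proof.
move=> om0 B0 w dg dh dphi cphi' gp gp'.
rewrite (osc_ibp om0 B0 w dg dh dphi cphi' gp gp') normcM.
have -> : normc ('i / om%:C) = `|om|^-1 by rewrite normcM normcV normc_i mul1r normcR.
rewrite ler_wpM2l ?invr_ge0// (le_trans (le_normcD _ _))//.
have -> : 8 / d * (N * B) = 4 / d * (N * B) + 4 / d * (N * B).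
  by field; rewrite gt_eqF.
have cphi := cdiff_ccont dphi.
apply: lerD; apply: decays_grows_cint_le => //; try exact: grows_osc.
  by apply: ccont_cmeas; apply: ccontM => //; exact: ccont_osc.
by apply: ccont_cmeas; apply: ccontM => //; exact: ccont_osc.
Qed.

End WeakIBP.

(** * Finitely many modes *)

Section Tempered.
Context {R : realType}.
Local Notation C := R[i].
Context (a be : R).
Context (abe : a < be / 2).

(** [tempered] and [cbounded] are qualitative bounds with unnamed constants: they serve to justify
    integrability and the linearity of the integrals. *)
Definition tempered (phi : R -> C) := ccont phi /\ exists B, grows a B phi.
Definition cbounded (b : R -> C) := ccont b /\ exists K, forall x, normc (b x) <= K.

Lemma tempered_integrable N g phi : decays be N g -> tempered phi ->
  cintegrable setT (fun x => g x * phi x).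
Proof.
by move=> dg [cp [B gp]]; apply: (decays_grows_integrable abe dg gp); exact: ccont_cmeas.
Qed.

Lemma temperedD phi psi : tempered phi -> tempered psi -> tempered (fun x => phi x + psi x).
Proof.
move=> [c1 [B1 b1]] [c2 [B2 b2]]; split; first exact: ccontD.
by exists (B1 + B2) => x; rewrite mulrDl (le_trans (le_normcD _ _))// lerD.
Qed.

Lemma temperedMb b phi : cbounded b -> tempered phi -> tempered (fun x => b x * phi x).
Proof.
move=> [c1 [K bK]] [c2 [B hB]]; split; first exact: ccontM.
exists (K * B) => x; rewrite normcM -mulrA.
by rewrite ler_pM ?normc_ge0//; exact: hB.
Qed.

Lemma cbounded_cst z : cbounded (fun=> z).
Proof. by split; [exact: ccont_cst|exists (normc z)]. Qed.

Lemma temperedZ z phi : tempered phi -> tempered (fun x => z * phi x).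
Proof. exact: temperedMb (cbounded_cst z). Qed.

Lemma cboundedM b c : cbounded b -> cbounded c -> cbounded (fun x => b x * c x).
Proof.
move=> [c1 [K1 b1]] [c2 [K2 b2]]; split; first exact: ccontM.
by exists (K1 * K2) => x; rewrite normcM ler_pM ?normc_ge0.
Qed.

Lemma cbounded_osc om : cbounded (osc om).
Proof.
by split; [exact: ccont_osc|exists 1 => x; rewrite normc_osc].
Qed.

Lemma cbounded_sum (I : Type) (s : seq I) (F : I -> R -> C) :
  (forall i, cbounded (F i)) -> cbounded (fun x => \sum_(i <- s) F i x).
Proof.
move=> h; elim: s => [|i s [IH1 [K IH2]]].
  by split; [exact: ccont_sum (fun i => (h i).1)|exists 0 => x; rewrite big_nil normc0].
split; first exact: ccont_sum (fun i => (h i).1).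
have [_ [K' hK']] := h i.
by exists (K' + K) => x; rewrite big_cons (le_trans (le_normcD _ _))// lerD.
Qed.

Lemma tempered_osc om phi : tempered phi -> tempered (fun x => phi x * osc om x).
Proof.
move=> [cp [B hB]]; split; first by apply: ccontM => //; exact: ccont_osc.
by exists B; exact: grows_osc.
Qed.

Lemma tempered_cintD N g phi psi : decays be N g -> tempered phi -> tempered psi ->
  cint setT (fun x => g x * (phi x + psi x)) =
  cint setT (fun x => g x * phi x) + cint setT (fun x => g x * psi x).
Proof.
move=> dg tp tq; rewrite -(cintD measurableT (tempered_integrable dg tp) (tempered_integrable dg tq)).
by apply: eq_cint => x _; rewrite mulrDr.
Qed.

Lemma tempered_cintZ N g phi z : decays be N g -> tempered phi ->
  cint setT (fun x => g x * (z * phi x)) = z * cint setT (fun x => g x * phi x).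
Proof.
move=> dg tp; rewrite -(cintZ z measurableT (tempered_integrable dg tp)).
by apply: eq_cint => x _; rewrite mulrCA.
Qed.

Lemma tempered_cint_sum (I : Type) (s : seq I) N g (F : I -> R -> C) : decays be N g ->
  (forall i, tempered (F i)) ->
  cint setT (fun x => g x * (\sum_(i <- s) F i x)) =
  \sum_(i <- s) cint setT (fun x => g x * F i x).
Proof.
move=> dg tF; rewrite -(cint_sum s measurableT (fun i => tempered_integrable dg (tF i))).
by apply: eq_cint => x _; rewrite mulr_sumr.
Qed.

End Tempered.

(** * The estimate for finitely many modes with remainders *)

Section Core.
Context {R : realType}.
Local Notation C := R[i].
Local Notation mu := (@lebesgue_measure R).
Context (al a be M kappa theta eps tau N : R) (k : C).
Context (hk : `|complex.Im k| <= al).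
Context (ala : al < a).
Context (abe : a < be / 2).
Context (M0 : 0 < M).
Context (hkappa : normc k <= kappa).
Context (theta0 : 0 < theta).
Context (eps0 : 0 < eps).
Context (eps1 : eps <= 1).
Context (tau0 : 0 <= tau).
Context (N0 : 0 <= N).
Let d := be - 2 * a.
Let d0 : 0 < d. Proof. by rewrite /d subr_gt0 mulrC -ltr_pdivlMr. Qed.
Let a0 : 0 <= a.
Proof. by rewrite (le_trans _ (ltW ala))// (le_trans _ hk). Qed.
Let kappa0 : 0 <= kappa. Proof. exact: le_trans (normc_ge0 k) hkappa. Qed.

Context (I : finType) (nu : I -> I) (lam n : I -> R) (Q D1 G2 G3 : I -> R -> C).
Context (lam_nu : forall j, lam (nu j) = - lam j).
Context (lam_ge : forall j, theta <= `|lam j|).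
Context (lam_sep : forall j l, l != nu j -> theta <= `|lam j + lam l|).
Context (Q_nu : forall j x, Q (nu j) x = (Q j x)^*).
Context (Qd : forall j, cdiff (Q j) (D1 j)).
Context (D1c : forall j, ccont (D1 j)).
Context (wQ : forall j, weak_derivative (Q j) (D1 j)).
Context (wD : forall j, weak_derivative (D1 j) (G2 j)).
Context (wG : forall j, weak_derivative (G2 j) (G3 j)).
Context (bQ : forall j x, normc (Q j x) <= n j * edecay be x).
Context (bD : forall j x, normc (D1 j x) <= n j * edecay be x).
Context (bG2 : forall j, decays be (n j) (G2 j)).
Context (bG3 : forall j, decays be (n j) (G3 j)).
Context (n0 : forall j, 0 <= n j).
Context (nN : \sum_j n j <= N).

Context (qav : R -> R) (qav1 : R -> C).
Context (wqav : weak_derivative (fun x => (qav x)%:C) qav1).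
Context (cqav : continuous qav).
Context (bqav : forall x, `|qav x| <= N * edecay be x).
Context (bqav1 : decays be N qav1).

Definition om j := 2 * pi * lam j / eps.
Definition Lam x := ((2 * pi) ^+ 2)^-1 * \sum_j normc (Q j x) ^+ 2 / lam j ^+ 2.

(** [r1] and [r2] absorb the modes outside [I]. Their size [tau] is a parameter of its own, so that
    it can be sent to 0 at fixed [eps]. *)
Context (U1 U2 r1 r2 : R -> R).
Context (cU1 : continuous U1).
Context (cU2 : continuous U2).
Context (bU1 : forall x, `|U1 x| <= M * edecay be x).
Context (bU2 : forall x, `|U2 x| <= M * edecay be x).
Context (br1 : forall x, `|r1 x| <= tau * edecay be x).
Context (br2 : forall x, `|r2 x| <= tau * edecay be x).
Context (U1E : forall x, U1 x = qav x - eps ^+ 2 * Lam x + r1 x).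
Context (U2E : forall x, (U2 x)%:C = (qav x)%:C + \sum_j Q j x * osc (om j) x + (r2 x)%:C).

Let be0 : 0 <= be. Proof. by move: abe; rewrite ltr_pdivlMr// => h; apply: le_trans (ltW h); rewrite mulr_ge0. Qed.

Lemma le_edecay_cst c x (u : R) : 0 <= c -> u <= c * edecay be x -> u <= c.
Proof.
by move=> c0 h; rewrite (le_trans h)// ler_piMr// edecay_le1.
Qed.

Lemma n_le_N j : n j <= N.
Proof.
rewrite (le_trans _ nN)// (bigD1 j)//= lerDl sumr_ge0// => i _; exact: n0.
Qed.

Lemma two_pi_ge1 : 1 <= 2 * pi :> R.
Proof. by have := @pi_ge2 R; lra. Qed.

Lemma lam_neq0 j : lam j != 0.
Proof. by rewrite -normr_gt0 (lt_le_trans theta0). Qed.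

Lemma om_neq0 j : om j != 0.
Proof.
by rewrite /om !mulf_neq0 ?invr_eq0 ?lam_neq0 ?gt_eqF// ?pi_gt0.
Qed.

Lemma om_inv_le (l : R) : theta <= `|l| -> `|2 * pi * l / eps|^-1 <= eps / theta.
Proof.
move=> hl; have l0 : 0 < `|l| by rewrite (lt_le_trans theta0).
rewrite normrM normfV (gtr0_norm eps0) invf_div ler_wpM2l//; first exact: ltW.
rewrite normrM (ger0_norm (le_trans ler01 two_pi_ge1)) lef_pV2 ?posrE//.
  by rewrite (le_trans hl)// ler_peMl// two_pi_ge1.
by rewrite mulr_gt0// (lt_le_trans ltr01 two_pi_ge1).
Qed.

Lemma decays_pw (c : R) (g : R -> C) : ccont g -> (forall x, normc (g x) <= c * edecay be x) ->
  decays be c g.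
Proof. by move=> cg h; split; [exact: ccont_cmeas|exact: ae_all]. Qed.

Lemma ccontQ j : ccont (Q j). Proof. exact: cdiff_ccont (Qd j). Qed.

Lemma dQ j : decays be (n j) (Q j). Proof. by apply: decays_pw => //; exact: ccontQ. Qed.
Lemma dD1 j : decays be (n j) (D1 j). Proof. by apply: decays_pw. Qed.

Lemma dqav : decays be N (fun x => (qav x)%:C).
Proof.
by apply: decays_pw => [|x]; [exact: ccont_real|rewrite normcR].
Qed.

Lemma QQnu j x : Q j x * Q (nu j) x = (normc (Q j x) ^+ 2)%:C.
Proof.
rewrite Q_nu normc_sqr; case: (Q j x) => u v; apply: complex_ext; rewrite !ReImE /=; ring.
Qed.

Lemma normc_sqr_le j x : normc (Q j x) ^+ 2 <= n j * N * edecay be x.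
Proof.
have h := bQ j x; rewrite expr2.
apply: (@le_trans _ _ (n j * edecay be x * N)).
  rewrite ler_pM ?normc_ge0//.
  exact: le_trans (le_edecay_cst (n0 j) h) (n_le_N j).
by rewrite mulrAC.
Qed.

Definition Lbound := N ^+ 2 / theta ^+ 2.

Lemma Lam_ge0 x : 0 <= Lam x.
Proof.
rewrite mulr_ge0 ?invr_ge0 ?sqr_ge0//; apply: sumr_ge0 => j _.
by rewrite divr_ge0 ?sqr_ge0.
Qed.

Lemma Lam_le x : Lam x <= Lbound * edecay be x.
Proof.
have pi2 : ((2 * pi) ^+ 2)^-1 <= 1 :> R.
  by rewrite invf_le1 ?exprn_ege1 ?two_pi_ge1// exprn_gt0// (lt_le_trans ltr01 two_pi_ge1).
have t2 : 0 < theta ^+ 2 by rewrite exprn_gt0.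
apply: (@le_trans _ _ (1 * \sum_j n j * (N * edecay be x / theta ^+ 2))).
  rewrite ler_pM ?invr_ge0 ?sqr_ge0//.
    by apply: sumr_ge0 => j _; rewrite divr_ge0 ?sqr_ge0.
  apply: ler_sum => j _; rewrite mulrA ler_pM ?sqr_ge0 ?invr_ge0 ?sqr_ge0//.
    by rewrite mulrA; exact: normc_sqr_le.
  have ht : theta ^+ 2 <= lam j ^+ 2.
    by rewrite -(real_normK (num_real (lam j))) ler_pXn2r ?nnegrE ?(ltW theta0).
  by rewrite lef_pV2 ?posrE// (lt_le_trans t2 ht).
rewrite mul1r -mulr_suml /Lbound.
have -> : N ^+ 2 / theta ^+ 2 * edecay be x = N * (N * edecay be x / theta ^+ 2) by ring.
by rewrite ler_wpM2r// divr_ge0 ?sqr_ge0// mulr_ge0// expR_ge0.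
Qed.

(** One growth constant for [p], [p'], [p''], [r] and [r']. Each Jost factor and each derivative is
    bounded by [jost_bound], and the bracket comes from the worst case
    [p'' = (U1 + U2 - 2 * k ^ 2) p + 2 r]. *)
Definition Bconst := (2 * M + 2 * kappa ^+ 2 + 2) * jost_bound al a be M kappa ^+ 2.

(** [h] bounds the inverse frequencies and [t] the nonoscillating remainder. In the bracket, 5 is 1
    + 2 + 2 from the terms with [G2], [D1] and [r]; [2 * kappa ^+ 2] comes from [k ^+ 2]; and
    [6 * N] is [4 * N] from [qav] plus [2 * N] from the nonresonant products. *)
Definition Ydecay (h t : R) := h * (8 / d * Bconst * (5 + 2 * kappa ^+ 2 + 6 * N))
   + 4 / d * Bconst * t.

(* [p] is the product of a Jost solution for [U1] and one for [U2], and [r] is the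
   product of their derivatives; the two Schroedinger equations close the system. *)
Definition schroedinger_pair (p p' r r' : R -> C) :=
  [/\ cdiff p p' /\ cdiff p' (fun x => ((U1 x)%:C + (U2 x)%:C - 2 * k ^+ 2) * p x + 2 * r x),
      cdiff r r' /\ ccont r',
      grows a Bconst p /\ grows a Bconst p',
      grows a Bconst r /\ grows a Bconst r' &
      grows a Bconst (fun x => ((U1 x)%:C + (U2 x)%:C - 2 * k ^+ 2) * p x + 2 * r x)].

Lemma product_schroedinger_pair : exists p p' r r', schroedinger_pair p p' r r' /\
   jost_wronskian U2 k - jost_wronskian U1 k =
     cint setT (fun x => (U2 x - U1 x)%:C * p x).
Proof.
have [f' [[fd fd'] fb fb' _ _]] := jost_plus_props hk ala abe M0 hkappa cU1 bU1.
have [g' [[gd gd'] gb gb' _ _]] := jost_minus_props hk ala abe M0 hkappa cU2 bU2.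
have wd := jost_wronskian_diff hk ala abe M0 hkappa cU1 cU2 bU1 bU2.
set f := jost_plus U1 k in fd fd' fb wd; set g := jost_minus U2 k in gd gd' gb wd.
set A := jost_bound al a be M kappa in fb fb' gb gb'.
have A0 : 0 <= A by have := le_trans (normc_ge0 _) (fb 0); rewrite pmulr_lge0 ?expR_gt0.
have c1 : ccont f := cdiff_ccont fd. have c1' : ccont f' := cdiff_ccont fd'.
have c2 : ccont g := cdiff_ccont gd. have c2' : ccont g' := cdiff_ccont gd'.
have eg x : egrow (2 * a) x = egrow a x * egrow a x.
  by rewrite /egrow -expRD; congr expR; ring.
have prod (u v : R -> C) : (forall x, normc (u x) <= A * egrow a x) ->
    (forall x, normc (v x) <= A * egrow a x) -> forall x, normc (u x * v x) <= A ^+ 2 * egrow (2 * a) x.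
  move=> hu hv x; rewrite normcM eg.
  have -> : A ^+ 2 * (egrow a x * egrow a x) = (A * egrow a x) * (A * egrow a x) by ring.
  by rewrite ler_pM ?normc_ge0.
have BA c : 0 <= c -> c <= 2 * M + 2 * kappa ^+ 2 + 2 -> c * A ^+ 2 <= Bconst.
  by move=> c0 h; rewrite /Bconst ler_wpM2r// sqr_ge0.
have k2 : 0 <= kappa ^+ 2 by rewrite sqr_ge0.
have M_gt0 : 0 < M := M0.
have B0 : 0 <= Bconst by rewrite /Bconst mulr_ge0 ?sqr_ge0// !addr_ge0// ?mulr_ge0// ltW.
pose p x := f x * g x.
pose p' x := f' x * g x + f x * g' x.
pose r x := f' x * g' x.
pose q1 x := (U1 x)%:C - k ^+ 2; pose q2 x := (U2 x)%:C - k ^+ 2.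
pose p'' x := (q1 x + q2 x) * p x + 2 * r x.
have p''E x : p'' x = ((U1 x)%:C + (U2 x)%:C - 2 * k ^+ 2) * p x + 2 * r x.
  by rewrite /p'' /q1 /q2; ring.
pose r' x := q1 x * (f x * g' x) + q2 x * (f' x * g x).
have cq1 : ccont q1 by apply: ccontB; [exact: ccont_real|exact: ccont_cst].
have cq2 : ccont q2 by apply: ccontB; [exact: ccont_real|exact: ccont_cst].
have nk2 : normc (k ^+ 2) <= kappa ^+ 2.
  by rewrite normcX ler_pXn2r ?nnegrE ?normc_ge0.
have bq (U : R -> R) x : (forall x, `|U x| <= M * edecay be x) ->
    normc ((U x)%:C - k ^+ 2) <= M + kappa ^+ 2.
  move=> hU; rewrite (le_trans (ler_normcB _ _))// normcR lerD//.
  exact: le_edecay_cst (ltW M0) (hU x).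
have gp : grows a Bconst p.
  move=> x; apply: le_trans (prod f g fb gb x) _; rewrite ler_wpM2r ?expR_ge0//.
  by rewrite -[leLHS]mul1r; apply: BA => //; lra.
have gr : grows a Bconst r.
  move=> x; apply: le_trans (prod f' g' fb' gb' x) _; rewrite ler_wpM2r ?expR_ge0//.
  by rewrite -[leLHS]mul1r; apply: BA => //; lra.
have gp' : grows a Bconst p'.
  move=> x; rewrite (le_trans (le_normcD _ _))//.
  apply: (@le_trans _ _ (2 * A ^+ 2 * egrow (2 * a) x)).
    have -> : 2 * A ^+ 2 * egrow (2 * a) x = A ^+ 2 * egrow (2 * a) x + A ^+ 2 * egrow (2 * a) x by ring.
    by apply: lerD; exact: prod.
  by rewrite ler_wpM2r ?expR_ge0//; apply: BA => //; lra.
have gp'' : grows a Bconst p''.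
  move=> x; rewrite (le_trans (le_normcD _ _))// !normcM.
  have n2 : normc (2 : C) = 2 by rewrite normcMn normc1.
  have e : Bconst * egrow (2 * a) x = (M + kappa ^+ 2 + (M + kappa ^+ 2)) * (A ^+ 2 * egrow (2 * a) x)
     + 2 * (A ^+ 2 * egrow (2 * a) x) by rewrite /Bconst -/A; ring.
  rewrite e n2 -!normcM lerD//.
    rewrite normcM ler_pM ?normc_ge0//; last exact: prod.
    by rewrite (le_trans (le_normcD _ _))// lerD// bq.
  by rewrite ler_wpM2l//; exact: prod.
have gr' : grows a Bconst r'.
  move=> x; rewrite (le_trans (le_normcD _ _))//.
  apply: (@le_trans _ _ ((M + kappa ^+ 2) * (A ^+ 2 * egrow (2 * a) x) + (M + kappa ^+ 2) * (A ^+ 2 * egrow (2 * a) x))).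
    rewrite (normcM (q1 x)) (normcM (q2 x)); apply: lerD; rewrite ler_pM ?normc_ge0//.
    - exact: bq. - exact: prod. - exact: bq. - exact: prod.
  rewrite -mulrDl mulrA ler_wpM2r ?expR_ge0//; apply: BA; lra.
have dp : cdiff p p' by exact: cdiffM.
have cp : ccont p := cdiff_ccont dp.
have dp' : cdiff p' p''.
  apply: eq_cdiff (cdiffD (cdiffM fd' gd) (cdiffM fd gd')) => // x.
  by rewrite /p'' /q1 /q2 /p /r; ring.
have cp' : ccont p' := cdiff_ccont dp'.
have dr : cdiff r r'.
  apply: eq_cdiff (cdiffM fd' gd') => // x.
  by rewrite /r' /q1 /q2; ring.
have cr : ccont r := cdiff_ccont dr.
have cp'' : ccont p''.
  by apply: ccontD; apply: ccontM => //; [exact: ccontD|exact: ccont_cst].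
have cr' : ccont r' by apply: ccontD; apply: ccontM => //; exact: ccontM.
exists p, p', r, r'; split => //; split => //.
- by split => //; apply: eq_cdiff dp' => // x; rewrite p''E.
- by move=> x; rewrite -p''E.
Qed.

Lemma Bconst_ge0 : 0 <= Bconst.
Proof.
have M_gt0 : 0 < M := M0.
by rewrite /Bconst mulr_ge0 ?sqr_ge0// !addr_ge0// ?mulr_ge0 ?sqr_ge0// ltW.
Qed.

Section Mode.
Context (p p' r r' : R -> C).
Context (H : schroedinger_pair p p' r r').

Let dp : cdiff p p'. Proof. by case: H => [[]]. Qed.
Let dp' : cdiff p' (fun x => ((U1 x)%:C + (U2 x)%:C - 2 * k ^+ 2) * p x + 2 * r x).
Proof. by case: H => [[]]. Qed.
Let dr : cdiff r r'. Proof. by case: H => _ []. Qed.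
Let cr' : ccont r'. Proof. by case: H => _ []. Qed.
Let gp : grows a Bconst p. Proof. by case: H => _ _ []. Qed.
Let gp' : grows a Bconst p'. Proof. by case: H => _ _ []. Qed.
Let gr : grows a Bconst r. Proof. by case: H => _ _ _ []. Qed.
Let gr' : grows a Bconst r'. Proof. by case: H => _ _ _ []. Qed.
Let gp'' : grows a Bconst (fun x => ((U1 x)%:C + (U2 x)%:C - 2 * k ^+ 2) * p x + 2 * r x).
Proof. by case: H. Qed.
Let cp : ccont p. Proof. exact: cdiff_ccont dp. Qed.
Let cp' : ccont p'. Proof. exact: cdiff_ccont dp'. Qed.
Let cr : ccont r. Proof. exact: cdiff_ccont dr. Qed.
Let cp'' : ccont (fun x => ((U1 x)%:C + (U2 x)%:C - 2 * k ^+ 2) * p x + 2 * r x).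
Proof.
apply: ccontD; apply: ccontM => //; last exact: ccont_cst.
by apply: ccontB; [apply: ccontD; exact: ccont_real|exact: ccont_cst].
Qed.
Let B0 := Bconst_ge0.
Let tp : tempered a p. Proof. by split => //; exists Bconst. Qed.
Let tr : tempered a r. Proof. by split => //; exists Bconst. Qed.

(** The weak Leibniz rule for [(Q p)'']: one integration by parts on [Q * p], then one on each of
    the two resulting products, whose mixed terms coincide and give the factor 2. *)
Lemma mode_ibp j : cint setT (fun x => Q j x * (p x * osc (om j) x)) =
  - (om j ^- 2)%:C * (cint setT (fun x => G2 j x * (p x * osc (om j) x))
    + 2 * cint setT (fun x => D1 j x * (p' x * osc (om j) x))
    + cint setT (fun x => Q j x * ((((U1 x)%:C + (U2 x)%:C - 2 * k ^+ 2) * p x + 2 * r x)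
         * osc (om j) x))).
Proof.
have o0 := om_neq0 j.
rewrite (osc_ibp abe o0 B0 (wQ j) (dQ j) (dD1 j) dp cp' gp gp').
rewrite (osc_ibp abe o0 B0 (wD j) (dD1 j) (bG2 j) dp cp' gp gp').
rewrite (osc_ibp abe o0 B0 (wQ j) (dQ j) (dD1 j) dp' cp'' gp' gp'').
have oC : (om j)%:C != 0 :> C by rewrite eq_complex /= negb_and o0.
have -> : - (om j ^- 2)%:C = 'i / (om j)%:C * ('i / (om j)%:C) :> C.
  have -> : 'i / (om j)%:C * ('i / (om j)%:C) = ('i * 'i) * ((om j)%:C ^- 2) :> C by field.
  by rewrite i_sqr mulN1r fmorphV rmorphXn.
by ring.
Qed.

Lemma cbounded_Q j : cbounded (Q j).
Proof.
split; first exact: ccontQ.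
by exists (n j) => x; exact: le_edecay_cst (n0 j) (bQ j x).
Qed.

Lemma cbounded_real (u : R -> R) (K : R) : continuous u -> (forall x, `|u x| <= K) ->
  cbounded (fun x => (u x)%:C).
Proof. by move=> cu hu; split; [exact: ccont_real|exists K => x; rewrite normcR]. Qed.

Lemma cbounded_qav : cbounded (fun x => (qav x)%:C).
Proof. by apply: (@cbounded_real _ N) => // x; exact: le_edecay_cst N0 (bqav x). Qed.

(** What is left of [U1 + U2] without [2 * qav] and the oscillating sum. By [sE] its size is of
    order [eps ^ 2 + tau], so a bound by absolute values is enough for it. *)
Let s x := (U1 x)%:C + (U2 x)%:C - 2 * (qav x)%:C - \sum_l Q l x * osc (om l) x.

Lemma sE x : s x = (- (eps ^+ 2 * Lam x) + r1 x + r2 x)%:C.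
Proof. by rewrite /s U1E U2E !rmorphD rmorphN /=; ring. Qed.

Lemma cbounded_s : cbounded s.
Proof.
have ds x : normc (s x) <= eps ^+ 2 * Lbound + tau + tau.
  rewrite sE normcR (le_trans (ler_normD _ _))// lerD//.
    rewrite (le_trans (ler_normD _ _))// lerD//; last exact: le_edecay_cst tau0 (br1 x).
    rewrite normrN normrM ger0_norm ?sqr_ge0// ler_wpM2l ?sqr_ge0// ger0_norm ?Lam_ge0//.
    by apply: le_edecay_cst (Lam_le x); rewrite divr_ge0 ?sqr_ge0.
  exact: le_edecay_cst tau0 (br2 x).
split; last by exists (eps ^+ 2 * Lbound + tau + tau).
apply: ccontB.
  apply: ccontB; first by apply: ccontD; exact: ccont_real.
  by apply: ccontM; [exact: ccont_cst|exact: ccont_real].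
by apply: ccont_sum => l; apply: ccontM; [exact: ccontQ|exact: ccont_osc].
Qed.

Lemma s_grows : grows a ((eps ^+ 2 * Lbound + 2 * tau) * Bconst) (fun x => s x * p x).
Proof.
move=> x; rewrite normcM -mulrA; apply: ler_pM; rewrite ?normc_ge0//.
have -> : eps ^+ 2 * Lbound + 2 * tau = eps ^+ 2 * Lbound + tau + tau by ring.
rewrite sE normcR (le_trans (ler_normD _ _))// lerD//.
  rewrite (le_trans (ler_normD _ _))// lerD//; last exact: le_edecay_cst tau0 (br1 x).
  rewrite normrN normrM ger0_norm ?sqr_ge0// ler_wpM2l ?sqr_ge0// ger0_norm ?Lam_ge0//.
  by apply: le_edecay_cst (Lam_le x); rewrite divr_ge0 ?sqr_ge0.
exact: le_edecay_cst tau0 (br2 x).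
Qed.

(** All terms but the one with [s] are arranged as a weakly differentiable factor, a continuously
    differentiable one and [osc], the shape of [osc_bound]. In the first term [qav], which has only
    one weak derivative, takes the weak place and [Q j] joins the test function. *)
Lemma mode_split j :
  cint setT (fun x => Q j x * ((((U1 x)%:C + (U2 x)%:C - 2 * k ^+ 2) * p x + 2 * r x)
         * osc (om j) x)) =
  2 * cint setT (fun x => (qav x)%:C * ((Q j x * p x) * osc (om j) x))
  + - (2 * k ^+ 2) * cint setT (fun x => Q j x * (p x * osc (om j) x))
  + 2 * cint setT (fun x => Q j x * (r x * osc (om j) x))
  + cint setT (fun x => Q j x * ((s x * p x) * osc (om j) x))
  + \sum_l cint setT (fun x => Q j x * ((Q l x * p x) * osc (om j + om l) x)).
Proof.
have t1 := tempered_osc (om j) tp.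
have tq : tempered a (fun x => (qav x)%:C * (p x * osc (om j) x)) := temperedMb cbounded_qav t1.
have t2 := tempered_osc (om j) tr.
have t3 := tempered_osc (om j) (temperedMb cbounded_s tp).
have t4 l : tempered a (fun x => (Q l x * p x) * osc (om j + om l) x).
  by apply: tempered_osc; exact: temperedMb (cbounded_Q l) tp.
have t4s : tempered a (fun x => \sum_l (Q l x * p x) * osc (om j + om l) x).
  have h := temperedMb (cbounded_sum (index_enum I) (fun l => cboundedM (cbounded_Q l) (cbounded_osc (om j + om l)))) tp.
  rewrite (_ : (fun x => _) = (fun x => (\sum_l Q l x * osc (om j + om l) x) * p x)) //.
  by apply/funext => x; rewrite mulr_suml; apply: eq_bigr => l _; ring.
rewrite -(tempered_cint_sum abe (index_enum I) (dQ j) t4).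
have -> : cint setT (fun x => (qav x)%:C * ((Q j x * p x) * osc (om j) x)) =
   cint setT (fun x => Q j x * ((qav x)%:C * (p x * osc (om j) x))).
  by apply: eq_cint => x _; ring.
rewrite -(tempered_cintZ abe 2 (dQ j) tq) -(tempered_cintZ abe (- (2 * k ^+ 2)) (dQ j) t1).
rewrite -(tempered_cintZ abe 2 (dQ j) t2).
have T1 := temperedD (temperedZ 2 tq) (temperedZ (- (2 * k ^+ 2)) t1).
rewrite -(tempered_cintD abe (dQ j) (temperedZ 2 tq) (temperedZ (- (2 * k ^+ 2)) t1)).
rewrite -(tempered_cintD abe (dQ j) T1 (temperedZ 2 t2)).
rewrite -(tempered_cintD abe (dQ j) (temperedD T1 (temperedZ 2 t2)) t3).
rewrite -(tempered_cintD abe (dQ j) (temperedD (temperedD T1 (temperedZ 2 t2)) t3) t4s).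
apply: eq_cint => x _; congr (_ * _).
have -> : \sum_l Q l x * p x * osc (om j + om l) x =
    (\sum_l Q l x * osc (om l) x) * p x * osc (om j) x.
  rewrite !mulr_suml; apply: eq_bigr => l _.
  by rewrite /osc mulrDl rmorphD mulrDr cexpD; ring.
by rewrite /s; ring.
Qed.

Lemma om_nu j : om (nu j) = - om j.
Proof. by rewrite /om lam_nu mulrN mulNr. Qed.

Lemma osc0 x : osc 0 x = 1 :> C.
Proof. by rewrite /osc mul0r mulr0 cexp0. Qed.

Lemma om_inv j : `|om j|^-1 <= eps / theta.
Proof. exact: om_inv_le. Qed.

Lemma om_sum_inv j l : l != nu j -> `|om j + om l|^-1 <= eps / theta.
Proof.
move=> jl; have -> : om j + om l = 2 * pi * (lam j + lam l) / eps by rewrite /om; ring.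
exact: om_inv_le (lam_sep jl).
Qed.

Lemma om_sum_neq0 j l : l != nu j -> om j + om l != 0.
Proof.
move=> jl; have -> : om j + om l = 2 * pi * (lam j + lam l) / eps by rewrite /om; ring.
have : lam j + lam l != 0 by rewrite -normr_gt0 (lt_le_trans theta0)// lam_sep.
by move=> h; rewrite !mulf_neq0 ?invr_eq0 ?h ?gt_eqF// ?pi_gt0.
Qed.

Let Qp_diff l : cdiff (fun x => Q l x * p x) (fun x => D1 l x * p x + Q l x * p' x).
Proof. exact: cdiffM. Qed.

Let Qp_ccont l : ccont (fun x => D1 l x * p x + Q l x * p' x).
Proof. by apply: ccontD; apply: ccontM => //; exact: ccontQ. Qed.

Let mul_grows (u v : R -> C) l : (forall x, normc (u x) <= n l * edecay be x) ->
  grows a Bconst v -> forall x, normc (u x * v x) <= n l * Bconst * egrow (2 * a) x.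
Proof.
move=> hu hv x; rewrite normcM -mulrA ler_pM ?normc_ge0//.
exact: le_edecay_cst (n0 l) (hu x).
Qed.

(** Weakened by a factor 2, because [osc_bound] takes one constant for a function and its
    derivative, and this derivative is a sum of two products. *)
Let Qp_grows l : grows a (2 * (n l * Bconst)) (fun x => Q l x * p x).
Proof.
move=> x; apply: le_trans (mul_grows (bQ l) gp x) _.
have nb : 0 <= n l * Bconst by rewrite mulr_ge0.
by apply: ler_wpM2r; [exact: expR_ge0|lra].
Qed.

Let Qp_grows' l : grows a (2 * (n l * Bconst)) (fun x => D1 l x * p x + Q l x * p' x).
Proof.
move=> x; rewrite (le_trans (le_normcD _ _))// mulr_natl mulr2n mulrDl; apply: lerD.
  exact: mul_grows.
exact: mul_grows.
Qed.

(* The resonant product [Q j * Q (nu j) = |Q j| ^ 2] does not oscillate. It is kept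
   on the left: summed over [j], it rebuilds [eps ^ 2 * Lam]. *)
Lemma mode_bound j :
  normc (cint setT (fun x => Q j x * (p x * osc (om j) x))
     + (om j ^- 2)%:C * cint setT (fun x => Q j x * Q (nu j) x * p x))
  <= (eps / theta) ^+ 2 * (n j * Ydecay (eps / theta) (eps ^+ 2 * Lbound + 2 * tau)).
Proof.
set h := eps / theta; have h0 : 0 <= h by rewrite divr_ge0// ltW.
have d8 : 0 <= 8 / d by rewrite divr_ge0// ltW.
rewrite mode_ibp mode_split (bigD1 (nu j))//=.
have -> : cint setT (fun x => Q j x * (Q (nu j) x * p x * osc (om j + om (nu j)) x)) =
    cint setT (fun x => Q j x * Q (nu j) x * p x).
  by apply: eq_cint => x _; rewrite om_nu subrr osc0; ring.
set Z := cint setT (fun x => Q j x * Q (nu j) x * p x).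
set T1 := cint setT (fun x => G2 j x * _); set T2 := cint setT (fun x => D1 j x * _).
set T3 := cint setT (fun x => (qav x)%:C * _).
set T4 := cint setT (fun x => Q j x * (p x * osc (om j) x)).
set T5 := cint setT (fun x => Q j x * (r x * osc (om j) x)).
set T6 := cint setT (fun x => Q j x * (s x * p x * osc (om j) x)).
set T7 := \sum_(l | l != nu j) _.
(* The integral [Z], produced by [l = nu j], cancels against the one added on the left of the
   claim. *)
have -> : - (om j ^- 2)%:C * (T1 + 2 * T2 + (2 * T3 + - (2 * k ^+ 2) * T4 + 2 * T5 + T6 + (Z + T7)))
   + (om j ^- 2)%:C * Z = - (om j ^- 2)%:C * (T1 + 2 * T2 + (2 * T3 + - (2 * k ^+ 2) * T4 + 2 * T5 + T6 + T7)).
  by ring.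
rewrite normcM normcN normcR normrV ?unitfE ?expf_neq0 ?om_neq0// normrX -exprVn.
rewrite ler_pM ?normc_ge0 ?exprn_ge0 ?invr_ge0//.
  by rewrite ler_pXn2r ?nnegrE ?invr_ge0// om_inv.
have osc_le (om B Nn : R) (X : C) : `|om|^-1 <= h -> 0 <= Nn * B ->
    normc X <= `|om|^-1 * (8 / d * (Nn * B)) -> normc X <= h * (8 / d * (Nn * B)).
  move=> ho NB hX; apply: le_trans hX _; rewrite ler_wpM2r//.
  by rewrite mulr_ge0.
have nB0 l : 0 <= n l * Bconst by rewrite mulr_ge0.
have oj := om_inv j; have o0 := om_neq0 j.
have b1 : normc T1 <= h * (8 / d * (n j * Bconst)).
  by apply: (osc_le _ _ _ _ oj) => //; exact: (osc_bound abe o0 B0 (wG j) (bG2 j) (bG3 j) dp cp' gp gp').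
have b2 : normc T2 <= h * (8 / d * (n j * Bconst)).
  by apply: (osc_le _ _ _ _ oj) => //; exact: (osc_bound abe o0 B0 (wD j) (dD1 j) (bG2 j) dp' cp'' gp' gp'').
have b3 : normc T3 <= h * (8 / d * (N * (2 * (n j * Bconst)))).
  apply: (osc_le _ _ _ _ oj); first by apply: mulr_ge0 => //; apply: mulr_ge0.
  by apply: (osc_bound abe o0 _ wqav dqav bqav1 (Qp_diff j) (Qp_ccont j) (Qp_grows j) (Qp_grows' j)); apply: mulr_ge0.
have b4 : normc T4 <= h * (8 / d * (n j * Bconst)).
  by apply: (osc_le _ _ _ _ oj) => //; exact: (osc_bound abe o0 B0 (wQ j) (dQ j) (dD1 j) dp cp' gp gp').
have b5 : normc T5 <= h * (8 / d * (n j * Bconst)).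
  by apply: (osc_le _ _ _ _ oj) => //; exact: (osc_bound abe o0 B0 (wQ j) (dQ j) (dD1 j) dr cr' gr gr').
have L0 : 0 <= Lbound by rewrite divr_ge0 ?sqr_ge0.
have e0 : 0 <= eps ^+ 2 * Lbound + 2 * tau.
  by apply: addr_ge0; apply: mulr_ge0 => //; exact: sqr_ge0.
have b6 : normc T6 <= 4 / d * (n j * ((eps ^+ 2 * Lbound + 2 * tau) * Bconst)).
  apply: (decays_grows_cint_le abe (dQ j) (grows_osc (om j) s_grows)).
    by rewrite mulr_ge0.
  apply: ccont_cmeas; apply: ccontM; last exact: ccont_osc.
  by apply: ccontM => //; case: cbounded_s.
(* The sum over [l] costs only a factor [N], whatever the number of modes, because the bound for
   each [l] is proportional to [n l]. *)
have b7 : normc T7 <= h * (8 / d * (n j * (2 * (N * Bconst)))).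
  apply: (@le_trans _ _ (\sum_(l | l != nu j) h * (8 / d * (n j * (2 * (n l * Bconst)))))).
    rewrite /T7; elim/big_ind2 : _ => [|u1 v1 u2 v2 h1 h2|l jl]; first by rewrite normc0.
      by rewrite (le_trans (le_normcD _ _))// lerD.
    apply: (osc_le _ _ _ _ (om_sum_inv jl)); first by apply: mulr_ge0 => //; apply: mulr_ge0.
    by apply: (osc_bound abe (om_sum_neq0 jl) _ (wQ j) (dQ j) (dD1 j) (Qp_diff l) (Qp_ccont l) (Qp_grows l) (Qp_grows' l)); apply: mulr_ge0.
  rewrite -!mulr_sumr -mulr_suml; do 2 apply: ler_wpM2l => //; apply: ler_wpM2l => //.
  apply: ler_wpM2l => //; apply: ler_wpM2r => //.
  rewrite (le_trans _ nN)// [leRHS](bigD1 (nu j))//= lerDr.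
  exact: n0.
have n2 : normc (2 : C) = 2 by rewrite normcMn normc1.
have k2 : normc (- (2 * k ^+ 2)) <= 2 * kappa ^+ 2.
  rewrite normcN (normcM 2) n2 ler_wpM2l// normcX ler_pXn2r ?nnegrE ?normc_ge0//.
have m2 (X : C) (b : R) : normc X <= b -> normc (2 * X) <= 2 * b.
  by move=> hX; rewrite (normcM 2) n2 ler_wpM2l.
have b4' : normc (- (2 * k ^+ 2) * T4) <= 2 * kappa ^+ 2 * (h * (8 / d * (n j * Bconst))).
  by rewrite (normcM (- _)) ler_pM ?normc_ge0.
have -> : n j * Ydecay h (eps ^+ 2 * Lbound + 2 * tau) =
   h * (8 / d * (n j * Bconst)) + 2 * (h * (8 / d * (n j * Bconst)))
   + (2 * (h * (8 / d * (N * (2 * (n j * Bconst))))) +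
      2 * kappa ^+ 2 * (h * (8 / d * (n j * Bconst))) + 2 * (h * (8 / d * (n j * Bconst)))
      + 4 / d * (n j * ((eps ^+ 2 * Lbound + 2 * tau) * Bconst))
      + h * (8 / d * (n j * (2 * (N * Bconst))))).
  by rewrite /Ydecay; ring.
do ! (rewrite (le_trans (le_normcD _ _))//; apply: lerD => //; rewrite ?m2//).
Qed.

End Mode.

(** In order: the terms integrated by parts once more, of size [h ^+ 3] with [h = eps / theta]; the
    part [eps ^+ 2 * Lbound] of the bound on [s], which gives [eps ^+ 4]; its part [2 * tau]; and
    the remainder [r2 - r1] itself. *)
Definition core_const := 8 / d * (N * Bconst) * (5 + 2 * kappa ^+ 2 + 6 * N) / theta ^+ 3
  + 4 / d * (N * Bconst) * Lbound / theta ^+ 2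
  + 8 / d * (N * Bconst) / theta ^+ 2 + 8 / d * Bconst.

Lemma core_estimate : normc (jost_wronskian U2 k - jost_wronskian U1 k) <=
  core_const * (eps ^+ 3 + tau).
Proof.
have [p [p' [r [r' [H ->]]]]] := product_schroedinger_pair.
have gp : grows a Bconst p by case: H => _ _ [].
have cp : ccont p by case: H => [[dp _]] *; exact: cdiff_ccont dp.
have tp : tempered a p by split => //; exists Bconst.
have B0 := Bconst_ge0.
have cQQ j : ccont (fun x => Q j x * Q (nu j) x) by apply: ccontM; exact: ccontQ.
have dQQ j : decays be (n j * N) (fun x => Q j x * Q (nu j) x).
  apply: decays_pw => // x; rewrite QQnu normcR ger0_norm ?sqr_ge0//.
  exact: normc_sqr_le.
pose rr x := (U2 x - U1 x)%:C - \sum_j Q j x * osc (om j) x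
  - \sum_j (om j ^- 2)%:C * (Q j x * Q (nu j) x).
(* The origin of the effective potential: the squared inverse frequencies times the resonant
   products sum exactly to [eps ^+ 2 * Lam]. Adding and subtracting the resonant integrals therefore
   leaves only [r2 - r1] in [rr]. *)
have LamE x : (eps ^+ 2 * Lam x)%:C = \sum_j (om j ^- 2)%:C * (Q j x * Q (nu j) x).
  rewrite /Lam mulrA mulr_sumr rmorph_sum; apply: eq_bigr => j _.
  rewrite QQnu -rmorphM; congr (_%:C); rewrite /om.
  have l0 := lam_neq0 j; have e0 : eps != 0 by rewrite gt_eqF.
  have : pi != 0 :> R by rewrite gt_eqF ?pi_gt0.
  by move: (pi : R) => P p0; field; rewrite l0 e0 p0.
have rrE x : rr x = (r2 x - r1 x)%:C.
  by rewrite /rr -LamE real_complexB U2E U1E !rmorphD rmorphN /=; ring.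
have crr : ccont rr.
  apply: ccontB; first apply: ccontB.
  - by apply: ccont_real => x; apply: cvgB; [exact: cU2|exact: cU1].
  - by apply: ccont_sum => j; apply: ccontM; [exact: ccontQ|exact: ccont_osc].
  - by apply: ccont_sum => j; apply: ccontM; [exact: ccont_cst|exact: cQQ].
have drr : decays be (tau + tau) rr.
  apply: decays_pw => // x; rewrite rrE normcR mulrDl.
  by rewrite (le_trans (ler_normB _ _))// lerD.
have i1 j := tempered_integrable abe (dQ j) (tempered_osc (om j) tp).
have i2 j := tempered_integrable abe (dQQ j) tp.
have i3 := tempered_integrable abe drr tp.
have i4 j := cintegrableZ (om j ^- 2)%:C measurableT (i2 j).
have i5 j := cintegrableD measurableT (i1 j) (i4 j).
have -> : cint setT (fun x => (U2 x - U1 x)%:C * p x) =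
   \sum_j (cint setT (fun x => Q j x * (p x * osc (om j) x))
     + (om j ^- 2)%:C * cint setT (fun x => Q j x * Q (nu j) x * p x))
   + cint setT (fun x => rr x * p x).
  under eq_bigr => j _ do rewrite -(cintZ _ measurableT (i2 j)) -(cintD measurableT (i1 j) (i4 j)).
  rewrite -(cint_sum (index_enum I) measurableT i5).
  rewrite -(cintD measurableT (cintegrable_sum (index_enum I) measurableT i5) i3).
  apply: eq_cint => x _; rewrite big_split /= /rr.
  have -> : \sum_i Q i x * (p x * osc (om i) x) = (\sum_i Q i x * osc (om i) x) * p x.
    by rewrite mulr_suml; apply: eq_bigr => i _; ring.
  have -> : \sum_i (om i ^- 2)%:C * (Q i x * Q (nu i) x * p x) =
      (\sum_i (om i ^- 2)%:C * (Q i x * Q (nu i) x)) * p x.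
    by rewrite mulr_suml; apply: eq_bigr => i _; ring.
  by ring.
set h := eps / theta; set t := eps ^+ 2 * Lbound + 2 * tau.
have h0 : 0 <= h by rewrite divr_ge0// ltW.
have L0 : 0 <= Lbound by rewrite divr_ge0 ?sqr_ge0.
have t0 : 0 <= t by apply: addr_ge0; apply: mulr_ge0 => //; exact: sqr_ge0.
have d4 : 0 <= 4 / d by rewrite divr_ge0// ltW.
have d8 : 0 <= 8 / d by rewrite divr_ge0// ltW.
have s1 : normc (\sum_j (cint setT (fun x => Q j x * (p x * osc (om j) x))
     + (om j ^- 2)%:C * cint setT (fun x => Q j x * Q (nu j) x * p x))) <=
     h ^+ 2 * (N * Ydecay h t).
  apply: (@le_trans _ _ (\sum_j h ^+ 2 * (n j * Ydecay h t))).
    elim/big_ind2 : _ => [|u1 v1 u2 v2 h1 h2|j _]; first by rewrite normc0.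
      by rewrite (le_trans (le_normcD _ _))// lerD.
    exact: mode_bound H j.
  rewrite -mulr_sumr -mulr_suml ler_wpM2l ?sqr_ge0// ler_wpM2r//.
  apply: addr_ge0; apply: mulr_ge0 => //; apply: mulr_ge0 => //; first exact: mulr_ge0.
  by rewrite !addr_ge0// mulr_ge0// sqr_ge0.
have s2 : normc (cint setT (fun x => rr x * p x)) <= 4 / d * ((tau + tau) * Bconst).
  exact: (decays_grows_cint_le abe drr gp B0 (ccont_cmeas cp)).
apply: le_trans (le_normcD _ _) _; apply: le_trans (lerD s1 s2) _.
have NB : 0 <= N * Bconst by rewrite mulr_ge0.
(* Here [eps <= 1] enters: the fourth power is absorbed into the third. *)
have e3 : eps ^+ 4 <= eps ^+ 3 by rewrite ler_wiXn2l// ltW.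
have e2 : eps ^+ 2 <= 1 by rewrite exprn_ile1// ltW.
have e30 : 0 <= eps ^+ 3 by rewrite exprn_ge0// ltW.
have k0 : 0 <= 5 + 2 * kappa ^+ 2 + 6 * N.
  by rewrite !addr_ge0// mulr_ge0// sqr_ge0.
have tn0 : theta != 0 by rewrite gt_eqF.
have -> : h ^+ 2 * (N * Ydecay h t) + 4 / d * ((tau + tau) * Bconst) =
  8 / d * (N * Bconst) * (5 + 2 * kappa ^+ 2 + 6 * N) / theta ^+ 3 * eps ^+ 3 +
  4 / d * (N * Bconst) * Lbound / theta ^+ 2 * eps ^+ 4 +
  8 / d * (N * Bconst) / theta ^+ 2 * (eps ^+ 2 * tau) + 8 / d * Bconst * tau.
  by rewrite /Ydecay /h /t; field; rewrite tn0 gt_eqF.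
rewrite /core_const; set c1 := _ / theta ^+ 3; set c2 := _ * Lbound / theta ^+ 2.
set c3 := _ / theta ^+ 2; set c4 := 8 / d * Bconst.
have th n' : 0 <= theta ^+ n' by rewrite exprn_ge0// ltW.
have c10 : 0 <= c1 by rewrite /c1 divr_ge0// mulr_ge0// mulr_ge0.
have c20 : 0 <= c2 by rewrite /c2 divr_ge0// mulr_ge0// mulr_ge0.
have c30 : 0 <= c3 by rewrite /c3 divr_ge0// mulr_ge0.
have c40 : 0 <= c4 by rewrite /c4 mulr_ge0.
have u1 : c2 * eps ^+ 4 <= c2 * eps ^+ 3 by rewrite ler_wpM2l.
have u2 : c3 * (eps ^+ 2 * tau) <= c3 * tau by rewrite ler_wpM2l// ler_piMl.
have tt := tau0.
have v1 := mulr_ge0 c10 tt; have v2 := mulr_ge0 c20 tt.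
have v3 := mulr_ge0 c30 e30; have v4 := mulr_ge0 c40 e30.
by rewrite !mulrDl !mulrDr; lra.
Qed.

End Core.

(** * Continuous representatives of Sobolev functions *)

Section DuBoisReymond.
Context {R : realType}.
Local Notation C := R[i].
Local Notation mu := (@lebesgue_measure R).
Implicit Types (g h : R -> R) (x y : R).

Lemma ae_exists (P : R -> Prop) : {ae mu, forall x, P x} -> exists x, P x.
Proof.
move=> ae; apply: contrapT => H.
have : {ae mu, forall x : R, False} by apply: ae_imp ae _ => x hx; apply: H; exists x.
move=> [A [mA A0 AT]]; have : mu setT = 0.
  rewrite -A0; congr (mu _); apply/seteqP; split => // x _.
  exact: AT.
have -> : mu setT = +oo%E by rewrite -set_itvNyy lebesgue_measure_itv.
by [].
Qed.

Let rad (n : nat) : R := n.+1%:R^-1.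
Let rad_gt0 n : 0 < rad n. Proof. by rewrite /rad invr_gt0 ltr0n. Qed.

Lemma lebesgue_pt_seq g x : mu.-integrable setT (EFin \o g) -> lebesgue_pt g x ->
  (rad n)^-1 * \int[mu]_(y in ball x (rad n)) `|g y - g x| @[n --> \oo] --> 0.
Proof.
move=> ig lx.
have c0 : rad n @[n --> \oo] --> 0^'+.
  move=> A hA; have h : \forall n \near \oo, 0 < rad n -> A (rad n) := cvg_harmonic hA.
  apply: (@filterS _ \oo _ (fun n => 0 < rad n -> A (rad n)) _ _ h) => n; apply.
  exact: rad_gt0.
have c1 : davg g x (rad n) @[n --> \oo] --> 0%E := cvg_comp _ _ c0 lx.
have e n : davg g x (rad n) =
    ((rad n *+ 2)^-1 * \int[mu]_(y in ball x (rad n)) `|g y - g x|)%:E.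
  have r0 := rad_gt0 n; have r2 : rad n *+ 2 != 0 by rewrite mulrn_eq0 /= gt_eqF.
  rewrite /davg /iavg lebesgue_measure_ball ?ltW// inver (negbTE r2) EFinM; congr (_ * _)%E.
  have mb : measurable (ball x (rad n)) by exact: measurable_ball.
  have ib : mu.-integrable (ball x (rad n)) (EFin \o (fun y => `|g y - g x|)).
    apply: (@integrable_norm _ _ _ mu _ (fun y => g y - g x)).
    apply: (@integrableB _ _ _ mu _ mb (EFin \o g) (cst (g x)%:E)); first exact: integrable_subT.
    apply: (@measurable_bounded_integrable _ _ _ mu (cst (g x)) _ mb);
      [|exact: measurable_cst|exact: bounded_cst].
    have e : mu (ball x (rad n)) = (rad n *+ 2)%:E by exact: lebesgue_measure_ball (ltW r0).
    have f : (mu (ball x (rad n)) < +oo)%E by rewrite e ltry.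
    exact: f.
  rewrite /Rintegral fineK//; exact: integrable_fin_num.
have c2 : (rad n *+ 2)^-1 * \int[mu]_(y in ball x (rad n)) `|g y - g x| @[n --> \oo] --> 0.
  have h := @fine_cvg _ _ _ _ (fun n => davg g x (rad n)) 0 c1.
  rewrite (_ : (fun n => _) = fine \o (fun n => davg g x (rad n))); first exact: h.
  by apply/funext => n /=; rewrite e.
have c3 : 2 * ((rad n *+ 2)^-1 * \int[mu]_(y in ball x (rad n)) `|g y - g x|) @[n --> \oo] --> (2 * 0 : R).
  by apply: cvgM => //; exact: cvg_cst.
rewrite mulr0 in c3; apply: cvg_trans c3; apply: near_eq_cvg; apply: nearW => n.
by rewrite -mulr_natr; field; rewrite gt_eqF.
Qed.


(** A mollified jump at [x]. Its derivative [scaled_tent] is an approximate identity supported in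
    the ball of radius [r] and bounded by [r^-1], which suits Lebesgue points. *)
Definition scaled_step (r x y : R) := step (r^-1 * (y - x)).
Definition scaled_tent (r x y : R) := r^-1 * tent (r^-1 * (y - x)).

Lemma is_derive_scaled_step r x (y : R) : is_derive y 1 (scaled_step r x) (scaled_tent r x y).
Proof.
have dl : is_derive y 1 (fun y : R => r^-1 * (y - x)) r^-1.
  apply: (@is_derive_eq _ _ _ _ _ _ _ _ (is_deriveZ r^-1 (is_deriveB (is_derive_id y 1) (is_derive_cst x y 1)))).
  by rewrite /GRing.scale /= subr0 mulr1.
have h := @is_derive1_comp R step (fun y => r^-1 * (y - x)) y _ _ (is_derive_step _) dl.
by rewrite mulrC in h.
Qed.

Lemma continuous_scaled_tent r x : continuous (scaled_tent r x).
Proof.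
move=> y; apply: cvgM; first exact: cvg_cst.
apply: (@continuous_comp _ _ _ (fun y => r^-1 * (y - x)) tent); last exact: continuous_tent.
by apply: cvgM; [exact: cvg_cst|apply: cvgB; [exact: cvg_id|exact: cvg_cst]].
Qed.

Lemma scaled_tent_bound r x y : 0 < r -> 0 <= scaled_tent r x y <= r^-1.
Proof.
move=> r0; have /andP[h1 h2] := tent_bound (r^-1 * (y - x)).
have ri : 0 <= r^-1 by rewrite invr_ge0 ltW.
by rewrite /scaled_tent mulr_ge0//= ler_piMr.
Qed.

Lemma scaled_tent_out r x y : 0 < r -> r <= `|x - y| -> scaled_tent r x y = 0.
Proof.
move=> r0 h; rewrite /scaled_tent tent_out ?mulr0//.
by rewrite normrM normfV (gtr0_norm r0) ler_pdivlMl// mulr1 distrC.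
Qed.

Lemma scaled_step_right r x y : 0 < r -> r <= y - x -> scaled_step r x y = 1.
Proof. by move=> r0 h; rewrite /scaled_step step_ge// ler_pdivlMl// mulr1. Qed.

Lemma scaled_step_left r x y : 0 < r -> y - x <= - r -> scaled_step r x y = 0.
Proof. by move=> r0 h; rewrite /scaled_step step_le// ler_pdivrMl// mulrN1. Qed.

(** The mass is the total rise of [scaled_step] from 0 to 1. *)
Lemma integral_scaled_tent r x : 0 < r ->
  mu.-integrable setT (EFin \o scaled_tent r x) /\ \int[mu]_y scaled_tent r x y = 1.
Proof.
move=> r0; have mb : measurable (ball x r) by exact: measurable_ball.
have it : mu.-integrable setT (EFin \o scaled_tent r x).
  have mt : measurable_fun setT (scaled_tent r x).
    by apply: continuous_measurable_fun; exact: continuous_scaled_tent.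
  have ib : mu.-integrable (ball x r) (EFin \o cst r^-1).
    apply: (@measurable_bounded_integrable _ _ _ mu (cst r^-1) _ mb);
      [|exact: measurable_cst|exact: bounded_cst].
    have e : mu (ball x r) = (r *+ 2)%:E by exact: lebesgue_measure_ball (ltW r0).
    have f : (mu (ball x r) < +oo)%E by rewrite e ltry.
    exact: f.
  have ib' := (@integrable_mkcond _ _ _ mu _ _ mb).1 ib.
  rewrite restrict_EFin in ib'.
  apply: (ae_dominated_integrable measurableT mt ib'); apply: ae_all => y _.
  have /andP[h1 h2] := scaled_tent_bound x y r0.
  rewrite ger0_norm// patchE; case: ifPn => //.
  rewrite notin_setE /ball /= => /negP; rewrite -leNgt => /(scaled_tent_out r0) ->.
  exact: lexx.
split => //.
have h := @Rintegral_derivative R (scaled_step r x) (scaled_tent r x) 0 1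
  (is_derive_scaled_step r x) (@continuous_scaled_tent r x) it.
rewrite h ?subr0//.
  apply: cvg_near_cst; near=> n; apply: scaled_step_right => //.
  by rewrite lerBrDr; near: n; exact: nbhs_infty_ger.
apply: cvg_near_cst; near=> n; apply: scaled_step_left => //.
have nr : r - x <= n%:R by near: n; exact: nbhs_infty_ger.
by lra.
Unshelve. all: by end_near. Qed.

(** The kernel has mass 1 and is at most [r^-1] on a ball of measure [2 r], so the error is at most
    twice the average of [|g y - g x|] over that ball. *)
Lemma lebesgue_pt_tent g x : mu.-integrable setT (EFin \o g) -> lebesgue_pt g x ->
  \int[mu]_y (g y * scaled_tent (rad n) x y) @[n --> \oo] --> g x.
Proof.
move=> ig lx; have c := lebesgue_pt_seq ig lx.
have mg : measurable_fun setT g by case/integrableP: ig => /measurable_EFinP.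
have bd n : `|\int[mu]_y (g y * scaled_tent (rad n) x y) - g x| <=
    (rad n)^-1 * \int[mu]_(y in ball x (rad n)) `|g y - g x|.
  have r0 := rad_gt0 n; have [it e1] := integral_scaled_tent x r0.
  have mb : measurable (ball x (rad n)) by exact: measurable_ball.
  have mt : measurable_fun setT (scaled_tent (rad n) x).
    by apply: continuous_measurable_fun; exact: continuous_scaled_tent.
  have igt : mu.-integrable setT (EFin \o (fun y => g y * scaled_tent (rad n) x y)).
    have ig' := @integrable_norm _ _ _ mu _ _ ig.
    apply: (ae_dominated_integrable measurableT _ (integrableZ (rad n)^-1 measurableT ig')).
      exact: measurable_funM.
    apply: ae_all => y _; have /andP[h1 h2] := scaled_tent_bound x y r0.
    by rewrite normrM mulrC ler_pM// ger0_norm.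
  have -> : \int[mu]_y (g y * scaled_tent (rad n) x y) - g x =
      \int[mu]_y ((g y - g x) * scaled_tent (rad n) x y).
    rewrite -[X in _ - X]mulr1 -e1 -RintegralZl// -RintegralB//; last exact: integrableZ.
    by apply: eq_Rintegral => y _; rewrite mulrBl.
  have ib : mu.-integrable (ball x (rad n)) (EFin \o (fun y => `|g y - g x|)).
    apply: (@integrable_norm _ _ _ mu _ (fun y => g y - g x)).
    apply: (@integrableB _ _ _ mu _ mb (EFin \o g) (cst (g x)%:E)); first exact: integrable_subT.
    apply: (@measurable_bounded_integrable _ _ _ mu (cst (g x)) _ mb);
      [|exact: measurable_cst|exact: bounded_cst].
    have e : mu (ball x (rad n)) = (rad n *+ 2)%:E by exact: lebesgue_measure_ball (ltW r0).
    have f : (mu (ball x (rad n)) < +oo)%E by rewrite e ltry.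
    exact: f.
  have ib1 := integrableZ (rad n)^-1 mb ib.
  have ib2 := (@integrable_mkcond _ _ _ mu _ _ mb).1 ib1.
  rewrite restrict_EFin in ib2.
  rewrite -RintegralZl// [leRHS]Rintegral_mkcond.
  apply: ae_norm_Rintegral_le => //.
    apply: (ae_dominated_integrable measurableT _ (_ : mu.-integrable setT (EFin \o
      (fun y => `|g y * scaled_tent (rad n) x y| + `|g x * scaled_tent (rad n) x y|)))).
    - apply: measurable_funM => //; apply: measurable_funB => //; exact: measurable_cst.
    - have h := @integrableD _ _ _ mu _ measurableT _ _ (@integrable_norm _ _ _ mu _ _ igt)
        (@integrable_norm _ _ _ mu _ _ (integrableZ (g x) measurableT it)).
      exact: eq_integrable h.
    - by apply: ae_all => y _; rewrite mulrBl ler_normB.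
  apply: ae_all => y _; rewrite patchE normrM.
  have /andP[h1 h2] := scaled_tent_bound x y r0.
  case: ifPn => [_|].
    by rewrite (ger0_norm h1) mulrC; apply: ler_wpM2r.
  rewrite notin_setE /ball /= => /negP; rewrite -leNgt => /(scaled_tent_out r0) ->.
  by rewrite normr0 mulr0.
apply/subr_cvg0; apply/norm_cvg0P.
apply: (squeeze_cvgr _ (cvg_cst 0) c); apply: nearW => n /=.
by rewrite normr_ge0 bd.
Qed.

(** Away from [x] the mollified jumps are eventually 0 or 1, and the single point [x] is a null
    set. *)
Lemma cvg_step_tail h x : mu.-integrable setT (EFin \o h) ->
  \int[mu]_y (h y * scaled_step (rad n) x y) @[n --> \oo] --> \int[mu]_(y in `]x, +oo[) h y.
Proof.
move=> ih; have [/measurable_EFinP mh _] := integrableP _ _ _ ih.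
rewrite Rintegral_mkcond.
have c0 : rad n @[n --> \oo] --> 0 by exact: cvg_harmonic.
have neqx : {ae mu, forall y, y != x}.
  exists [set x]; split => //; first exact: lebesgue_measure_set1.
  by move=> y /= /negP; rewrite negbK => /eqP.
have cs r : continuous (scaled_step r x).
  by move=> y; exact: is_derive_continuous (is_derive_scaled_step r x y).
apply: (@dominated_Rintegral_cvg _ _ _ _ (fun y => `|h y|)) => //.
- by move=> n; apply: measurable_funM => //; exact: continuous_measurable_fun.
- by apply/(measurable_restrictT _ _).1 => //; exact: measurable_funTS.
- apply: ae_imp neqx _ => y yx _; apply: cvg_near_cst.
  have : 0 < `|y - x| by rewrite normr_gt0 subr_eq0.
  move=> /(cvgr_lt _ c0); apply: filterS => n; rewrite patchE.
  have r0 := rad_gt0 n.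
  case: (ltrgtP x y) => [xy|xy|exy]; last by rewrite exy eqxx in yx.
  + move=> h1.
    by rewrite scaled_step_right ?ltW// mulr1 mem_set//= in_itv /= xy.
  + move=> h1.
    rewrite scaled_step_left; [|by []|by rewrite lerNr opprB ltW].
    by rewrite mulr0 memNset//= in_itv /= andbT; apply/negP; rewrite -leNgt ltW.
- exact: (@integrable_norm _ _ _ mu _ _ ih).
- apply: ae_all => y _ n; rewrite normrM ler_piMr//.
  by have /andP[h1 h2] := step_bound ((rad n)^-1 * (y - x)); rewrite ger0_norm.
Qed.

(** Tested on the difference of two mollified jumps, at [x] and at a fixed Lebesgue point [x0], the
    hypothesis turns in the limit into [g x - g x0] against a difference of tails of [h]. Almost
    every [x] is a Lebesgue point. *)
Lemma du_bois_reymond g h :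
  mu.-integrable setT (EFin \o g) -> mu.-integrable setT (EFin \o h) ->
  (forall phi, test_function phi ->
     \int[mu]_y (g y * derive1 phi y) = - \int[mu]_y (h y * phi y)) ->
  exists c, {ae mu, forall x, g x = c + \int[mu]_(y in `]-oo, x]) h y}.
Proof.
move=> ig ih H.
have mg : measurable_fun setT g by case/integrableP: ig => /measurable_EFinP.
have mh : measurable_fun setT h by case/integrableP: ih => /measurable_EFinP.
have lg : {ae mu, forall x, lebesgue_pt g x}.
  by apply: lebesgue_differentiation; apply: open_integrable_locally => //; exact: openT.
have [x0 lx0] := ae_exists lg.
exists (g x0 - \int[mu]_(y in `]-oo, x0]) h y).
apply: ae_imp lg _ => x lx.
have cs r z : continuous (scaled_step r z).
  by move=> y; exact: is_derive_continuous (is_derive_scaled_step r z y).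
have igt n z : mu.-integrable setT (EFin \o (fun y => g y * scaled_tent (rad n) z y)).
  have ig' := @integrable_norm _ _ _ mu _ _ ig.
  apply: (ae_dominated_integrable measurableT _ (integrableZ (rad n)^-1 measurableT ig')).
    by apply: measurable_funM => //; apply: continuous_measurable_fun; exact: continuous_scaled_tent.
  apply: ae_all => y _; have /andP[h1 h2] := scaled_tent_bound z y (rad_gt0 n).
  by rewrite normrM mulrC ler_pM// ger0_norm.
have ihs n z : mu.-integrable setT (EFin \o (fun y => h y * scaled_step (rad n) z y)).
  have ih' := @integrable_norm _ _ _ mu _ _ ih.
  apply: (ae_dominated_integrable measurableT _ ih').
    by apply: measurable_funM => //; exact: continuous_measurable_fun.
  apply: ae_all => y _; rewrite normrM ler_piMr//.
  by have /andP[h1 h2] := step_bound ((rad n)^-1 * (y - z)); rewrite ger0_norm.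
have E n : \int[mu]_y (g y * scaled_tent (rad n) x y) - \int[mu]_y (g y * scaled_tent (rad n) x0 y)
   = - (\int[mu]_y (h y * scaled_step (rad n) x y) - \int[mu]_y (h y * scaled_step (rad n) x0 y)).
  have r0 := rad_gt0 n.
  (* One jump alone tends to 1 at +oo; the difference of two has compact support. *)
  pose phi y := scaled_step (rad n) x y - scaled_step (rad n) x0 y.
  have dphi (y : R) : is_derive y 1 phi (scaled_tent (rad n) x y - scaled_tent (rad n) x0 y).
    exact: is_deriveB (is_derive_scaled_step _ _ _) (is_derive_scaled_step _ _ _).
  have ephi : derive1 phi = fun y => scaled_tent (rad n) x y - scaled_tent (rad n) x0 y.
    by apply/funext => y; rewrite derive1E; case: (dphi y).
  have tphi : test_function phi.
    split.
    - by move=> y; case: (dphi y).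
    - by rewrite ephi => y; apply: cvgB; exact: continuous_scaled_tent.
    - exists (rad n + `|x| + `|x0|) => y; have := ler_norm x; have := ler_norm x0.
      have := ler_norm (- x); have := ler_norm (- x0); rewrite !normrN => a1 a2 a3 a4.
      rewrite ltr_normr => /orP[b|b].
        by rewrite /phi !scaled_step_right ?subrr//; lra.
      by rewrite /phi !scaled_step_left ?subrr//; lra.
  rewrite -!RintegralB//.
  have -> : \int[mu]_y (g y * scaled_tent (rad n) x y - g y * scaled_tent (rad n) x0 y)
     = \int[mu]_y (g y * derive1 phi y).
    by apply: eq_Rintegral => y _; rewrite ephi mulrBr.
  rewrite H//; congr (- _).
  by apply: eq_Rintegral => y _; rewrite /phi mulrBr.
have c1 : \int[mu]_y (g y * scaled_tent (rad n) x y) -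
    \int[mu]_y (g y * scaled_tent (rad n) x0 y) @[n --> \oo] --> g x - g x0.
  by apply: cvgB; exact: lebesgue_pt_tent.
have c2 : - (\int[mu]_y (h y * scaled_step (rad n) x y) -
    \int[mu]_y (h y * scaled_step (rad n) x0 y)) @[n --> \oo] -->
    - (\int[mu]_(y in `]x, +oo[) h y - \int[mu]_(y in `]x0, +oo[) h y).
  by apply: cvgN; apply: cvgB; exact: cvg_step_tail.
have e3 : g x - g x0 = - (\int[mu]_(y in `]x, +oo[) h y - \int[mu]_(y in `]x0, +oo[) h y).
  apply: (cvg_unique (@Rhausdorff R) c1).
  by rewrite (_ : (fun n => _) = (fun n => - (\int[mu]_y (h y * scaled_step (rad n) x y) -
    \int[mu]_y (h y * scaled_step (rad n) x0 y))))//; apply/funext => n; exact: E.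
have tailE z : \int[mu]_(y in `]z, +oo[) h y = \int[mu]_y h y - \int[mu]_(y in `]-oo, z]) h y.
  by rewrite -Rintegral_tailE// Rintegral_itv_obnd_cbnd//; exact: integrable_subT.
by move: e3; rewrite !tailE; lra.
Qed.

End DuBoisReymond.

Section Representatives.
Context {R : realType}.
Local Notation C := R[i].
Local Notation mu := (@lebesgue_measure R).

(* A divergent real sequence has the junk limit [point]. *)
Lemma measurable_limn (u : nat -> R -> R) : (forall n, measurable_fun setT (u n)) ->
  measurable_fun setT (fun x => limn (u ^~ x)).
Proof.
move=> mu_.
pose E n x := (u n x)%:E.
pose S x := limn_esup (E ^~ x); pose I x := limn_einf (E ^~ x).
have mE n : measurable_fun setT (E n) by exact: measurable_EFinf.
have mS : measurable_fun setT S by exact: measurable_fun_limn_esup.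
have mI : measurable_fun setT I.
  rewrite (_ : I = fun x => (- limn_esup ((fun n x => - E n x) ^~ x))%E) //.
  apply: measurableT_comp => //; apply: measurable_fun_limn_esup => n.
  exact: measurableT_comp.
(* Convergence is the measurable condition that the upper and lower limits agree and are finite. *)
rewrite (_ : (fun x => _) = fun x =>
   if (I x == S x) && (S x \is a fin_num) then fine (S x) else point).
  apply: measurable_fun_ifT.
  - apply: measurable_and; first exact: measurable_fun_eqe.
    apply: (measurable_fun_bool true).
    by have := emeasurable_fin_num measurableT mS; rewrite setTI.
  - exact: measurableT_comp.
  - exact: measurable_cst.
apply/funext => x.
have [cu|ncu] := pselect (cvgn (u ^~ x)).
  have cE : E ^~ x @ \oo --> (limn (u ^~ x))%:E.
    by apply/fine_cvgP; split; [exact: nearW|exact: cu].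
  have [h1 h2] := cvg_limn_einf_sup cE.
  by rewrite /I /S h1 h2 eqxx.
rewrite dvgP//; case: ifPn => // /andP[/eqP IS fS]; exfalso; apply: ncu.
have cE : E ^~ x @ \oo --> (fine (S x))%:E.
  rewrite fineK//.
  apply: (@squeeze_cvge _ _ _ _ (einfs (E ^~ x)) _ (esups (E ^~ x))).
  - apply: nearW => n; apply/andP; split.
      by apply: ereal_inf_lbound; exists n => //=.
    by apply: ereal_sup_ubound; exists n => //=.
  - rewrite -IS /I limn_einf_lim; exact: is_cvg_einfs.
  - rewrite /S limn_esup_lim; exact: is_cvg_esups.
by apply/cvg_ex; exists (fine (S x)); exact: (fine_cvg cE).
Qed.

Lemma continuous_normc (g : R -> C) : ccont g -> continuous (fun x => normc (g x)).
Proof.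
move=> [c1 c2].
rewrite (_ : (fun x => _) = fun x => Num.sqrt (complex.Re (g x) ^+ 2 + complex.Im (g x) ^+ 2)).
  move=> x; apply: (@continuous_comp _ _ _
    (fun x => complex.Re (g x) ^+ 2 + complex.Im (g x) ^+ 2) Num.sqrt); last exact: sqrt_continuous.
  by apply: cvgD; rewrite expr2; apply: cvgM; by [exact: c1|exact: c2].
by apply/funext => x; case: (g x).
Qed.

(** Around a point where [u] is positive there is a whole ball of such points, and a ball has
    positive measure. *)
Lemma ae_le0_continuous (u : R -> R) : continuous u -> {ae mu, forall x, u x <= 0} ->
  forall x, u x <= 0.
Proof.
move=> cu [A [mA A0 uA]] x; rewrite leNgt; apply/negP => ux.
have [r r0 hr] : exists2 r : R, 0 < r & ball x r `<=` A.
  have hn : \forall y \near x, 0 < u y by have := cu x => /cvgr_gt; apply.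
  have [r /= r0 hr] := (nbhs_ballP _ _).1 hn.
  exists r => // y /hr /= uy; apply: uA => /= h.
  by move: uy; rewrite ltNge h.
have : (mu (ball x r) <= mu A)%E.
  by apply: le_measure; rewrite ?inE//; exact: measurable_ball.
have e : mu (ball x r) = (r *+ 2)%:E by exact: lebesgue_measure_ball (ltW r0).
by rewrite A0 e lee_fin leNgt mulrn_wgt0.
Qed.

Lemma ae_eq_continuous (u v : R -> R) : continuous u -> continuous v ->
  {ae mu, forall x, u x = v x} -> forall x, u x = v x.
Proof.
move=> cu cv h x; apply/eqP; rewrite eq_le -(subr_le0 (v x)) -(subr_le0 (u x)).
have ae1 : {ae mu, forall x, u x - v x <= 0} by apply: ae_imp h _ => y ->; rewrite subrr.
have ae2 : {ae mu, forall x, v x - u x <= 0} by apply: ae_imp h _ => y ->; rewrite subrr.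
apply/andP; split.
  apply: (@ae_le0_continuous (fun x => u x - v x)) => // y.
  by apply: cvgB; [exact: cu|exact: cv].
apply: (@ae_le0_continuous (fun x => v x - u x)) => // y.
by apply: cvgB; [exact: cv|exact: cu].
Qed.

Lemma ae_eq_ccont (f g : R -> C) : ccont f -> ccont g ->
  {ae mu, forall x, f x = g x} -> forall x, f x = g x.
Proof.
move=> [c1 c2] [d1 d2] h x; apply: complex_ext.
  apply: (@ae_eq_continuous (fun x => complex.Re (f x)) (fun x => complex.Re (g x))) => //.
  by apply: ae_imp h _ => y ->.
apply: (@ae_eq_continuous (fun x => complex.Im (f x)) (fun x => complex.Im (g x))) => //.
by apply: ae_imp h _ => y ->.
Qed.

Lemma ae_decay_continuous be N (g : R -> C) : ccont g ->
  {ae mu, forall x, normc (g x) <= N * edecay be x} ->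
  forall x, normc (g x) <= N * edecay be x.
Proof.
move=> cg h x; rewrite -subr_le0.
apply: (@ae_le0_continuous (fun x => normc (g x) - N * edecay be x)).
  move=> y; apply: cvgB; first exact: continuous_normc.
  by apply: cvgM; [exact: cvg_cst|exact: continuous_edecay].
by apply: ae_imp h _ => y; rewrite subr_le0.
Qed.

Context (be : R).
Context (be0 : 0 < be).

Lemma decays_integrable N (g : R -> C) : decays be N g -> cintegrable setT g.
Proof.
move=> [mg h]; apply: (cintegrable_dom measurableT mg (integrableZ N measurableT (integrable_edecay be0))).
by apply: ae_imp h _ => x hx _.
Qed.

Lemma ae_decays N (g G : R -> C) : cmeas G -> decays be N g ->
  {ae mu, forall x, g x = G x} -> decays be N G.
Proof. by move=> mG [_ h] e; split => //; apply: ae_imp2 h e _ => x h <-. Qed.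

Lemma decays_locally_integrable N (g : R -> C) : decays be N g -> clocally_integrable g.
Proof.
move=> /decays_integrable[i1 i2]; split; apply: open_integrable_locally => //; exact: openT.
Qed.

Lemma cmeas_test (phi : R -> R) : test_function phi ->
  cmeas (fun x => (phi x)%:C) /\ cmeas (fun x => (derive1 phi x)%:C).
Proof.
move=> [d c _]; split; apply: cmeas_real; apply: continuous_measurable_fun => //.
by move=> x; apply: differentiable_continuous; apply/derivable1_diffP; exact: d.
Qed.

Lemma ae_weak_derivative N1 N2 (g h G H : R -> C) : weak_derivative g h ->
  decays be N1 g -> decays be N2 h -> cmeas G -> cmeas H ->
  {ae mu, forall x, g x = G x} -> {ae mu, forall x, h x = H x} -> weak_derivative G H.
Proof.
move=> [_ _ w] dg dh mG mH gG hH; split.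
- exact: decays_locally_integrable (ae_decays mG dg gG).
- exact: decays_locally_integrable (ae_decays mH dh hH).
move=> phi tphi; have [m1 m2] := cmeas_test tphi.
transitivity (cint setT (fun x => g x * (derive1 phi x)%:C)).
  apply: ae_eq_cint => //; [exact: cmeasM|apply: cmeasM => //; by case: dg|].
  by apply: ae_imp gG _ => x ->.
rewrite w//; congr (- _); apply: ae_eq_cint => //; [apply: cmeasM => //; by case: dh|exact: cmeasM|].
by apply: ae_imp hH _ => x ->.
Qed.

Lemma weak_derivative_primitive N1 N2 (g h : R -> C) : weak_derivative g h ->
  decays be N1 g -> decays be N2 h ->
  exists c, {ae mu, forall x, g x = c + cint `]-oo, x] h}.
Proof.
move=> [_ _ w] dg dh.
have [g1 g2] := decays_integrable dg; have [h1 h2] := decays_integrable dh.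
have Re_real (z : C) (x : R) : complex.Re (z * x%:C) = complex.Re z * x.
  by rewrite ReM /= mulr0 subr0.
have Im_real (z : C) (x : R) : complex.Im (z * x%:C) = complex.Im z * x.
  by rewrite ImM /= mulr0 add0r.
have wRe (phi : R -> R) : test_function phi ->
    \int[mu]_y (complex.Re (g y) * derive1 phi y) = - \int[mu]_y (complex.Re (h y) * phi y).
  move=> tphi; have := congr1 (@complex.Re R) (w phi tphi); rewrite ReN /= => e.
  rewrite (_ : \int[mu]_y (_ * derive1 phi y) = \int[mu]_y complex.Re (g y * (derive1 phi y)%:C)).
    by rewrite e; congr (- _); apply: eq_Rintegral => y _; rewrite Re_real.
  by apply: eq_Rintegral => y _; rewrite Re_real.
have wIm (phi : R -> R) : test_function phi ->
    \int[mu]_y (complex.Im (g y) * derive1 phi y) = - \int[mu]_y (complex.Im (h y) * phi y).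
  move=> tphi; have := congr1 (@complex.Im R) (w phi tphi); rewrite ImN /= => e.
  rewrite (_ : \int[mu]_y (_ * derive1 phi y) = \int[mu]_y complex.Im (g y * (derive1 phi y)%:C)).
    by rewrite e; congr (- _); apply: eq_Rintegral => y _; rewrite Im_real.
  by apply: eq_Rintegral => y _; rewrite Im_real.
have [c1 a1] := du_bois_reymond g1 h1 wRe.
have [c2 a2] := du_bois_reymond g2 h2 wIm.
exists (c1 +i* c2); apply: ae_imp2 a1 a2 _ => x e1 e2.
by apply: complex_ext; rewrite ?ReImE /= ?e1 ?e2.
Qed.

Lemma ccont_head (h : R -> C) : cintegrable setT h -> ccont (fun x => cint `]-oo, x] h).
Proof.
move=> ih; have [h1 h2] := ih.
apply: (@eq_ccont _ (fun x => cint setT h - cint `[x, +oo[ h)).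
  move=> x; apply: complex_ext; rewrite !ReImE /= Rintegral_tailE//; ring.
apply: ccontB; [exact: ccont_cst|exact: ccont_tail].
Qed.

Lemma cdiff_head (h : R -> C) : ccont h -> cintegrable setT h ->
  cdiff (fun x => cint `]-oo, x] h) h.
Proof.
move=> [c1 c2] [h1 h2] x; split => /=.
  exact: is_derive_head h1 (c1 x).
exact: is_derive_head h2 (c2 x).
Qed.

Lemma continuous_representative N1 N2 (g h : R -> C) : weak_derivative g h ->
  decays be N1 g -> decays be N2 h ->
  exists2 G, ccont G & {ae mu, forall x, g x = G x}.
Proof.
move=> w dg dh; have [c hc] := weak_derivative_primitive w dg dh.
exists (fun x => c + cint `]-oo, x] h) => //.
apply: ccontD; [exact: ccont_cst|apply: ccont_head; exact: decays_integrable dh].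
Qed.

(** Two weak derivatives yield one classical derivative: [l] gives [h] a continuous representative,
    and the primitive of that representative is continuously differentiable. *)
Lemma C1_representative N1 N2 N3 (g h l : R -> C) : weak_derivative g h ->
  weak_derivative h l -> decays be N1 g -> decays be N2 h -> decays be N3 l ->
  exists G H, [/\ cdiff G H, ccont H, {ae mu, forall x, g x = G x} &
    {ae mu, forall x, h x = H x}].
Proof.
move=> w1 w2 dg dh dl; have [H cH hH] := continuous_representative w2 dh dl.
have [c hc] := weak_derivative_primitive w1 dg dh.
have mH := ccont_cmeas cH; have iH := decays_integrable (ae_decays mH dh hH).
exists (fun x => c + cint `]-oo, x] H), H; split => //.
  apply: eq_cdiff (cdiffD (cdiff_cst c) (cdiff_head cH iH)) => // x; exact: add0r.
apply: ae_imp hc _ => x ->; congr (_ + _); apply: ae_eq_cint => //; first by case: dh.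
by apply: ae_imp hH _ => y e _.
Qed.

Lemma Linfty_norm_ge0 (g : R -> C) : (0 <= Linfty_norm be g)%E.
Proof.
apply: ess_sup_gee.
  have e : mu setT = +oo%E by rewrite -set_itvNyy lebesgue_measure_itv.
  have f : (0 < mu setT)%E by rewrite e.
  exact: f.
by apply: ae_all => x; rewrite lee_fin mulr_ge0 ?expR_ge0// normc_ge0.
Qed.

Lemma Linfty_norm_decays (g : R -> C) (s : R) : cmeas g -> (Linfty_norm be g <= s%:E)%E ->
  decays be s g.
Proof.
move=> mg hs; split => //.
have := ess_sup_ge mu (fun x => (expR (be * `|x|) * normc (g x))%:E).
move=> h; apply: ae_imp h _ => x /le_trans /(_ hs); rewrite lee_fin.
by rewrite /edecay expRN ler_pdivlMr ?expR_gt0// mulrC.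
Qed.

(** The strict inequality extracts one family of weak derivatives from the infimum; as the norms are
    nonnegative, each of them lies below the same [s]. *)
Lemma sobolev_decays n (g : R -> C) (s : R) : (sobolev_norm n.+1 be g < s%:E)%E ->
  exists G, [/\ G 0%N = g, forall l, (l < n.+1)%N -> weak_derivative (G l) (G l.+1) &
    forall l, (l <= n.+1)%N -> decays be s (G l)].
Proof.
move=> /ereal_inf_lt[t [G [G0 wG ->]] ts].
exists G; split => // l ln; apply: Linfty_norm_decays.
  have cm (f : R -> C) : clocally_integrable f -> cmeas f by move=> [[m1 _ _] [m2 _ _]].
  case: l ln => [_|l ln]; apply: cm; last by have [_ ? _] := wG l ln.
  by have [? _ _] := wG 0%N isT.
apply: le_trans (ltW ts); rewrite (bigD1 (Ordinal (ln : (l < n.+2)%N)))//= leeDl//.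
by apply: sume_ge0 => i _; exact: Linfty_norm_ge0.
Qed.

Lemma sobolev_norm_ge0 n (g : R -> C) : (0 <= sobolev_norm n be g)%E.
Proof.
apply: le_ereal_inf_tmp => _ [G [_ _ ->]].
by apply: sume_ge0 => i _; exact: Linfty_norm_ge0.
Qed.

End Representatives.

(** * Truncated series and continuity of their limits *)

Section SeriesTails.
Context {R : realType}.

(** One numerical series [t] controls the tails at all points: the dependence on the point sits in
    the factor [e], which is later a multiple of [edecay be x]. *)
Lemma dominated_series (u t : nat -> R) (e : R) : 0 <= e -> (forall m, 0 <= t m) ->
  (forall m, `|u m| <= t m * e) -> cvgn (series t) ->
  cvgn (series u) /\
  forall K, `|limn (series u) - series u K| <= (limn (series t) - series t K) * e.
Proof.
move=> e0 t0 ut ct.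
have cu : cvgn (series u).
  apply: normed_cvg; apply: (@series_le_cvg _ _ (fun m => e * t m)) => //.
  - by move=> m; exact: normr_ge0.
  - by move=> m; rewrite mulr_ge0.
  - by move=> m /=; rewrite mulrC; exact: ut.
  - have -> : series (fun m => e * t m) = fun n => e * series t n.
      by apply/funext => n; rewrite /series /= mulr_sumr.
    by apply: is_cvgM => //; exact: is_cvg_cst.
split=> // K.
have c1 : `|series u n - series u K| @[n --> \oo] --> `|limn (series u) - series u K|.
  by apply: cvg_norm; apply: cvgB; [exact: cu|exact: cvg_cst].
apply: (cvgr_to_le c1); near=> n.
have Kn : (K <= n)%N by near: n; exact: nbhs_infty_ge.
rewrite sub_series_geq//.
apply: le_trans (ler_norm_sum _ _ _) _.
apply: (@le_trans _ _ (\sum_(K <= i < n) t i * e)); first exact: ler_sum.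
rewrite -mulr_suml ler_wpM2r// -sub_series_geq// lerD2r.
apply: nondecreasing_cvgn_le => //.
by apply: nondecreasing_series => i _ _; exact: t0.
Unshelve. all: by end_near. Qed.

Lemma uniform_limit_continuous_nat (W : R -> R) (WK : nat -> R -> R) (tau : nat -> R) :
  (forall K, continuous (WK K)) -> (forall K x, `|W x - WK K x| <= tau K) ->
  tau n @[n --> \oo] --> 0 -> continuous W.
Proof.
move=> cW hW ct x; apply/cvgrPdist_le => e e0.
have e3 : 0 < e / 3 by rewrite divr_gt0.
have [K hK] : exists K, tau K <= e / 3.
  have : \forall n \near \oo, tau n <= e / 3 by have := ct => /cvgr_le; apply.
  by move=> [K _ hK]; exists K; exact: (hK K (leqnn K)).
have /cvgrPdist_le /(_ _ e3) h := cW K x.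
near=> y.
have -> : W x - W y = (W x - WK K x) + (WK K x - WK K y) - (W y - WK K y) by ring.
rewrite (le_trans (ler_normB _ _))// (le_trans (lerD (ler_normD _ _) (lexx _)))//.
have h1 := le_trans (hW K x) hK; have h2 := le_trans (hW K y) hK.
have h3 : `|WK K x - WK K y| <= e / 3 by near: y; exact: h.
have -> : e = e / 3 + e / 3 + e / 3 by field.
by rewrite !lerD.
Unshelve. all: by end_near. Qed.

End SeriesTails.

Section ModeRepresentatives.
Context {R : realType}.
Local Notation C := R[i].
Local Notation mu := (@lebesgue_measure R).
Context (be : R).
Context (be0 : 0 < be).

(** [Q] and [D] are representatives of a coefficient and of its derivative, with pointwise bounds,
    while [G2] and [G3] stay weak. The given [q] is retained through measurability and almost
    everywhere equality, for the return to the original potential. *)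
Definition mode_rep (n : R) (q Q D G2 G3 : R -> C) :=
  [/\ cdiff Q D /\ ccont D,
      [/\ weak_derivative Q D, weak_derivative D G2 & weak_derivative G2 G3],
      (forall x, normc (Q x) <= n * edecay be x) /\
      (forall x, normc (D x) <= n * edecay be x),
      decays be n G2 /\ decays be n G3 &
      cmeas q /\ {ae mu, forall x, q x = Q x}].

Lemma mode_rep_exists (q : R -> C) (s : R) : (sobolev_norm 3 be q < s%:E)%E ->
  exists Q D G2 G3, mode_rep s q Q D G2 G3.
Proof.
move=> /sobolev_decays[G [G0 wG dG]].
have d0 := dG 0%N isT; have d1 := dG 1%N isT; have d2 := dG 2%N isT; have d3 := dG 3%N isT.
have w0 := wG 0%N isT; have w1 := wG 1%N isT; have w2 := wG 2%N isT.
rewrite G0 in d0 w0.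
have [Q [D [dQ cD qQ gD]]] := C1_representative be0 w0 w1 d0 d1 d2.
have cQ := cdiff_ccont dQ.
have mQ := ccont_cmeas cQ; have mD := ccont_cmeas cD.
have [m2 _] := d2.
exists Q, D, (G 2%N), (G 3%N); split => //.
- split => //.
    exact: (ae_weak_derivative be0 w0 d0 d1 mQ mD qQ gD).
  apply: (ae_weak_derivative be0 w1 d1 d2 mD m2 gD).
  exact: ae_all.
- split; apply: ae_decay_continuous => //.
    by have [] := ae_decays mQ d0 qQ.
  by have [] := ae_decays mD d1 gD.
- by split => //; case: d0.
Qed.

Lemma real_rep_exists (u : R -> R) (s : R) :
  (sobolev_norm 1 be (fun x => (u x)%:C) < s%:E)%E ->
  exists (v : R -> R) (h : R -> C), [/\ continuous v,
     weak_derivative (fun x => (v x)%:C) h, forall x, `|v x| <= s * edecay be x,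
     decays be s h & measurable_fun setT u /\ {ae mu, forall x, u x = v x}].
Proof.
move=> /sobolev_decays[G [G0 wG dG]].
have d0 := dG 0%N isT; have d1 := dG 1%N isT; have w0 := wG 0%N isT.
rewrite G0 in d0 w0.
have [Q cQ qQ] := continuous_representative be0 w0 d0 d1.
have [cv _] := cQ.
have uv : {ae mu, forall x, u x = complex.Re (Q x)} by apply: ae_imp qQ _ => x <-.
have uvC : {ae mu, forall x, (u x)%:C = (complex.Re (Q x))%:C} by apply: ae_imp uv _ => x ->.
have mv : cmeas (fun x => (complex.Re (Q x))%:C).
  by apply: cmeas_real; exact: continuous_measurable_fun.
exists (fun x => complex.Re (Q x)), (G 1%N); split => //.
- apply: (ae_weak_derivative be0 w0 d0 d1 mv _ uvC); first by case: d1.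
  exact: ae_all.
- move=> x; rewrite -normcR.
  apply: (@ae_decay_continuous R be s (fun x => (complex.Re (Q x))%:C)).
    exact: ccont_real.
  by have [] := ae_decays mv d0 uvC.
- by split => //; case: d0 => [[]].
Qed.

End ModeRepresentatives.

Section Modes.
Context {R : realType}.
Local Notation C := R[i].

(** Indexing by rank and sign keeps the finite set of modes symmetric: it contains the resonant
    partner of each mode, its waves add up to a real function, and its sums are the partial sums in
    [sum_nonzero]. *)
Definition mode (K : nat) (p : 'I_K * bool) : int :=
  if p.2 then Posz p.1.+1 else Negz p.1.

Definition flip (K : nat) (p : 'I_K * bool) : 'I_K * bool := (p.1, ~~ p.2).

Lemma mode_neq0 K (p : 'I_K * bool) : mode p != 0.
Proof. by case: p => m []. Qed.

Lemma mode_flip K (p : 'I_K * bool) : mode (flip p) = - mode p.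
Proof. by case: p => m []; rewrite /mode /= ?NegzE ?opprK. Qed.

Lemma mode_inj K : injective (@mode K).
Proof.
move=> [m b] [m' b']; rewrite /mode /=; case: b; case: b' => //= -[] e.
  by congr (_, _); apply: val_inj.
by congr (_, _); apply: val_inj.
Qed.

Lemma sum_modes (V : nmodType) K (F : int -> V) :
  \sum_(p : 'I_K * bool) F (mode p) = \sum_(0 <= m < K) (F (Posz m.+1) + F (Negz m)).
Proof.
rewrite big_mkord -(pair_bigA _ (fun (m : 'I_K) (b : bool) => F (mode (m, b)))) /=.
by apply: eq_bigr => m _; rewrite big_bool.
Qed.

Lemma esum_modes_le (a : int -> \bar R) K : 
  (\sum_(p : 'I_K * bool) a (mode p) <= \esum_(j in [set j : int | j != 0%R]) a j)%E.
Proof.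
apply: esum_ge; exists [set` [seq mode p | p <- enum {: 'I_K * bool}]].
  split; first exact: finite_seq.
  by move=> j /= /mapP[p _ ->]; exact: mode_neq0.
rewrite -fsbig_seq; last by rewrite map_inj_uniq ?enum_uniq//; exact: mode_inj.
by rewrite big_map big_enum.
Qed.

End Modes.

(** * Summation over all modes *)

Lemma osc_opp {R : realType} (o x : R) : osc (- o) x = (osc o x)^*.
Proof.
have Re_i (u : R) : complex.Re ('i * u%:C) = 0 by rewrite /= !(mul0r, mulr0, subrr).
have Im_i (u : R) : complex.Im ('i * u%:C) = u by rewrite /= !(mul0r, mul1r, add0r).
have Re_conj (z : R[i]) : complex.Re z^* = complex.Re z by case: z.
have Im_conj (z : R[i]) : complex.Im z^* = - complex.Im z by case: z.
apply: complex_ext; rewrite ?Re_conj ?Im_conj /osc ?Re_cexp ?Im_cexp !Re_i !Im_i mulNr.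
  by rewrite cosN.
by rewrite sinN mulrN.
Qed.

Section AllModes.
Context {R : realType}.
Local Notation C := R[i].
Context (theta be al a N : R) (lambda : int -> R) (n : int -> R)
  (Q D1 G2 G3 : int -> R -> C) (qav : R -> R) (qav1 : R -> C).
Context (theta0 : 0 < theta) (al0 : 0 <= al) (ala : al < a) (abe : a < be / 2)
  (N0 : 0 <= N)
  (lambdaN : forall j, j != 0 -> lambda (- j) = - lambda j)
  (lambda_sepd : forall j k, j != 0 -> k != 0 -> j != k -> theta <= `|lambda j - lambda k|)
  (lambda_big : forall j, j != 0 -> theta <= `|lambda j|)
  (QN : forall j x, j != 0 -> Q (- j) x = (Q j x)^*)
  (Qd : forall j, j != 0 -> cdiff (Q j) (D1 j))
  (D1c : forall j, j != 0 -> ccont (D1 j))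
  (wQ : forall j, j != 0 -> weak_derivative (Q j) (D1 j))
  (wD : forall j, j != 0 -> weak_derivative (D1 j) (G2 j))
  (wG : forall j, j != 0 -> weak_derivative (G2 j) (G3 j))
  (bQ : forall j x, j != 0 -> normc (Q j x) <= n j * edecay be x)
  (bD : forall j x, j != 0 -> normc (D1 j x) <= n j * edecay be x)
  (bG2 : forall j, j != 0 -> decays be (n j) (G2 j))
  (bG3 : forall j, j != 0 -> decays be (n j) (G3 j))
  (n0 : forall j, 0 <= n j)
  (nN : forall K, \sum_(p : 'I_K * bool) n (mode p) <= N)
  (wqav : weak_derivative (fun x => (qav x)%:C) qav1)
  (cqav : continuous qav)
  (bqav : forall x, `|qav x| <= N * edecay be x)
  (bqav1 : decays be N qav1).

Definition pair_weight m := n (Posz m.+1) + n (Negz m).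

Lemma series_pair_weight K :
  series pair_weight K = \sum_(p : 'I_K * bool) n (mode p).
Proof. by rewrite sum_modes /series /=. Qed.

Lemma pair_weight_ge0 m : 0 <= pair_weight m.
Proof. by rewrite addr_ge0. Qed.

Lemma cvg_pair_weight : cvgn (series pair_weight).
Proof.
apply: nondecreasing_is_cvgn.
  by apply: nondecreasing_series => i _ _; exact: pair_weight_ge0.
by exists N => _ [K _ <-]; rewrite series_pair_weight.
Qed.

(** It bounds the truncation error of the oscillating series and, up to a constant, that of the
    effective well, at every [x] and for every [eps]. *)
Definition weight_tail K := limn (series pair_weight) - series pair_weight K.

Lemma weight_tail_ge0 K : 0 <= weight_tail K.
Proof.
rewrite subr_ge0; apply: nondecreasing_cvgn_le; last exact: cvg_pair_weight.
by apply: nondecreasing_series => i _ _; exact: pair_weight_ge0.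
Qed.

Lemma cvg_weight_tail : weight_tail K @[K --> \oo] --> 0.
Proof.
rewrite -(subrr (limn (series pair_weight))).
by apply: cvgB; [exact: cvg_cst|exact: cvg_pair_weight].
Qed.

Lemma weight_tail0 : weight_tail 0 <= N.
Proof.
rewrite /weight_tail [X in _ - X]/series /= big_nil subr0.
apply: limr_le; first exact: cvg_pair_weight.
by apply: nearW => K; rewrite series_pair_weight.
Qed.

Lemma mode_weight_le m : n (Posz m.+1) <= N /\ n (Negz m) <= N.
Proof.
have h : pair_weight m <= N.
  apply: le_trans (nN m.+1); rewrite -series_pair_weight /series /= big_nat_recr//=.
  by rewrite lerDr sumr_ge0// => i _; exact: pair_weight_ge0.
by split; apply: le_trans h; rewrite ?lerDl ?lerDr.
Qed.

Let edecay_ge0 x : 0 <= edecay be x.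
Proof. exact: expR_ge0. Qed.

Let be0 : 0 < be.
Proof. have h1 := al0; have h2 := ala; have h3 := abe. lra. Qed.

(** The real part suffices: in a symmetric sum the modes [j] and [- j] are conjugate, so the
    imaginary parts cancel. *)
Definition wave eps x j := complex.Re (Q j x * osc (2 * pi * lambda j / eps) x).
Definition well x j := normc (Q j x) ^+ 2 / lambda j ^+ 2.

Lemma wave_le eps x j : j != 0 -> `|wave eps x j| <= n j * edecay be x.
Proof.
move=> j0; apply: le_trans (normc_ge_Re _) _.
by rewrite normcM normc_osc mulr1; exact: bQ.
Qed.

Lemma well_ge0 x j : 0 <= well x j.
Proof. by rewrite divr_ge0 ?sqr_ge0. Qed.

Lemma well_le x j : j != 0 -> n j <= N ->
  `|well x j| <= n j * (N / theta ^+ 2 * edecay be x).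
Proof.
move=> j0 hj; rewrite ger0_norm ?well_ge0 //.
have h : normc (Q j x) ^+ 2 <= n j * N * edecay be x.
  have e1 := edecay_le1 x (ltW be0).
  have := bQ x j0; have q0 := normc_ge0 (Q j x).
  have nj := n0 j; have e0 := edecay_ge0 x => hq.
  apply: (@le_trans _ _ (n j * edecay be x * N)); last by rewrite le_eqVlt; apply/orP; left; apply/eqP; ring.
  rewrite expr2; apply: ler_pM => //.
  apply: le_trans hq _; apply: le_trans hj.
  by rewrite ler_piMr.
rewrite /well.
have l2 : theta ^+ 2 <= lambda j ^+ 2.
  rewrite -(real_normK (num_real (lambda j))) lerXn2r ?nnegrE ?(ltW theta0)//.
  exact: lambda_big.
have t2 : 0 < theta ^+ 2 by rewrite exprn_gt0.
apply: (@le_trans _ _ (n j * N * edecay be x / theta ^+ 2)).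
  apply: ler_pM => //; first by rewrite sqr_ge0.
    by rewrite invr_ge0 sqr_ge0.
  by rewrite lef_pV2 ?posrE// (lt_le_trans t2).
by rewrite le_eqVlt; apply/orP; left; apply/eqP; ring.
Qed.

Definition pairs (f : int -> R) m := f (Posz m.+1) + f (Negz m).

Lemma sum_nonzeroE f : sum_nonzero f = limn (series (pairs f)).
Proof. by []. Qed.

Lemma wave_sum eps x : cvgn (series (pairs (wave eps x))) /\
  forall K, `|sum_nonzero (wave eps x) - series (pairs (wave eps x)) K|
    <= weight_tail K * edecay be x.
Proof.
rewrite sum_nonzeroE.
apply: dominated_series => //; [exact: pair_weight_ge0| |exact: cvg_pair_weight].
by move=> m; rewrite mulrDl; apply: le_trans (ler_normD _ _) _; rewrite lerD// wave_le.
Qed.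

Lemma well_sum x : cvgn (series (pairs (well x))) /\
  forall K, `|sum_nonzero (well x) - series (pairs (well x)) K|
    <= weight_tail K * (N / theta ^+ 2 * edecay be x).
Proof.
rewrite sum_nonzeroE.
apply: dominated_series => //; [|exact: pair_weight_ge0| |exact: cvg_pair_weight].
  by rewrite mulr_ge0// divr_ge0// sqr_ge0.
move=> m; have [h1 h2] := mode_weight_le m.
by rewrite mulrDl; apply: le_trans (ler_normD _ _) _; rewrite lerD// well_le.
Qed.

Let U2 eps x := qav x + sum_nonzero (wave eps x).
Let U1 eps x := qav x - eps ^+ 2 * (((2 * pi) ^+ 2)^-1 * sum_nonzero (well x)).

Lemma continuous_series_pairs (f : R -> int -> R) K :
  (forall j, j != 0 -> continuous (fun x => f x j)) ->
  continuous (fun x => series (pairs (f x)) K).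
Proof.
move=> cf; rewrite /series /=.
elim: K => [|K IH].
  under eq_fun do rewrite big_nil.
  by move=> x; exact: cvg_cst.
under eq_fun do rewrite big_nat_recr//=.
by move=> x; apply: cvgD; [exact: IH|apply: cvgD; exact: cf].
Qed.

Lemma continuous_wave eps j : j != 0 -> continuous (fun x => wave eps x j).
Proof.
by move=> j0; exact: (ccontM (cdiff_ccont (Qd j0)) (ccont_osc _)).1.
Qed.

Lemma continuous_well j : j != 0 -> continuous (fun x => well x j).
Proof.
move=> j0 x; rewrite /well; apply: cvgMr_tmp.
have h := continuous_normc (cdiff_ccont (Qd j0)).
by apply: (@cvgM _ _ _ _ (fun y => normc (Q j y)) (fun y => normc (Q j y))); exact: h.
Qed.

Lemma continuous_U2 eps : continuous (U2 eps).
Proof.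
move=> x; apply: cvgD; first exact: cqav.
apply: (@uniform_limit_continuous_nat _ _ (fun K x => series (pairs (wave eps x)) K) weight_tail).
- by move=> K; apply: continuous_series_pairs => j; exact: continuous_wave.
- move=> K y; apply: le_trans ((wave_sum eps y).2 K) _.
  by rewrite ler_piMr ?weight_tail_ge0// edecay_le1// ltW.
- exact: cvg_weight_tail.
Qed.

Lemma continuous_U1 eps : continuous (U1 eps).
Proof.
move=> x; apply: cvgB; first exact: cqav.
apply: cvgMl_tmp; apply: cvgMl_tmp.
apply: (@uniform_limit_continuous_nat _ _ (fun K x => series (pairs (well x)) K)
  (fun K => weight_tail K * (N / theta ^+ 2))).
- by move=> K; apply: continuous_series_pairs => j; exact: continuous_well.
- move=> K y; apply: le_trans ((well_sum y).2 K) _.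
  rewrite mulrA ler_piMr ?(edecay_le1 _ (ltW be0))//.
  by rewrite mulr_ge0 ?weight_tail_ge0// divr_ge0 ?sqr_ge0.
- rewrite -(mul0r (N / theta ^+ 2)).
  by apply: cvgMr_tmp; exact: cvg_weight_tail.
Qed.

(** [2 * N] covers [qav] and the waves, and [N * (N / theta ^+ 2)] the well, whose prefactor is at
    most 1 when [eps <= 1]. The final 1 gives the strict positivity that the Volterra estimates ask
    of [M]. *)
Definition potential_bound := 2 * N + N * (N / theta ^+ 2) + 1.

Lemma potential_bound_gt0 : 0 < potential_bound.
Proof.
by rewrite ltr_wpDl// addr_ge0// mulr_ge0// divr_ge0// sqr_ge0.
Qed.

Lemma U2_le eps x : `|U2 eps x| <= potential_bound * edecay be x.
Proof.
have h := (wave_sum eps x).2 0.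
rewrite [X in _ - X]/series /= big_nil subr0 in h.
apply: le_trans (ler_normD _ _) _.
have h' := le_trans h (ler_wpM2r (edecay_ge0 x) weight_tail0).
apply: le_trans (lerD (bqav x) h') _; rewrite -mulrDl ler_wpM2r//.
rewrite /potential_bound.
have : 0 <= N * (N / theta ^+ 2) by rewrite mulr_ge0// divr_ge0// sqr_ge0.
lra.
Qed.

Let inv_sqr_2pi_le1 : 0 <= ((2 * pi : R) ^+ 2)^-1 <= 1.
Proof.
have p2 := pi_ge2 R.
rewrite invr_ge0 sqr_ge0 /= invf_le1; last by rewrite exprn_gt0// mulr_gt0// pi_gt0.
rewrite exprn_ege1//; move: p2; move: (pi : R) => P; lra.
Qed.

Let scale_well (eps w c : R) : 0 < eps -> eps <= 1 -> `|w| <= c ->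
  `|eps ^+ 2 * (((2 * pi) ^+ 2)^-1 * w)| <= c.
Proof.
move=> e0 e1 wc; have /andP[p0 p1] := inv_sqr_2pi_le1.
rewrite mulrA normrM; apply: le_trans wc; rewrite ler_piMl// (normrM (eps ^+ 2)).
rewrite (ger0_norm (sqr_ge0 eps)) (ger0_norm p0).
by rewrite mulr_ile1 ?sqr_ge0// exprn_ile1// ltW.
Qed.

Lemma U1_le eps x : 0 < eps -> eps <= 1 -> `|U1 eps x| <= potential_bound * edecay be x.
Proof.
move=> e0 e1; have h := (well_sum x).2 0.
rewrite [X in _ - X]/series /= big_nil subr0 in h.
apply: le_trans (ler_normB _ _) _.
have c0 : 0 <= N / theta ^+ 2 by rewrite divr_ge0// sqr_ge0.
have h' := le_trans h (ler_wpM2r (mulr_ge0 c0 (edecay_ge0 x)) weight_tail0).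
apply: le_trans (lerD (bqav x) (scale_well e0 e1 h')) _; rewrite mulrA -mulrDl ler_wpM2r//.
rewrite /potential_bound; have := N0; lra.
Qed.

Lemma Im_sum_osc eps K x :
  complex.Im (\sum_(p : 'I_K * bool) Q (mode p) x *
    osc (om eps (fun p => lambda (mode p)) p) x) = 0.
Proof.
rewrite (big_morph _ (@ImD R) (erefl _)).
rewrite (sum_modes K (fun j => complex.Im (Q j x * osc (2 * pi * lambda j / eps) x))).
apply: big1 => m _; have j0 : Posz m.+1 != 0 by [].
have -> : Negz m = - Posz m.+1 by [].
rewrite (QN _ j0) (lambdaN j0).
have -> : 2 * pi * - lambda (Posz m.+1) / eps = - (2 * pi * lambda (Posz m.+1) / eps).
  by move: (pi : R) => P; ring.
rewrite osc_opp -rmorphM; case: (Q _ x * osc _ x) => u v /=; exact: subrr.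
Qed.

(** At fixed [eps] the finite estimate is used for the modes with |j| <= K, with
    [tau = b * weight_tail K], and then [K] goes to infinity. The potentials themselves are not
    truncated; the remaining modes sit in [r1] and [r2]. *)
Lemma wronskian_estimate kappa eps (k : C) : 0 < eps -> eps <= 1 ->
  `|complex.Im k| <= al -> normc k <= kappa ->
  normc (jost_wronskian (U2 eps) k - jost_wronskian (U1 eps) k) <=
  core_const al a be potential_bound kappa theta N * eps ^+ 3.
Proof.
move=> e0 e1 hk hkap.
set c := core_const _ _ _ _ _ _ _.
(* Large enough for both remainders: up to [edecay be x], [r2] is bounded by the tail and [r1] by
   [N / theta ^+ 2] times the tail. *)
set b := 1 + N / theta ^+ 2.
have c0 : 0 <= N / theta ^+ 2 by rewrite divr_ge0// sqr_ge0.
have cv : c * (eps ^+ 3 + b * weight_tail K) @[K --> \oo] --> c * eps ^+ 3.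
  rewrite -[in X in _ --> X](addr0 (eps ^+ 3)) -[in X in _ --> X](mulr0 b).
  apply: cvgMl_tmp; apply: cvgD; first exact: cvg_cst.
  by apply: cvgMl_tmp; exact: cvg_weight_tail.
apply: (cvgr_to_ge cv); apply: nearW => K.
pose lam (p : 'I_K * bool) := lambda (mode p).
have m0 (p : 'I_K * bool) := mode_neq0 p.
pose r2 x := sum_nonzero (wave eps x) - series (pairs (wave eps x)) K.
pose r1 x := - (eps ^+ 2 * (((2 * pi) ^+ 2)^-1 *
  (sum_nonzero (well x) - series (pairs (well x)) K))).
apply: (@core_estimate _ al a be potential_bound kappa theta eps (b * weight_tail K) N k
  hk ala abe potential_bound_gt0 hkap theta0 e0 e1 _ N0 _ (@flip K) lam (n \o @mode K)
  (Q \o @mode K) (D1 \o @mode K) (G2 \o @mode K) (G3 \o @mode K)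
  _ _ _ _ _ _ _ _ _ _ _ _ _ _ _ qav qav1 wqav cqav bqav bqav1 (U1 eps) (U2 eps) r1 r2) => //=.
- by rewrite mulr_ge0 ?weight_tail_ge0// addr_ge0.
- by move=> p; rewrite /lam mode_flip lambdaN.
- by move=> p; exact: lambda_big.
(* The sum of the two frequencies is the frequency of [l] minus that of [flip p], so the separation
   hypothesis applies as soon as [l] is not the partner of [p]. *)
- move=> p l lp; rewrite /lam -[lambda (mode p)]opprK -lambdaN// -mode_flip addrC.
  apply: lambda_sepd => //.
  by apply: contra_neq lp => /mode_inj.
- by move=> p x; rewrite mode_flip QN.
- by move=> p; exact: Qd.
- by move=> p; exact: D1c.
- by move=> p; exact: wQ.
- by move=> p; exact: wD.
- by move=> p; exact: wG.
- by move=> p x; exact: bQ.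
- by move=> p x; exact: bD.
- by move=> p; exact: bG2.
- by move=> p; exact: bG3.
- exact: nN.
- exact: continuous_U1.
- exact: continuous_U2.
- by move=> x; exact: U1_le.
- by move=> x; exact: U2_le.
- move=> x; rewrite normrN; apply: scale_well => //.
  apply: le_trans ((well_sum x).2 K) _.
  rewrite mulrA ler_wpM2r// [leLHS]mulrC ler_wpM2r ?weight_tail_ge0//.
  by rewrite /b lerDr.
- move=> x; apply: le_trans ((wave_sum eps x).2 K) _.
  by rewrite ler_wpM2r// ler_peMl ?weight_tail_ge0// /b lerDl.
- move=> x; rewrite /U1 /r1 /Lam /=.
  rewrite (sum_modes K (fun j => well x j)).
  rewrite /series /pairs /=; move: (sum_nonzero _) (bigop _ _ _) => s s'.
  move: (_ ^-1) => P; ring.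
- move=> x; apply: complex_ext.
    rewrite !ReD /= (big_morph _ (@ReD R) (erefl _)).
    rewrite (sum_modes K (fun j => wave eps x j)) /U2 /r2 /series /pairs /=.
    by rewrite -addrA; congr (_ + _); rewrite subrKC.
  by rewrite !ImD /= Im_sum_osc !addr0.
Qed.

Lemma potentials_estimate eps : 0 < eps -> eps <= 1 ->
  [/\ continuous (U1 eps), continuous (U2 eps),
      forall x, `|U1 eps x| <= potential_bound * edecay be x,
      forall x, `|U2 eps x| <= potential_bound * edecay be x &
      forall kappa (k : C), `|complex.Im k| <= al -> normc k <= kappa ->
        normc (jost_wronskian (U2 eps) k - jost_wronskian (U1 eps) k) <=
        core_const al a be potential_bound kappa theta N * eps ^+ 3].
Proof.
move=> e0 e1; split; [exact: continuous_U1|exact: continuous_U2| | |].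
- by move=> x; exact: U1_le.
- by move=> x; exact: U2_le.
- by move=> kappa k; exact: wronskian_estimate.
Qed.

End AllModes.

(** * Compactness, null sets and the return to the given potentials *)

Section CompactSup.
Context {R : realType}.
Local Notation C := R[i].

Lemma normc_continuous : continuous (fun z : C^o => normc z).
Proof.
move=> z; apply/(@cvgrPdist_lt _ _ _ _ (nbhs_filter (z : C^o))) => e e0.
have e0' : (0 : C) < e%:C by rewrite ltcR.
apply/nbhs_ballP; exists (e%:C : C) => //= w; rewrite /ball /= => zw.
apply: le_lt_trans (ler_normc_sub _ _) _.
by move: zw; rewrite normc_def ltcR; case: (z - w).
Qed.

(** The supremum on which the final constant depends bounds each modulus once the set of moduli is
    known to be bounded; this comes from compactness. *)
Lemma compact_normc_le_sup (K : set C) k : @compact C^o K -> K k ->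
  normc k <= sup [set normc z | z in K].
Proof.
move=> cK Kk; apply: ub_le_sup; last by exists k.
have : compact [set normc z | z in K].
  by apply: (@continuous_compact C^o R) cK; apply: continuous_subspaceT; exact: normc_continuous.
move=> /compact_bounded[M [_ hM]]; exists (M + 1) => _ [z Kz <-].
apply: le_trans (ler_norm _) _; apply: (hM (M + 1)); first by rewrite ltrDl.
by exists z.
Qed.

End CompactSup.

Section SumNonzero.
Context {R : realType}.

Lemma eq_sum_nonzero (a b : int -> R) : (forall j, j != 0 -> a j = b j) ->
  sum_nonzero a = sum_nonzero b.
Proof.
by move=> ab; rewrite /sum_nonzero; congr (limn (series _)); apply/funext => m; rewrite !ab.
Qed.

(** The given coefficients may produce a divergent series on a null set, where [limn] takes a
    default value; measurability has to cover those points too. *)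
Lemma measurable_sum_nonzero (f : R -> int -> R) :
  (forall j, j != 0 -> measurable_fun setT (fun x => f x j)) ->
  measurable_fun setT (fun x => sum_nonzero (f x)).
Proof.
move=> mf.
apply: (@measurable_limn _ (fun K x => series (fun m => f x (Posz m.+1) + f x (Negz m)) K)) => K.
rewrite /series /=; apply: measurable_sum => m.
by apply: measurable_funD; exact: mf.
Qed.

Lemma ae_nonzero (P : int -> R -> Prop) :
  (forall j, j != 0 -> {ae @lebesgue_measure R, forall x, P j x}) ->
  {ae @lebesgue_measure R, forall x, forall j, j != 0 -> P j x}.
Proof.
move=> h.
have hp : {ae @lebesgue_measure R, forall x, forall m, P (Posz m.+1) x}.
  by apply: ae_foralln => m; exact: h.
have hn : {ae @lebesgue_measure R, forall x, forall m, P (Negz m) x}.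
  by apply: ae_foralln => m; exact: h.
by apply: (ae_imp2 hp hn) => x h1 h2 [[|m]|m].
Qed.

End SumNonzero.

Section Representation.
Context {R : realType}.
Local Notation C := R[i].
Local Notation mu := (@lebesgue_measure R).

Lemma jost_wronskian_ae (al a be M : R) (k : C) (U V : R -> R) :
  `|complex.Im k| <= al -> al < a -> a < be / 2 -> 0 < M ->
  continuous U -> (forall x, `|U x| <= M * edecay be x) ->
  measurable_fun setT V -> {ae mu, forall x, U x = V x} ->
  jost_wronskian U k = jost_wronskian V k.
Proof.
move=> hk ala abe M0 cU bU mV UV.
have mU : measurable_fun setT U by exact: continuous_measurable_fun.
rewrite /jost_wronskian (jost_plus_ae hk ala abe M0 mU mV (ae_all bU) UV).
by rewrite (jost_minus_ae hk ala abe M0 mU mV (ae_all bU) UV).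
Qed.

Lemma sum_half_powers K : \sum_(p : 'I_K * bool) (2^-1 : R) ^+ `|mode p| <= 2.
Proof.
rewrite (sum_modes K (fun j => (2^-1 : R) ^+ `|j|)) /=.
suff -> : \sum_(0 <= m < K) ((2^-1 : R) ^+ m.+1 + 2^-1 ^+ m.+1) = 2 - 2 * 2^-1 ^+ K.
  by rewrite lerBlDr lerDl mulr_ge0// exprn_ge0.
elim: K => [|K IH]; first by rewrite big_nil expr0; ring.
rewrite big_nat_recr//= IH exprS; by field.
Qed.

(** The weights [n j] exceed the Sobolev norms strictly, as the extraction of weak derivatives
    requires. The slack, a power of 1/2 with exponent |j|, sums to at most 2 over the nonzero [j],
    whence the shift of [N_norm] by 2. *)
Lemma sobolev_mode_lt (be : R) (qav : R -> R) (q : int -> R -> C) :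
  (N_norm be qav q < +oo)%E -> exists n : int -> R,
  [/\ forall j, 0 <= n j,
      forall j, j != 0 -> (sobolev_norm 3 be (q j) < (n j)%:E)%E,
      forall K, \sum_(p : 'I_K * bool) n (mode p) <= fine (N_norm be qav q) + 2,
      0 <= fine (N_norm be qav q) &
      (sobolev_norm 1 be (fun x => (qav x)%:C) < (fine (N_norm be qav q) + 2)%:E)%E].
Proof.
move=> Nfin; set N := N_norm _ _ _ in Nfin *.
pose s j := sobolev_norm 3 be (q j).
have s0 j : (0 <= s j)%E := sobolev_norm_ge0 _ _ _.
have a0 := sobolev_norm_ge0 be 1 (fun x => (qav x)%:C).
have b0 : (0 <= \esum_(j in [set j : int | j != 0%R]) s j)%E by exact: esum_ge0.
have aN : (sobolev_norm 1 be (fun x => (qav x)%:C) <= N)%E by rewrite /N /N_norm leeDl.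
have bN : (\esum_(j in [set j : int | j != 0%R]) s j <= N)%E by rewrite /N /N_norm leeDr.
have N0 : (0 <= N)%E by exact: le_trans aN.
have NE : N = (fine N)%:E by rewrite fineK// ge0_fin_numE.
have sN j : j != 0 -> (s j <= N)%E.
  move=> j0; apply: le_trans bN; apply: esum_ge; exists [set j].
    by split=> // i ->.
  by rewrite fsbig_set1.
have sfin j : j != 0 -> s j \is a fin_num.
  by move=> j0; rewrite ge0_fin_numE//; exact: le_lt_trans (sN j j0) Nfin.
exists (fun j => fine (s j) + 2^-1 ^+ `|j|); split.
- by move=> j; rewrite addr_ge0 ?fine_ge0 ?exprn_ge0.
- by move=> j j0; rewrite -/(s j) EFinD fineK ?sfin// lteDl ?sfin// lte_fin exprn_gt0.
- move=> K; rewrite big_split/= lerD ?sum_half_powers//.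
  rewrite -lee_fin -NE -sumEFin; apply: le_trans bN; apply: le_trans (esum_modes_le s K).
  by apply: lee_sum => p _; rewrite fineK// sfin// mode_neq0.
- exact: fine_ge0.
- by apply: le_lt_trans aN _; rewrite EFinD -NE lteDl ?lte_fin// NE.
Qed.

End Representation.

Section Estimate.
Context {R : realType}.
Local Notation C := R[i].
Local Notation mu := (@lebesgue_measure R).

Lemma ccont_conj (f : R -> C) : ccont f -> ccont (fun x => (f x)^*).
Proof.
move=> [c1 c2]; split.
  suff -> : (fun x => complex.Re (f x)^*) = (fun x => complex.Re (f x)) by [].
  by apply/funext => x; case: (f x).
suff -> : (fun x => complex.Im (f x)^*) = (fun x => - complex.Im (f x)).
  by move=> x; apply: cvgN; exact: c2.
by apply/funext => x; case: (f x).
Qed.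

Lemma wave_arg (eps lam x : R) : 2 * pi * lam / eps * x = 2 * pi * lam * (x / eps).
Proof. by move: (pi : R) => P; ring. Qed.

Lemma normc_inv_2i : normc ('i *+ 2 : C)^-1 <= 1.
Proof.
have i2 : normc ('i *+ 2 : C) = 2 by rewrite normcMn normc_i.
have : normc ('i *+ 2 : C) * normc ('i *+ 2 : C)^-1 = 1.
  by rewrite -(normcM ('i *+ 2)) divff ?normc1// two_i_neq0.
by rewrite i2; move: (normc _^-1) => y; lra.
Qed.

(** The estimate is proved for the representatives and carried back: outside one null set all
    coefficients agree with them at once, so the potentials agree almost everywhere and their Jost
    Wronskians coincide. *)
Lemma scattering_estimate (theta be al a : R) (V : R -> R -> R) (qav : R -> R)
    (q : int -> R -> C) (lambda : int -> R) :
  0 < theta -> 0 < al -> al < a -> a < be / 2 -> hypotheses_V theta be V qav q lambda ->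
  forall kappa eps (k : C), 0 < eps -> eps <= 1 -> `|complex.Im k| <= al -> normc k <= kappa ->
  forall N, N = fine (N_norm be qav q) + 2 ->
  normc (jost_wronskian (fun x => V x (x / eps)) k
         - jost_wronskian (fun x => qav x + sigma_eff q lambda eps x) k) <=
  core_const al a be (potential_bound theta N) kappa theta N * eps ^+ 3.
Proof.
move=> theta0 al0 ala abe hV kappa eps k e0 e1 hk hkap N NE.
have be0 : 0 < be by move: al0 ala abe; clear; lra.
have [n [n0 sn nN fN av]] := sobolev_mode_lt (N_norm_fin hV).
rewrite -NE in nN av.
have N0 : 0 <= N by rewrite NE addr_ge0.
have [v [h [cv wv bv bh [mqav qavE]]]] := real_rep_exists be0 av.
pose rep j (T : (R -> C) * (R -> C) * (R -> C) * (R -> C)) :=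
  j != 0 -> mode_rep be (n j) (q j) T.1.1.1 T.1.1.2 T.1.2 T.2.
(* Representatives are chosen for all [j] at once; the index 0 receives zero functions about which
   nothing is claimed. *)
have [T hT] : {T & forall j, rep j (T j)}.
  apply: choice => j; rewrite /rep; have [->|j0] := eqVneq j 0; first by exists (cst 0, cst 0, cst 0, cst 0).
  have [Q [D [G2 [G3 H]]]] := mode_rep_exists be0 (sn j j0).
  by exists (Q, D, G2, G3).
pose Q j := (T j).1.1.1; pose D j := (T j).1.1.2.
pose G2 j := (T j).1.2; pose G3 j := (T j).2.
have qQ : {ae mu, forall x, forall j, j != 0 -> q j x = Q j x}.
  by apply: ae_nonzero => j j0; have [_ _ _ _ []] := hT j j0.
have mq j : j != 0 -> cmeas (q j) by move=> j0; have [_ _ _ _ []] := hT j j0.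
have QN j x : j != 0 -> Q (- j) x = (Q j x)^*.
  move=> j0; have Nj0 : - j != 0 by rewrite oppr_eq0.
  (* The conjugation symmetry passes from [q] almost everywhere and then holds everywhere by
     continuity. *)
  apply: (ae_eq_ccont (f := Q (- j)) (g := fun x => (Q j x)^*)).
  - by have [[/cdiff_ccont]] := hT _ Nj0.
  - by apply: ccont_conj; have [[/cdiff_ccont]] := hT _ j0.
  - by apply: (ae_imp qQ) => y hy; rewrite -!hy// (q_conj hV).
have est := @potentials_estimate R theta be al a N lambda n Q D G2 G3 v h theta0 (ltW al0) ala abe
  N0 (lambda_opp hV) (lambda_sep hV) (lambda_ge hV) QN.
have /est {est}est : forall j, j != 0 -> cdiff (Q j) (D j).
  by move=> j j0; have [[]] := hT j j0.
have /est {est}est : forall j, j != 0 -> ccont (D j).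
  by move=> j j0; have [[]] := hT j j0.
have /est {est}est : forall j, j != 0 -> weak_derivative (Q j) (D j).
  by move=> j j0; have [_ [? ? ?]] := hT j j0.
have /est {est}est : forall j, j != 0 -> weak_derivative (D j) (G2 j).
  by move=> j j0; have [_ [? ? ?]] := hT j j0.
have /est {est}est : forall j, j != 0 -> weak_derivative (G2 j) (G3 j).
  by move=> j j0; have [_ [? ? ?]] := hT j j0.
have bQ j x : j != 0 -> normc (Q j x) <= n j * edecay be x.
  by move=> j0; have [_ _ [+ _] _ _] := hT j j0; exact.
have /est {est}est := bQ.
have /est {est}est : forall j x, j != 0 -> normc (D j x) <= n j * edecay be x.
  by move=> j x j0; have [_ _ [_ +] _ _] := hT j j0; exact.
have /est {est}est : forall j, j != 0 -> decays be (n j) (G2 j).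
  by move=> j j0; have [_ _ _ [? ?] _] := hT j j0.
have /est {est}est : forall j, j != 0 -> decays be (n j) (G3 j).
  by move=> j j0; have [_ _ _ [? ?] _] := hT j j0.
pose U1 x := v x - eps ^+ 2 * (((2 * pi) ^+ 2)^-1 * sum_nonzero (well lambda Q x)).
pose U2 x := v x + sum_nonzero (wave lambda Q eps x).
have [cU1 cU2 bU1 bU2 {}est] := est n0 nN wv cv bv bh eps e0 e1.
have M0 : 0 < potential_bound theta N by exact: potential_bound_gt0.
(* The expansion of [V] is an identity between complex numbers; its real part turns the complex
   series into the sum of [wave]. *)
have VE x : V x (x / eps) = qav x + sum_nonzero (wave lambda q eps x).
  have /(congr1 (@complex.Re R)) := V_expansion hV x (x / eps).
  rewrite ReD /= => ->; congr (_ + _); apply: eq_sum_nonzero => j _.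
  by rewrite /wave /osc wave_arg.
have w2 : jost_wronskian U2 k = jost_wronskian (fun x => V x (x / eps)) k.
  apply: (jost_wronskian_ae hk ala abe M0 cU2 bU2).
    under eq_fun do rewrite VE.
    apply: measurable_funD mqav _; apply: measurable_sum_nonzero => j j0.
    exact: (cmeasM (mq j j0) (ccont_cmeas (ccont_osc _))).1.
  apply: (ae_imp2 qavE qQ) => x h1 h2; rewrite VE h1 /U2; congr (_ + _).
  by apply: eq_sum_nonzero => j j0; rewrite /wave h2.
have w1 : jost_wronskian U1 k =
    jost_wronskian (fun x => qav x + sigma_eff q lambda eps x) k.
  have SE x : qav x + sigma_eff q lambda eps x =
      qav x - eps ^+ 2 * (((2 * pi) ^+ 2)^-1 * sum_nonzero (well lambda q x)).
    by rewrite /sigma_eff mulNr.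
  apply: (jost_wronskian_ae hk ala abe M0 cU1 bU1).
    under eq_fun do rewrite SE.
    apply: measurable_funB mqav _.
    apply: measurable_funM; first exact: measurable_cst.
    apply: measurable_funM; first exact: measurable_cst.
    apply: measurable_sum_nonzero => j j0; apply: measurable_funM; last exact: measurable_cst.
    under eq_fun do rewrite normc_sqr.
    have [m1 m2] := mq j j0.
    by apply: measurable_funD; exact: measurable_funX.
  apply: (ae_imp2 qavE qQ) => x h1 h2; rewrite SE h1 /U1; congr (_ - _ * (_ * _)).
  by apply: eq_sum_nonzero => j j0; rewrite /well h2.
by rewrite -w1 -w2; exact: est.
Qed.

End Estimate.

Unset Implicit Arguments.
Set Strict Implicit.
Set Printing Implicit Defensive.

Theorem theorem3p3 (R : realType) (theta beta alpha : R) :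
  0 < theta -> 0 < beta -> 0 < alpha -> alpha < beta / 2 ->
  exists C : R -> R -> R, (forall N kappa, 0 < C N kappa) /\
  forall (V : R -> R -> R) (qav : R -> R) (q : int -> R -> R[i])
         (lambda : int -> R) (K : set R[i]),
    hypotheses_V theta beta V qav q lambda ->
    hypotheses_K alpha qav K ->
    exists eps0 : R, 0 < eps0 /\
    forall eps : R, 0 < eps -> eps < eps0 ->
      (ereal_sup
         [set (normc
                 (k_over_transmission (fun x => qav x + sigma_eff q lambda eps x) k
                  - k_over_transmission (fun x => V x (x / eps)) k))%:E
         | k in K]
       <= (eps ^+ 3)%:E * M_bound qav K
          * (C (fine (N_norm beta qav q)) (sup [set normc k | k in K]))%:E)%E.
Proof.
move=> theta0 beta0 alpha0 alphab.
(* Any rate strictly between would do: above [alpha] for the kernel bound, below [beta / 2] for the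
   integrability of products of two solutions. *)
pose a := (alpha + beta / 2) / 2.
have ala : alpha < a by rewrite /a; lra.
have abe : a < beta / 2 by rewrite /a; lra.
(* The shift by 2 is the slack in the weights of the modes. The absolute value and the 1 make the
   constant positive for all real arguments, also those that are not norms. *)
exists (fun N kappa => `|core_const alpha a beta (potential_bound theta (N + 2)) kappa theta
  (N + 2)| + 1); split=> [N kappa|V qav q lambda K hV hK].
  by rewrite ltr_wpDl.
(* The only smallness used is [eps <= 1]. *)
exists 1; split=> // eps e0 e1; apply: ge_ereal_sup => _ [k Kk <-].
set N := fine _; set kappa := sup _.
set c := _ + 1.
have c0 : 0 < c by rewrite ltr_wpDl.
have hk : `|complex.Im k| <= alpha by rewrite ltW// (K_strip hK).
have hkap : normc k <= kappa by exact: compact_normc_le_sup (K_compact hK) Kk.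
have est := scattering_estimate theta0 alpha0 ala abe hV e0 (ltW e1) hk hkap erefl.
have {}est : normc (k_over_transmission (fun x => qav x + sigma_eff q lambda eps x) k
    - k_over_transmission (fun x => V x (x / eps)) k) <= eps ^+ 3 * c.
  (* The quotient is linear in the Wronskian, with a factor of modulus at most 1. *)
  rewrite /k_over_transmission -mulrBl opprK addrC normcM mulrC.
  apply: le_trans (ler_piMl (normc_ge0 _) normc_inv_2i) _.
  apply: le_trans est _; rewrite [leLHS]mulrC ler_wpM2l ?exprn_ge0 ?(ltW e0)//.
  by rewrite (le_trans (ler_norm _))// lerDl.
(* The factor 1 is then replaced by [M_bound], which is a maximum with 1. *)
apply: (@le_trans _ _ ((eps ^+ 3)%:E * 1 * c%:E)%E).
  by rewrite mule1 -EFinM lee_fin.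
apply: lee_wpmul2r; first by rewrite lee_fin ltW.
apply: lee_wpmul2l; first by rewrite lee_fin exprn_ge0// ltW.
by rewrite /M_bound le_max lexx.
Qed.
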